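(* Let $m\ge 1$ be an integer. Let $\varphi\in C^0([0,\infty))\cap C^1((0,\infty))$ with $\varphi(0)=0$ and $\varphi'>0$ on $(0,\infty)$. Let $f\in C^0([0,\infty))$ be strictly increasing on $[0,\infty)$ with $f>0$ on $(0,\infty)$. Let $l\in C^0([0,\infty))$ with $l>0$ on $(0,\infty)$, and suppose that $l$ is $C$-monotone non-decreasing for some $C\ge 1$, i.e. $\sup_{s\in[0,t]} l(s)\le C\,l(t)$ for all $t\ge 0$. Suppose that $$\frac{t\varphi'(t)}{l(t)}\in L^1(0^+)\setminus L^1(+\infty),\qquad \frac{\varphi(t)}{l(t)}=o(1)\ \text{ as } t\to 0^+ .$$ Suppose further that there are constants $D,\Lambda>0$ and $\tau\ge 0$ such that $$s\varphi'(st)\le D s^{\tau}\varphi'(t)\quad \forall\, s\in(0,1],\ t\in(0,\infty),\qquad s^{1+\tau}l(t)\le \Lambda\, l(st)\quad\forall\, s\in[0,1],\ t\in[0,\infty).$$ Then every non-negative bounded weak solution $u\in C^1(H^m)$ of $$\Delta^\varphi_{H^m}u\ \ge\ f(u)\,l(|\nabla_{H^m}u|_{H^m})\qquad\text{on } H^m$$ is constant; moreover, if $l(0)>0$, then $u\equiv 0$.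
   Context: $H^m$ is the Heisenberg group: the manifold $\mathbb{R}^{2m+1}$ with points $q=(z,t)=(x_1,\dots,x_m,y_1,\dots,y_m,t)$ and group law $q\circ q'=\left(z+z',\,t+t'+2\sum_{i=1}^m (y_ix_i'-x_iy_i')\right)$. Its horizontal left-invariant vector fields are $X_j=\frac{\partial}{\partial x_j}+2y_j\frac{\partial}{\partial t}$, $Y_j=\frac{\partial}{\partial y_j}-2x_j\frac{\partial}{\partial t}$, $j=1,\dots,m$. For $C^1$ functions $u,v$: $\nabla_{H^m}u=\sum_j (X_ju)X_j+(Y_ju)Y_j$, $\nabla_{H^m}u\cdot\nabla_{H^m}v=\sum_j (X_ju)(X_jv)+(Y_ju)(Y_jv)$, and $|\nabla_{H^m}u|_{H^m}^2=\nabla_{H^m}u\cdot\nabla_{H^m}u$. The $\varphi$-Laplacian is $\Delta^\varphi_{H^m}u=\sum_{j}\left[X_j\left(|\nabla_{H^m}u|_{H^m}^{-1}\varphi(|\nabla_{H^m}u|_{H^m})X_ju\right)+Y_j\left(|\nabla_{H^m}u|_{H^m}^{-1}\varphi(|\nabla_{H^m}u|_{H^m})Y_ju\right)\right]$. The differential inequality is understood weakly: $u\in C^1(H^m)$ and, for all $\zeta\in C_0^\infty(H^m)$ with $\zeta\ge 0$, $$-\int_{\mathbb{R}^{2m+1}}|\nabla_{H^m}u|_{H^m}^{-1}\varphi(|\nabla_{H^m}u|_{H^m})\,\nabla_{H^m}u\cdot\nabla_{H^m}\zeta\ \ge\ \int_{\mathbb{R}^{2m+1}}f(u)\,l(|\nabla_{H^m}u|_{H^m})\,\zeta$$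 (Lebesgue measure; the integrand on the left is $0$ where $\nabla_{H^m}u=0$). $L^1(0^+)$, resp. $L^1(+\infty)$, means integrable in a right neighbourhood of $0$, resp. in a neighbourhood of $+\infty$. *)

(* Defs.v *)
From HB Require Import structures.
From mathcomp Require Import all_boot all_order all_algebra.
From mathcomp Require Import all_classical all_reals all_analysis.

Set Implicit Arguments.
Unset Strict Implicit.
Unset Printing Implicit Defensive.

Import Order.TTheory GRing.Theory Num.Theory.
Import numFieldNormedType.Exports.

Local Open Scope classical_set_scope.
Local Open Scope ring_scope.

(* Lebesgue measure on R^n, as the iterated product of [lebesgue_measure]
   carried to n-tuples, which bear the product (Borel) sigma-algebra. *)
Section lebesgue_tuple.
Context {R : realType}.
Local Notation RR := (measurableTypeR R).

Definition tuple_cons n (p : RR * n.-tuple RR) : n.+1.-tuple RR :=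
  [tuple of p.1 :: p.2].

Lemma measurable_tuple_cons n : measurable_fun setT (@tuple_cons n).
Proof. exact: measurable_cons. Qed.

Section step.
Variables (n : nat) (nu : {sigma_finite_measure set RR -> \bar R})
  (mu : {sigma_finite_measure set (n.-tuple RR) -> \bar R}).

Definition tuple_measure_step : set (n.+1.-tuple RR) -> \bar R :=
  pushforward (nu \x mu)%E (@tuple_cons n).

Let step0 : tuple_measure_step set0 = 0%E.
Proof. by rewrite /tuple_measure_step /pushforward preimage_set0 measure0. Qed.

Let step_ge0 A : (0 <= tuple_measure_step A)%E.
Proof. by rewrite /tuple_measure_step /pushforward; exact: measure_ge0. Qed.

Let step_sigma_additive : semi_sigma_additive tuple_measure_step.
Proof.
have mc := @measurable_tuple_cons n.
move=> F mF tF mUF; rewrite /tuple_measure_step /pushforward preimage_bigcup.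
apply: measure_semi_sigma_additive.
- by move=> k; rewrite -[X in measurable X]setTI; exact: mc.
- apply/trivIsetP => /= i j _ _ ij; rewrite -preimage_setI.
  by move/trivIsetP : tF => /(_ _ _ _ _ ij) ->//; rewrite preimage_set0.
- by rewrite -preimage_bigcup -[X in measurable X]setTI; exact: mc.
Qed.

HB.instance Definition _ := isMeasure.Build _ _ _ tuple_measure_step
  step0 step_ge0 step_sigma_additive.

Let step_sigma_finite : sigma_finite setT tuple_measure_step.
Proof.
have /sigma_finiteP[F [TF ndF Foo]] := sigma_finiteT nu.
have /sigma_finiteP[G [TG ndG Goo]] := sigma_finiteT mu.
exists (fun k => [set t : n.+1.-tuple RR |
    F k (tnth t ord0) /\ G k [tuple of behead t]]).
  apply/esym; rewrite -subTset => t _.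
  have : setT (tnth t ord0) by []. have : setT [tuple of behead t] by [].
  rewrite {1}TF {1}TG => -[j _ Gj] [k _ Fk]; exists (maxn k j) => //; split.
    by move: Fk; exact/subsetPset/ndF/leq_maxl.
  by move: Gj; exact/subsetPset/ndG/leq_maxr.
move=> k; have [mF Fk] := Foo k; have [mG Gk] := Goo k; split.
  apply: measurableI; rewrite -[X in measurable X]setTI.
    exact: (@measurable_tnth _ RR).
  exact: measurable_behead.
rewrite /tuple_measure_step /pushforward (_ : _ @^-1` _ = F k `*` G k).
  by rewrite product_measure1E// lte_mul_pinfty// ge0_fin_numE.
have consK (x : RR) (t : n.-tuple RR) :
  [tuple of behead (tuple_cons (x, t))] = t by exact/val_inj.
by apply/funext => -[x t]; rewrite /preimage /setX /= consK.
Qed.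

HB.instance Definition _ := Measure_isSigmaFinite.Build _ _ _ tuple_measure_step
  step_sigma_finite.

End step.

Fixpoint lebesgue_tuple (n : nat) :
    {sigma_finite_measure set (n.-tuple RR) -> \bar R} :=
  if n is n'.+1 then tuple_measure_step lebesgue_measure (lebesgue_tuple n')
  else \d_([tuple] : 0.-tuple RR).

Lemma lebesgue_tuple_box n (A : 'I_n -> set RR) :
  (forall i, measurable (A i)) ->
  lebesgue_tuple n [set t | forall i, A i (tnth t i)] =
  (\prod_(i < n) lebesgue_measure (A i))%E.
Proof.
elim: n A => [|n IH] A mA /=.
  rewrite big_ord0 diracE (_ : (_ \in _) = true)//.
  by apply/mem_set; case.
rewrite big_ord_recl /tuple_measure_step /pushforward.
rewrite (_ : _ @^-1` _ =
    A ord0 `*` [set t | forall i, A (lift ord0 i) (tnth t i)]).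
  rewrite product_measure1E//; first by congr (_ * _)%E; exact: IH.
  rewrite (_ : [set _ | _] = \big[setI/setT]_(i < n)
    ((fun t => tnth t i) @^-1` A (lift ord0 i))).
    apply: bigsetI_measurable => i _; rewrite -[X in measurable X]setTI.
    exact: (@measurable_tnth _ RR).
  apply/seteqP; split => t /=.
    by move=> h; rewrite -bigcap_seq => i _; exact: h.
  by rewrite -bigcap_seq => h i; apply: (h i); rewrite /= mem_index_enum.
apply/seteqP; split => -[x t] /=.
  move=> h; split => [|i]; first exact: (h ord0).
  by have := h (lift ord0 i); rewrite /tuple_cons tnthS.
move=> [h0 h] i; case: (unliftP ord0 i) => [j|] -> //.
by rewrite /tuple_cons tnthS; exact: h.
Qed.

Definition lebesgue_int n (F : 'rV[R]_n -> R) : R :=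
  \int[lebesgue_tuple n]_(t in setT) F (\row_i tnth t i).

End lebesgue_tuple.

Section Ck.
Context {R : realType} {n : nat}.
Implicit Types (u : 'rV[R]_n -> R) (i : 'I_n) (q : 'rV[R]_n).

Definition partial i u q : R := 'D_(delta_mx 0 i) u q.

Fixpoint Ck (k : nat) u : Prop :=
  continuous u /\
  if k is k'.+1 then
    (forall i q, derivable u q (delta_mx 0 i)) /\ (forall i, Ck k' (partial i u))
  else True.

Definition test_function (zeta : 'rV[R]_n -> R) : Prop :=
  (forall k, Ck k zeta) /\ compact (closure [set q | zeta q != 0]).

End Ck.

Section Heisenberg.
Context {R : realType} {m : nat}.

(* A point is the row (x_1, .., x_m, y_1, .., y_m, t). *)
Definition Hpoint := 'rV[R]_(m + m + 1).

Definition idx_x (j : 'I_m) : 'I_(m + m + 1) := lshift 1 (lshift m j).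
Definition idx_y (j : 'I_m) : 'I_(m + m + 1) := lshift 1 (rshift m j).
Definition idx_t : 'I_(m + m + 1) := rshift (m + m) ord0.

Implicit Types (u v : Hpoint -> R) (q : Hpoint).

Definition HX (j : 'I_m) u q : R :=
  partial (idx_x j) u q + 2 * q 0 (idx_y j) * partial idx_t u q.
Definition HY (j : 'I_m) u q : R :=
  partial (idx_y j) u q - 2 * q 0 (idx_x j) * partial idx_t u q.

Definition hgrad_dot u v q : R :=
  \sum_(j < m) (HX j u q * HX j v q + HY j u q * HY j v q).
Definition hgrad_norm u q : R := Num.sqrt (hgrad_dot u u q).

(* Since 0^-1 = 0, the left integrand vanishes where the gradient of u does. *)
Definition weak_subsolution (phi f l : R -> R) u : Prop :=
  Ck 1 u /\
  forall zeta : Hpoint -> R, test_function zeta -> (forall q, 0 <= zeta q) ->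
    - lebesgue_int (fun q =>
        (hgrad_norm u q)^-1 * phi (hgrad_norm u q) * hgrad_dot u zeta q)
    >= lebesgue_int (fun q => f (u q) * l (hgrad_norm u q) * zeta q).

End Heisenberg.

Arguments Hpoint : clear implicits.

Section OneVariable.
Context {R : realType}.
Implicit Types g l : R -> R.

Definition C_monotone_nondecreasing (C : R) l : Prop :=
  forall t, 0 <= t -> sup (l @` `[0, t]) <= C * l t.

Definition L1_right_of_0 g : Prop :=
  exists2 e : R, 0 < e & lebesgue_measure.-integrable `]0, e[ (EFin \o g).

Definition L1_near_pinfty g : Prop :=
  exists A : R, lebesgue_measure.-integrable `]A, +oo[ (EFin \o g).

End OneVariable.

(* Main.v *)
(* Let [r] be the Koranyi gauge at a centre [c], [v = delta r] and
   [s = sqrt rho / r = |grad r|, 0 < s <= 1] off the vertical axis [rho = 0].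
   The phi-Laplacian of [v] is [(2m+1) s phi(delta s) / r]; by the two scaling
   hypotheses, where [r > B] it is at most
   [((2m+1) D Lambda / B) (phi(delta) / l(delta)) l(delta s)], hence below
   [f(a) l(delta s)], for any given [a > 0], once [delta] is small.
   If a bounded solution [u] is not constant, choose [p] and [kappa > 0] with
   [u < sup u - kappa] near [p], centres near [p], and [delta] small: then
   [u - v] attains its maximum where [u > sup u - kappa], so at points with
   [r > B] and, the gradients of [u] and [v] being equal there, with
   phi-Laplacian of [v] smaller than [f(u) l(|grad u|)]. Testing the inequality
   with [((u - v - K)^+)^2] for [K] just below the maximum contradicts the
   monotonicity of [X |-> |X|^-1 phi(|X|) X].
   On the axis of the gauge [v] degenerates: using three centres near [p] that
   form a horizontal triangle, a far point on the axis of one of them is strictly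
   closer to another, so the centre giving the largest maximum has no maximum
   point on its own axis. *)

Require Import Defs.
From HB Require Import structures.
From mathcomp Require Import all_boot all_order all_algebra.
From mathcomp Require Import all_classical all_reals all_analysis.
From mathcomp Require Import ring lra.

Set Implicit Arguments.
Unset Strict Implicit.
Unset Printing Implicit Defensive.

Import Order.TTheory GRing.Theory Num.Theory.
Import numFieldNormedType.Exports.

Local Open Scope classical_set_scope.
Local Open Scope ring_scope.

(** Since [u] is only C^1, the two phi-Laplacians cannot be compared through second derivatives at a
    maximum point. The strict inequality there is an open condition on [u], its gradient and the
    gauge; compactness extends it to a whole superlevel set of [u - v], where it is integrated. The
    field of [v] is C^1 off the axis, so its divergence is computed exactly and enters through the
    divergence theorem; only the field of [u] is treated weakly. The weak inequality speaks of
    smooth test functions, but the test function built from [u] is no more regular than [u]. The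
    square makes the positive part C^1, and the inequality is carried over to C^1 test functions by
    approximating them uniformly together with their first derivatives. Splines do this rather than
    mollifiers: an approximant is a finite sum of products of one-variable functions, so smoothness,
    sign and support are read off and no integral is differentiated under its sign. A maximum exists
    because [u] is bounded and [delta * gr c] tends to infinity; the same fact makes the support of
    the test function compact. *)

Section pointwise_continuity.
Context {R : realType} {T : topologicalType}.
Implicit Types (f g : T -> R) (x : T).

Lemma contD f g x : {for x, continuous f} -> {for x, continuous g} ->
  {for x, continuous (fun y => f y + g y)}.
Proof. exact: continuousD. Qed.

Lemma contB f g x : {for x, continuous f} -> {for x, continuous g} ->
  {for x, continuous (fun y => f y - g y)}.
Proof. exact: continuousB. Qed.

Lemma contM f g x : {for x, continuous f} -> {for x, continuous g} ->
  {for x, continuous (fun y => f y * g y)}.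
Proof. exact: continuousM. Qed.

Lemma contC (c : R) x : {for x, continuous (fun _ : T => c)}.
Proof. exact: cst_continuous. Qed.

Lemma cont_comp (F : R -> R) f x : {for x, continuous f} ->
  {for f x, continuous F} -> {for x, continuous (fun y => F (f y))}.
Proof. exact: continuous_comp. Qed.

Lemma cont_sum (I : Type) (r : seq I) (P : pred I) (F : I -> T -> R) x :
  (forall i, P i -> {for x, continuous (F i)}) ->
  {for x, continuous (fun y => \sum_(i <- r | P i) F i y)}.
Proof.
move=> cF; elim: r => [|i r IH].
  rewrite (_ : (fun y => _) = (fun=> 0)); first exact: contC.
  by apply/funext => y; rewrite big_nil.
rewrite (_ : (fun y => _) = (fun y => (if P i then F i y else 0) +
  \sum_(i <- r | P i) F i y)); last first.
  by apply/funext => y; rewrite big_cons; case: ifP; rewrite ?add0r.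
by apply: contD => //; case Pi : (P i); [exact: cF|exact: contC].
Qed.

End pointwise_continuity.

(** * Derivatives and smooth functions *)

Section directional_derivatives.
Context {R : realType} {V : normedModType R}.
Implicit Types (g : V -> R) (q v : V).

(** Restricting to the line through [q] makes the one-variable chain rule and mean value theorem
    available for directional derivatives. *)
Lemma is_derive_line g q v (b : R) :
  is_derive q v g b <-> is_derive (0 : R) 1 (fun h : R => g (h *: v + q)) b.
Proof.
have E : 'D_v g q = 'D_1 (fun h : R => g (h *: v + q)) 0.
  rewrite /derive; set g1 := fun h => h^-1 *: _; set g2 := fun h => h^-1 *: _.
  suff -> : g1 = g2 by [].
  by apply/funext => h /=; rewrite /g1 /g2 /= !addr0 scale0r add0r /GRing.scale/= mulr1.
have [l2r r2l] := derivable1P g q v.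
by split=> -[dg dgE]; split; rewrite -?dgE ?E//; [exact: l2r|exact: r2l].
Qed.

Lemma is_derive_compR (F : R -> R) g q v (a b : R) :
  is_derive (g q) 1 F a -> is_derive q v g b -> is_derive q v (fun x => F (g x)) (a * b).
Proof.
move=> dF /is_derive_line dg; apply/is_derive_line.
apply: (@is_derive1_comp _ F (fun h : R => g (h *: v + q))).
by rewrite scale0r add0r.
Qed.

Lemma is_derive_mul g k q v (a b : R) : is_derive q v g a -> is_derive q v k b ->
  is_derive q v (fun x => g x * k x) (g q * b + k q * a).
Proof. by move=> dg dk; have := is_deriveM dg dk. Qed.

Lemma is_derive_add g k q v (a b : R) : is_derive q v g a -> is_derive q v k b ->
  is_derive q v (fun x => g x + k x) (a + b).
Proof. by move=> dg dk; have := is_deriveD dg dk. Qed.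

Lemma is_derive_sub g k q v (a b : R) : is_derive q v g a -> is_derive q v k b ->
  is_derive q v (fun x => g x - k x) (a - b).
Proof. by move=> dg dk; have := is_deriveB dg dk. Qed.

Lemma is_derive_scale (c : R) g q v (a : R) : is_derive q v g a ->
  is_derive q v (fun x => c * g x) (c * a).
Proof. by move=> dg; have := is_deriveZ c dg. Qed.

Lemma is_derive1_max (G : R -> R) (x b : R) :
  is_derive x 1 G b -> (forall y, G y <= G x) -> b = 0.
Proof.
move=> /is_derive1_caratheodory[g [gE cg gx]] Gmax.
(* [s] is the sign of [b]. The Caratheodory slope [g] keeps that sign near [x], so a small move in
   direction [s] would increase [G]. *)
have key (s : R) : 0 < s * b -> `|s| = 1 -> False.
  move=> sb s1.
  have : \forall z \near x, 0 < s * g z.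
    have : {for x, continuous (fun z => s * g z)} by apply: contM => //; exact: contC.
    by move/cvgr_gt; apply; rewrite gx.
  move=> /nbhs_ballP[e /= e0 be].
  pose z := x + e / 2 * s.
  have : ball x e z.
    rewrite /ball/= /z opprD addrA subrr sub0r normrN normrM s1 mulr1.
    by rewrite gtr0_norm ?divr_gt0// ltr_pdivrMr// ltr_pMr// ltr1n.
  move=> /be sgz.
  have zx : z - x = e / 2 * s by rewrite /z; ring.
  have := Gmax z; rewrite -subr_le0 gE zx => h1.
  have : 0 < e / 2 * (s * g z) by rewrite mulr_gt0// divr_gt0.
  rewrite ltNge => /negP; apply; apply: le_trans h1.
  by rewrite le_eqVlt; apply/orP; left; apply/eqP; ring.
case: (ltgtP b 0) => // b0.
- by exfalso; apply: (key (-1)); rewrite ?mulN1r ?oppr_gt0// normrN normr1.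
- by exfalso; apply: (key 1); rewrite ?mul1r ?normr1.
Qed.

Lemma is_derive_max g q v b :
  is_derive q v g b -> (forall q', g q' <= g q) -> b = 0.
Proof.
move=> /is_derive_line dg gmax; apply: (is_derive1_max dg) => y.
by rewrite scale0r add0r.
Qed.

End directional_derivatives.

Section coordinates.
Context {R : realType} {n : nat}.
Implicit Types (q v : 'rV[R]_n) (i j : 'I_n).

Lemma is_derive_coord i q v : is_derive q v (fun q => q 0 i) (v 0 i).
Proof.
apply/is_derive_line.
have -> : (fun h : R => (h *: v + q) 0 i) = (fun h => v 0 i *: h + q 0 i).
  by apply/funext => h; rewrite !mxE mulrC.
by apply: is_derive_eq; rewrite addr0 /GRing.scale/= mulr1.
Qed.

Lemma continuous_coord i : continuous (fun q => q 0 i).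
Proof. exact: coord_continuous. Qed.

Lemma is_derive_partial (f : 'rV[R]_n -> R) i q b :
  is_derive q (delta_mx 0 i) f b -> partial i f q = b.
Proof. by case. Qed.

End coordinates.

Section Ck_closure.
Context {R : realType} {n : nat}.
Implicit Types (f g : 'rV[R]_n -> R) (k : nat) (i : 'I_n).

Lemma Ck_continuous k f : Ck k f -> continuous f.
Proof. by case: k => [|k] []. Qed.

Lemma CkW k f : Ck k.+1 f -> Ck k f.
Proof.
elim: k f => [|k IH] f [cf [df Cf]]; split => //; split => // i.
exact/IH/Cf.
Qed.

Lemma Ck_cst k (c : R) : Ck k (fun _ : 'rV[R]_n => c).
Proof.
elim: k c => [|k IH] c; first by split => //; exact: cst_continuous.
split; first exact: cst_continuous.
split => [i q|i]; first exact: derivable_cst.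
have -> : partial i (fun _ : 'rV[R]_n => c) = (fun _ => 0).
  by apply/funext => q; exact: derive_cst.
exact: IH.
Qed.

Lemma CkD k f g : Ck k f -> Ck k g -> Ck k (fun q => f q + g q).
Proof.
elim: k f g => [|k IH] f g Cf Cg.
  by split=> // q; apply: contD; [exact: Cf.1|exact: Cg.1].
have [cf [df pf]] := Cf; have [cg [dg pg]] := Cg.
split=> [q|]; first by apply: contD; [exact: cf|exact: cg].
split => [i q|i]; first exact: derivableD.
have -> : partial i (fun q => f q + g q) = (fun q => partial i f q + partial i g q).
  by apply/funext => q; rewrite /partial deriveD.
by apply: IH; [exact: pf|exact: pg].
Qed.

Lemma CkM k f g : Ck k f -> Ck k g -> Ck k (fun q => f q * g q).
Proof.
elim: k f g => [|k IH] f g Cf Cg.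
  by split=> // q; apply: contM; [exact: Cf.1|exact: Cg.1].
have [cf [df pf]] := Cf; have [cg [dg pg]] := Cg.
split=> [q|]; first by apply: contM; [exact: cf|exact: cg].
split => [i q|i]; first exact: derivableM.
have -> : partial i (fun q => f q * g q) =
    (fun q => f q * partial i g q + g q * partial i f q).
  by apply/funext => q; rewrite /partial deriveM.
exact: CkD (IH _ _ (CkW Cf) (pg i)) (IH _ _ (CkW Cg) (pf i)).
Qed.

Lemma Ck_sum k (I : Type) (r : seq I) (P : pred I) (F : I -> 'rV[R]_n -> R) :
  (forall j, P j -> Ck k (F j)) -> Ck k (fun q => \sum_(j <- r | P j) F j q).
Proof.
move=> CF; elim: r => [|x r IH].
  under eq_fun do rewrite big_nil; exact: Ck_cst.
under eq_fun do rewrite big_cons.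
by case Px : (P x) => //; apply: CkD => //; exact: CF.
Qed.

Lemma Ck_prod k (I : Type) (r : seq I) (P : pred I) (F : I -> 'rV[R]_n -> R) :
  (forall j, P j -> Ck k (F j)) -> Ck k (fun q => \prod_(j <- r | P j) F j q).
Proof.
move=> CF; elim: r => [|x r IH].
  under eq_fun do rewrite big_nil; exact: Ck_cst.
under eq_fun do rewrite big_cons.
by case Px : (P x) => //; apply: CkM => //; exact: CF.
Qed.

End Ck_closure.

(** * Smooth functions of one real variable *)

Section smooth_line.
Context {R : realType}.
Implicit Types (f g : R -> R) (k : nat).

Fixpoint C1d k f : Prop :=
  continuous f /\
  if k is k'.+1 then (forall x, derivable f x 1) /\ C1d k' (derive1 f) else True.

Definition smooth f := forall k, C1d k f.

Lemma C1d_continuous k f : C1d k f -> continuous f.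
Proof. by case: k => [|k] []. Qed.

Lemma C1dW k f : C1d k.+1 f -> C1d k f.
Proof.
elim: k f => [|k IH] f [cf [df Cf]]; split => //; split => //.
exact/IH/Cf.
Qed.

Lemma derivable_continuous1 f : (forall x, derivable f x 1) -> continuous f.
Proof.
by move=> df x; exact/differentiable_continuous/derivable1_diffP.
Qed.

Lemma C1dS k f (df : R -> R) : (forall x : R, is_derive x 1 f (df x)) -> C1d k df -> C1d k.+1 f.
Proof.
move=> H Cdf.
have d x : derivable f x 1 by case: (H x).
split; first exact: derivable_continuous1.
split => //; rewrite (_ : derive1 f = df)//.
by apply/funext => x; rewrite derive1E; case: (H x).
Qed.

Lemma C1d_is_derive k f (x : R) : C1d k.+1 f -> is_derive x 1 f (derive1 f x).
Proof. by move=> [_ [df _]]; split; rewrite ?derive1E. Qed.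

Lemma C1dD k f g : C1d k f -> C1d k g -> C1d k (fun x => f x + g x).
Proof.
elim: k f g => [|k IH] f g Cf Cg.
  by split=> // q; apply: contD; [exact: Cf.1|exact: Cg.1].
apply: (@C1dS _ _ (fun x => derive1 f x + derive1 g x)).
  by move=> x; apply: is_deriveD; apply: C1d_is_derive; [exact: Cf|exact: Cg].
by apply: IH; [exact: Cf.2.2|exact: Cg.2.2].
Qed.

Lemma C1dM k f g : C1d k f -> C1d k g -> C1d k (fun x => f x * g x).
Proof.
elim: k f g => [|k IH] f g Cf Cg.
  by split=> // q; apply: contM; [exact: Cf.1|exact: Cg.1].
apply: (@C1dS _ _ (fun x => f x * derive1 g x + g x * derive1 f x)).
  by move=> x; apply: is_deriveM; apply: C1d_is_derive; [exact: Cf|exact: Cg].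
by apply: C1dD; apply: IH; by [exact: C1dW|exact: Cf.2.2|exact: Cg.2.2].
Qed.

Lemma C1d_cst k (c : R) : C1d k (fun _ => c).
Proof.
elim: k c => [|k IH] c; first by split => //; exact: cst_continuous.
by apply: (C1dS (df := fun _ => 0)); exact: IH.
Qed.

Lemma is_derive_affine (a b x : R) : is_derive x 1 (fun x : R => a * x + b) a.
Proof. by apply: is_derive_eq; rewrite addr0 /GRing.scale/= mulr1. Qed.

Lemma C1d_affine k f (a b : R) : C1d k f -> C1d k (fun x => f (a * x + b)).
Proof.
elim: k f => [|k IH] f Cf.
  split=> // x; apply: (@continuous_comp _ _ _ (fun x => a * x + b) f); last exact: Cf.1.
  by have [+ _] := is_derive_affine a b x => /derivable1_diffP/differentiable_continuous.
apply: (@C1dS _ _ (fun x => derive1 f (a * x + b) * a)).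
  by move=> x; apply: (@is_derive1_comp _ f (fun x => a * x + b));
    [apply: C1d_is_derive; exact: Cf|exact: is_derive_affine].
by apply: C1dM; [exact: IH Cf.2.2|exact: C1d_cst].
Qed.

Lemma Ck_coord n k f (i : 'I_n) : C1d k f -> Ck k (fun q : 'rV[R]_n => f (q 0 i)).
Proof.
elim: k f => [|k IH] f Cf.
  by split=> // q; apply: continuous_comp; [exact: continuous_coord|exact: Cf.1].
have D (j : 'I_n) (q : 'rV[R]_n) : is_derive q (delta_mx 0 j) (fun q : 'rV[R]_n => f (q 0 i))
    (derive1 f (q 0 i) * (i == j)%:R).
  apply: (@is_derive_compR _ _ f (fun q : 'rV[R]_n => q 0 i)); first by apply: C1d_is_derive; exact: Cf.
  apply: is_derive_eq; first exact: is_derive_coord.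
  by rewrite mxE eqxx.
split.
  by move=> q; apply: continuous_comp; [exact: continuous_coord|exact: Cf.1].
split=> [j q|j]; first by case: (D j q).
have -> : partial j (fun q : 'rV[R]_n => f (q 0 i)) =
    (fun q => derive1 f (q 0 i) * (i == j)%:R).
  by apply/funext => q; case: (D j q).
by apply: CkM; [exact: IH Cf.2.2|exact: Ck_cst].
Qed.

End smooth_line.

(** * A smooth partition of unity on the line *)

Section flat_exponential.
Context {R : realType}.
Implicit Types (p : {poly R}) (x : R).

(** The polynomial factor in 1/x closes the family under differentiation, so smoothness of the flat
    exponential follows by one induction over all [p]. *)
Definition flat_exp p x : R := if 0 < x then p.[x^-1] * expR (- x^-1) else 0.

Lemma flat_exp_le0 p x : x <= 0 -> flat_exp p x = 0.
Proof. by move=> x0; rewrite /flat_exp ltNge x0. Qed.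

(** Splitting off a factor x gives both the linear bound near 0 and the difference quotient at 0. *)
Lemma flat_exp_mulX p x : flat_exp p x = flat_exp (p * 'X) x * x.
Proof.
rewrite /flat_exp; case: ifPn => [x0|_]; last by rewrite mul0r.
by rewrite hornerMX; field; rewrite gt_eqF.
Qed.

(** Each monomial is bounded by a factorial times the exponential, because y^k / k! is a term of its
    series. *)
Lemma horner_le_expR p : exists2 C : R, 0 <= C & forall y, 0 < y -> `|p.[y]| <= C * expR y.
Proof.
exists (\sum_(i < size p) `|p`_i| * (i.+1)`!%:R) => [|y y0].
  by apply: sumr_ge0 => i _; rewrite mulr_ge0.
rewrite horner_coef mulr_suml; apply: le_trans (ler_norm_sum _ _ _) _.
apply: ler_sum => i _; rewrite normrM -mulrA ler_wpM2l// normrX gtr0_norm//.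
have fact0 n : 0 < n`!%:R :> R by rewrite ltr0n fact_gt0.
have e1 : 1 <= expR y by apply: le_trans (expR_ge1Dx y); rewrite lerDl ltW.
case: (nat_of_ord i) => [|k].
  by rewrite expr0 (le_trans e1)// ler_peMl ?expR_ge0// ler1n.
apply: (@le_trans _ _ (k.+1`!%:R * expR y)).
  rewrite mulrC -ler_pdivrMr//; apply: le_trans (expR_ge1Dxn k (ltW y0)).
  by rewrite lerDr.
by rewrite ler_wpM2r ?expR_ge0// ler_nat [k.+2`!]factS leq_pmull.
Qed.

Lemma flat_exp_le p : exists2 C : R, 0 <= C & forall x, `|flat_exp p x| <= C * `|x|.
Proof.
have [C C0 pC] := horner_le_expR (p * 'X); exists C => // x.
rewrite flat_exp_mulX normrM ler_wpM2r//.
rewrite /flat_exp; case: ifPn => [x0|_]; last by rewrite normr0.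
rewrite normrM (gtr0_norm (expR_gt0 _)) expRN ler_pdivrMr ?expR_gt0//.
by rewrite pC// invr_gt0.
Qed.

Lemma flat_exp_continuous0 p : {for 0, continuous (flat_exp p)}.
Proof.
have [C C0 pC] := flat_exp_le p.
rewrite /prop_for/continuous_at {2}/flat_exp ltxx.
apply/cvgr0Pnorm_le => e e0.
have d0 : 0 < e / (C + 1) by rewrite divr_gt0// ltr_wpDl.
apply/nbhs_ballP; exists (e / (C + 1)) => //= x; rewrite /ball/= sub0r normrN => xe.
apply: le_trans (pC x) _; apply: (@le_trans _ _ (C * (e / (C + 1)))).
  by rewrite ler_wpM2l// ltW.
by rewrite mulrCA ger_pMr// ler_pdivrMr ?mul1r ?lerDl// ltr_wpDl.
Qed.

Lemma flat_exp_derive p x :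
  is_derive x 1 (flat_exp p) (flat_exp ((p - p^`()) * 'X^2) x).
Proof.
case: (ltgtP x 0) => x0.
- rewrite flat_exp_le0 ?ltW//; apply: (near_eq_is_derive (f := cst 0)).
  by near=> z; rewrite /= flat_exp_le0//; apply/ltW; near: z; exact: lt_nbhsl.
- have xn0 : x != 0 by rewrite gt_eqF.
  have dV : is_derive x 1 (fun y : R => y^-1) (- x ^- 2).
    rewrite -[X in is_derive _ _ _ X]mulr1.
    exact: (is_deriveV (f := id) xn0 (is_derive_id _ _)).
  pose g (y : R) : R := p.[y^-1] * expR (- y^-1).
  apply: (near_eq_is_derive (f := g)).
    by near=> z; rewrite /flat_exp ifT//; near: z; exact: lt_nbhsr.
  have dp : is_derive x 1 (fun y : R => p.[y^-1]) (p^`().[x^-1] * (- x ^- 2)).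
    exact: (@is_derive1_comp _ (horner p) (fun y : R => y^-1)).
  have de : is_derive x 1 (fun y : R => expR (- y^-1)) (expR (- x^-1) * - (- x ^- 2)).
    exact: (@is_derive1_comp _ expR (fun y : R => - y^-1)).
  rewrite /g; apply: is_derive_eq; rewrite /flat_exp x0 !hornerE /GRing.scale/=.
  by field.
(* At 0 the slope function is [flat_exp (p * 'X)], which is continuous there with value 0. *)
- rewrite x0 flat_exp_le0//; apply/is_derive1_caratheodory.
  exists (flat_exp (p * 'X)); split.
  + by move=> z; rewrite subr0 (flat_exp_le0 p (lexx 0)) subr0 -flat_exp_mulX.
  + exact: flat_exp_continuous0.
  + by rewrite flat_exp_le0.
Unshelve. all: by end_near. Qed.

Lemma smooth_flat_exp p : smooth (flat_exp p).
Proof.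
move=> k; elim: k p => [|k IH] p.
  split=> //; apply: derivable_continuous1 => x.
  by have [] := flat_exp_derive p x.
exact: C1dS (flat_exp_derive p) (IH _).
Qed.

End flat_exponential.

Section spline.
Context {R : realType}.
Implicit Types (f F G : R -> R) (x y : R).

Lemma primitive_from0 f : continuous f -> (forall x, x <= 0 -> f x = 0) ->
  exists2 F, (forall x, is_derive x 1 F (f x)) & forall x, x <= 0 -> F x = 0.
Proof.
move=> cf f0.
(* Starting at -1 rather than 0 makes 0 an interior point, so the fundamental theorem covers every x
   >= 0 at once. *)
pose F x := (\int[lebesgue_measure]_(t in [set` `[(-1)%R, x]]) (f t))%R.
have F0 x : x <= 0 -> F x = 0.
  move=> x0; rewrite /F; under eq_Rintegral => t.
    rewrite inE/= in_itv/= => /andP[_ tx].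
    rewrite f0; last exact: le_trans tx x0.
    over.
  by rewrite /Rintegral integral0.
exists F => // x; case: (ltP x 0) => x0.
  rewrite f0 ?ltW//; apply: (near_eq_is_derive (f := cst 0)).
  by near=> z; rewrite /= F0//; apply/ltW; near: z; exact: lt_nbhsl.
have [] := @continuous_FTC1_closed R f (-1) x (x + 1).
- by rewrite ltrDl.
- apply: continuous_compact_integrable; first exact: segment_compact.
  exact: continuous_subspaceT.
- by apply: lt_le_trans x0; rewrite ltrN10.
- exact: cf.
- by rewrite derive1E => dF DF; split.
Unshelve. all: by end_near. Qed.

Lemma MVT_derive F (f : R -> R) x y : (forall x, is_derive x 1 F (f x)) -> x < y ->
  exists2 c, x < c < y & F y - F x = f c * (y - x).
Proof.
move=> dF xy; have [|c] := MVT xy (fun c _ => dF c).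
  apply: continuous_subspaceT; apply: derivable_continuous1 => z.
  by have [] := dF z.
by rewrite in_itv/=; exists c.
Qed.

Lemma telescope_shift G y (K : nat) :
  \sum_(k < K) (G (y - k%:R) - G (y - k%:R - 1)) = G y - G (y - K%:R).
Proof.
elim: K => [|K IH]; first by rewrite big_ord0 subr0 subrr.
have -> : y - K.+1%:R = y - K%:R - 1 by rewrite -natr1; ring.
by rewrite big_ord_recr/= IH; ring.
Qed.

(* A bump convolved with indicators of [0, 1]: one convolution gives [gamma], two
   give [beta], and the derivative of the latter is a difference of shifts. *)
Lemma spline_exists : exists beta gamma : R -> R,
  [/\ smooth beta,
      forall x, is_derive x 1 beta (gamma x - gamma (x - 1)),
      (forall x, 0 <= beta x) /\ (forall x, 0 <= gamma x),
      (forall x, ~~ (0 < x < 3) -> beta x = 0) /\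
      (forall x, ~~ (0 < x < 3) -> gamma x = 0) &
      forall (K : nat) y, 3 <= y <= K%:R ->
        \sum_(k < K) beta (y - k%:R) = 1 /\ \sum_(k < K) gamma (y - k%:R) = 1].
Proof.
pose b0 x : R := flat_exp 1 x * flat_exp 1 (-1 * x + 1).
have sb0 : smooth b0.
  move=> k; apply: C1dM; first exact: smooth_flat_exp.
  by apply: C1d_affine; exact: smooth_flat_exp.
have b0_ge0 x : 0 <= b0 x.
  rewrite mulr_ge0 /flat_exp//; case: ifP => // _;
  by rewrite !hornerE expR_ge0.
have b0_gt0 x : 0 < x < 1 -> 0 < b0 x.
  move=> /andP[x0 x1]; rewrite /b0 /flat_exp x0 ifT; last by lra.
  by rewrite !hornerE !mulr_gt0// expR_gt0.
have b0_le0 x : x <= 0 -> b0 x = 0 by move=> x0; rewrite /b0 flat_exp_le0 ?mul0r.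
have b0_ge1 x : 1 <= x -> b0 x = 0.
  by move=> x1; rewrite /b0 (@flat_exp_le0 _ 1 (-1 * x + 1)) ?mulr0//; lra.
have [P dP P0] := primitive_from0 (C1d_continuous (sb0 0)) b0_le0.
have I0 : 0 < P 1.
  have [c c01 E] := MVT_derive dP ltr01.
  by move: E; rewrite (P0 0)// !subr0 mulr1 => ->; exact: b0_gt0.
(* A smooth step: 0 up to 0, 1 from 1 on. *)
pose B x := (P 1)^-1 * P x.
have dB x : is_derive x 1 B ((P 1)^-1 * b0 x).
  by have := dP x => ?; exact: is_deriveZ.
have sB : smooth B.
  move=> [|k]; last by apply: (C1dS dB); apply: C1dM => //; exact: C1d_cst.
  by split=> //; apply: derivable_continuous1 => x; have [] := dB x.
have B0 (x : R) : x <= 0 -> B x = 0.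
  by move=> x0; rewrite /B (P0 x x0) mulr0.
have B1 x : 1 <= x -> B x = 1.
  have BB1 : B 1 = 1 by rewrite /B mulVf// gt_eqF.
  rewrite le_eqVlt => /predU1P[<-//|x1].
  have [c /andP[c1 _]] := MVT_derive dB x1.
  by rewrite b0_ge1 ?ltW// mulr0 mul0r => /eqP; rewrite subr_eq0 BB1 => /eqP.
have [C dC C0] := primitive_from0 (C1d_continuous (sB 0)) B0.
have sC : smooth C.
  move=> [|k]; last exact: (C1dS dC).
  by split=> //; apply: derivable_continuous1 => x; have [] := dC x.
(* Both [gamma] and the final [beta] are differences of consecutive translates of a smooth step
   ([B], respectively [Q]), so their sums over integer translates telescope to 1. *)
pose gamma x := B x - B (x - 1).
pose Q x := C x - C (x - 1).
have shift1 (x : R) : is_derive x 1 (fun y : R => y - 1) 1.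
  by apply: is_derive_eq; rewrite subr0.
have dQ x : is_derive x 1 Q (gamma x).
  have := dC x => ?; apply: is_deriveB.
  rewrite -[X in is_derive _ _ _ X]mulr1.
  exact: (@is_derive1_comp _ C (fun y : R => y - 1)).
have Q1 x : 2 <= x -> Q x = 1.
  move=> x2; have [|c /andP[c1 _]] := @MVT_derive C B (x - 1) x dC; first by lra.
  by rewrite B1 /Q => [->|]; lra.
have Q0 x : x <= 0 -> Q x = 0 by move=> x0; rewrite /Q !C0 ?subrr//; lra.
have gamma_ge0 x : 0 <= gamma x.
  have [|c _] := @MVT_derive B _ (x - 1) x dB; first by lra.
  rewrite /gamma => ->; rewrite mulr_ge0//; last by lra.
  by rewrite mulr_ge0// invr_ge0 ltW.
exists (fun x => Q x - Q (x - 1)), gamma; split.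
- have sQ : smooth Q.
    move=> k; apply: C1dD => //.
    rewrite (_ : (fun y => _) = (fun y => (-1) * C (1 * y + (-1)))).
      by apply: C1dM; [exact: C1d_cst|exact: C1d_affine].
    by apply/funext => y; rewrite mulN1r mul1r.
  move=> k; apply: C1dD => //.
  rewrite (_ : (fun y => _) = (fun y => (-1) * Q (1 * y + (-1)))).
    by apply: C1dM; [exact: C1d_cst|exact: C1d_affine].
  by apply/funext => y; rewrite mulN1r mul1r.
- move=> x; have := dQ x => ?; apply: is_deriveB.
  rewrite -[X in is_derive _ _ _ X]mulr1.
  exact: (@is_derive1_comp _ Q (fun y : R => y - 1)).
- split=> // x; have [|c _] := @MVT_derive Q _ (x - 1) x dQ; first by lra.
  by move=> ->; rewrite mulr_ge0//; lra.
- split=> x; rewrite negb_and -!leNgt => /orP[x0|x3].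
  + by rewrite !Q0 ?subrr//; lra.
  + by rewrite !Q1 ?subrr//; lra.
  + by rewrite /gamma !B0 ?subrr//; lra.
  + by rewrite /gamma !B1 ?subrr//; lra.
- move=> K y /andP[y3 yK]; split.
    by rewrite telescope_shift Q1 ?Q0 ?subr0//; lra.
  by rewrite telescope_shift B1 ?B0 ?subr0//; lra.
Qed.

End spline.

(** * Integration of compactly supported functions *)

Section vanishing.
Context {R : realType} {n : nat}.
Implicit Types (F G : 'rV[R]_n -> R) (q : 'rV[R]_n) (L : R).

(** Compact support with an explicit cube: cubes are the sup-norm balls and have known product
    measure. In positive dimension a negative [L] forces F = 0, so passing to |L| is harmless. *)
Definition vanish_out L F := forall q i, L < `|q 0 i| -> F q = 0.

Lemma vanish_outMr L F G : vanish_out L G -> vanish_out L (fun q => F q * G q).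
Proof. by move=> vF q i /vF ->; rewrite mulr0. Qed.

Lemma vanish_outD L F G : vanish_out L F -> vanish_out L G ->
  vanish_out L (fun q => F q + G q).
Proof. by move=> vF vG q i Lq; rewrite (vF q i Lq) (vG q i Lq) addr0. Qed.

Lemma vanish_out_sum L (I : Type) (r : seq I) (P : pred I)
    (F : I -> 'rV[R]_n -> R) : (forall i, vanish_out L (F i)) ->
  vanish_out L (fun q => \sum_(i <- r | P i) F i q).
Proof. by move=> vF q i Lq; rewrite big1// => j _; exact: vF Lq. Qed.

Lemma vanish_outW L L' F : L <= L' -> vanish_out L F -> vanish_out L' F.
Proof. by move=> LL' vF q i Lq; apply: (vF q i); exact: le_lt_trans Lq. Qed.

Lemma vanish_out_partial L F i : vanish_out L F -> vanish_out L (partial i F).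
Proof.
move=> vF q j Lq; rewrite /partial (near_eq_derive (g := cst 0)) ?derive_cst//.
have : {for q, continuous (fun q : 'rV[R]_n => `|q 0 j|)}.
  by apply: cont_comp; [exact: continuous_coord|exact: norm_continuous].
by move/cvgr_gt => /(_ _ Lq); apply: filterS => q' /vF.
Qed.

Lemma compact_cube L : compact [set q : 'rV[R]_n | forall i, `|q 0 i| <= L].
Proof.
have := @rV_compact R n (fun=> `[- L, L]%classic) (fun=> @segment_compact _ _ _).
congr compact; apply/seteqP; split => q /= h i.
  by have := h i; rewrite in_itv/= ler_norml.
by rewrite in_itv/= -ler_norml.
Qed.

Lemma vanish_out_bounded L F : continuous F -> vanish_out L F ->
  exists2 M : R, 0 <= M & forall q, `|F q| <= M.
Proof.
move=> cF vF.
pose K := [set q : 'rV[R]_n | forall i, `|q 0 i| <= L].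
have /compact_bounded[M [_ Mb]] : compact (F @` K).
  by apply: continuous_compact; [exact: continuous_subspaceT|exact: compact_cube].
exists (`|M| + 1) => [|q]; first by rewrite addr_ge0.
have [h|/existsNP[i /negP]] := pselect (forall i, `|q 0 i| <= L).
  by apply: Mb; [rewrite ltr_pwDr// ler_norm|exists q].
by rewrite -ltNge => /vF ->; rewrite normr0 addr_ge0.
Qed.

Lemma continuous_rV (T : topologicalType) (f : T -> 'rV[R]_n) (x : T) :
  (forall i, {for x, continuous (fun y => f y 0 i)}) -> {for x, continuous f}.
Proof.
move=> cf A [P nP PA].
have : \forall y \near x, forall i, P ord0 i (f y 0 i).
  by apply: filter_forall => i; exact: (cf i _ (nP 0 i)).
by apply: filterS => y Py; apply: PA => i j; rewrite ord1.
Qed.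

Lemma nbhs_cube q (A : set 'rV[R]_n) : nbhs q A ->
  exists2 e : R, 0 < e & forall q', (forall i, `|q' 0 i - q 0 i| < e) -> A q'.
Proof.
move=> /nbhs_ballP[e /= e0 eA]; exists e => // q' h; apply: eA; split=> // i j.
by rewrite /ball/= distrC (ord1 i).
Qed.

End vanishing.

Section tuple_integral.
Context {R : realType}.
Local Notation RR := (measurableTypeR R).

Definition tvec n (t : n.-tuple R) : 'rV[R]_n := \row_i tnth t i.

Lemma measurable_box n (A : 'I_n -> set RR) : (forall i, measurable (A i)) ->
  measurable [set t : n.-tuple RR | forall i, A i (tnth t i)].
Proof.
move=> mA; rewrite (_ : [set _ | _] = \big[setI/setT]_(i < n)
    ((fun t : n.-tuple RR => tnth t i) @^-1` A i)).
  apply: bigsetI_measurable => i _; rewrite -[X in measurable X]setTI.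
  exact: (@measurable_tnth _ RR).
apply/seteqP; split => t /=.
  by move=> h; rewrite -bigcap_seq => i _; exact: h.
by rewrite -bigcap_seq => h i; apply: (h i); rewrite /= mem_index_enum.
Qed.

(** This links the topology of rows to the product sigma-algebra of tuples: an open set is the
    countable union of the grid boxes of mesh 1/(N+1), over all N, that it contains. *)
Lemma open_tvec_measurable n (A : set 'rV[R]_n) : open A ->
  measurable (@tvec n @^-1` A : set (n.-tuple RR)).
Proof.
move=> oA.
pose D := (nat * {ffun 'I_n -> int})%type.
pose box (z : D) : set (n.-tuple RR) := [set t | forall i,
  `[(z.2 i)%:~R / z.1.+1%:R, ((z.2 i) + 1)%:~R / z.1.+1%:R]%classic (tnth t i)].
pose F (z : D) : set (n.-tuple RR) :=
  if `[< box z `<=` @tvec n @^-1` A >] then box z else set0.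
suff -> : @tvec n @^-1` A = \bigcup_z F z.
  apply: countable_bigcupT_measurable; first exact: countableP.
  move=> z; rewrite /F; case: asboolP => _; last exact: measurable0.
  apply: (@measurable_box n (fun i =>
    `[(z.2 i)%:~R / z.1.+1%:R, ((z.2 i) + 1)%:~R / z.1.+1%:R]%classic)) => i.
  exact: measurable_itv.
apply/seteqP; split => [t At|t [z _]]; last first.
  by rewrite /F; case: asboolP => // sub; exact: sub.
have [e e0 eA] := nbhs_cube (open_nbhs_nbhs (conj oA At)).
have [N _ /(_ N (leqnn N)) /= Ne] := near_infty_natSinv_lt (PosNum e0).
pose k : {ffun 'I_n -> int} := [ffun i => Num.floor (tnth t i * N.+1%:R)].
have close (a b c d : R) : c <= a -> c <= b -> a <= c + d -> b <= c + d ->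
    `|a - b| <= d.
  by move=> *; rewrite ler_norml; apply/andP; split; lra.
have N0 : 0 < N.+1%:R :> R by rewrite ltr0n.
have tk i : (k i)%:~R / N.+1%:R <= tnth t i <= ((k i) + 1)%:~R / N.+1%:R.
  rewrite ler_pdivrMr// ler_pdivlMr// ffunE.
  by have /andP[-> /ltW ->] := floor_itv (tnth t i * N.+1%:R).
have tbox : box (N, k) t by move=> i /=; rewrite in_itv/= tk.
exists (N, k) => //; rewrite /F; rewrite asboolT// => s bs.
apply: eA => i; rewrite !mxE; apply: le_lt_trans Ne.
have := bs i; rewrite /= in_itv/= => /andP[s1 s2].
have /andP[t1 t2] := tk i.
move: s2 t2; rewrite intrD mulrDl mul1r => s2 t2.
exact: close s1 t1 s2 t2.
Qed.

Lemma continuous_tvec_measurable n (F : 'rV[R]_n -> R) : continuous F ->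
  measurable_fun setT (fun t : n.-tuple RR => F (tvec t)).
Proof.
move=> /continuousP cF; apply: (measurability _ (measurable_realfun.RGenOpens.measurableE R)).
move=> _ [_ [a [b ->] <-]]; rewrite setTI.
by apply: (@open_tvec_measurable n (F @^-1` `]a, b[)); exact/cF/interval_open.
Qed.

Lemma measurable_cube n (a b : 'I_n -> R) :
  measurable [set t : n.-tuple RR | forall i, `[a i, b i]%classic (tnth t i)].
Proof.
apply: (@measurable_box n (fun i => `[a i, b i]%classic)) => i.
exact: measurable_itv.
Qed.

Lemma lebesgue_cube n (a b : 'I_n -> R) : (forall i, a i <= b i) ->
  lebesgue_tuple n [set t : n.-tuple RR | forall i, `[a i, b i]%classic (tnth t i)] =
  (\prod_(i < n) (b i - a i))%:E.
Proof.
move=> ab; rewrite (@lebesgue_tuple_box _ n (fun i => `[a i, b i]%classic)).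
  rewrite -prodEFin; apply: eq_bigr => i _.
  rewrite lebesgue_measure_itv/= lte_fin; case: ltgtP (ab i) => // -> _.
  by rewrite subrr.
by move=> i; exact: measurable_itv.
Qed.

Definition cube n L : set (n.-tuple RR) :=
  [set t | forall i, `[- L, L]%classic (tnth t i)].
Arguments cube n L : clear implicits.

Lemma measurable_cubeL n L : measurable (cube n L).
Proof. exact: (measurable_cube (fun=> - L) (fun=> L)). Qed.

Lemma fine_cube n L : 0 <= L -> lebesgue_tuple n (cube n L) = ((L + L) ^+ n)%:E.
Proof.
move=> L0; rewrite /cube (@lebesgue_cube n (fun=> - L) (fun=> L)).
  by rewrite opprK prodr_const card_ord.
by move=> i; lra.
Qed.

Lemma vanish_out_restrict n L (F : 'rV[R]_n -> R) : vanish_out L F ->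
  (fun t : n.-tuple RR => F (tvec t)) \_ (cube n L) = (fun t => F (tvec t)).
Proof.
move=> vF; apply/funext => t; rewrite patchE; case: ifPn => // /negP tL.
have /existsNP[i ti] : ~ forall i, `[- L, L]%classic (tnth t i).
  by move=> h; apply: tL; rewrite inE.
apply/esym/(vF _ i); rewrite ltNge mxE ler_norml; apply/negP.
by move: ti; rewrite /= in_itv.
Qed.

Lemma vanish_out_integrable n L (F : 'rV[R]_n -> R) : continuous F -> vanish_out L F ->
  (lebesgue_tuple n).-integrable setT (EFin \o (fun t : n.-tuple RR => F (tvec t))).
Proof.
move=> cF vF.
have {}vF : vanish_out `|L| F by apply: vanish_outW vF; exact: ler_norm.
rewrite -(vanish_out_restrict vF) -restrict_EFin.
apply: (integrable_mkcond _ (@measurable_cubeL n `|L|)).1.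
apply: measurable_bounded_integrable; first exact: measurable_cubeL.
- by rewrite [X in (X < _)%E]fine_cube// ltry.
- by apply: measurable_funTS; exact: continuous_tvec_measurable.
- have [M M0 FM] := vanish_out_bounded cF vF.
  exists M; split; first exact: num_real.
  by move=> x Mx t _ /=; apply: le_trans (ltW Mx); exact: FM.
Qed.

Lemma lebesgue_intD n L (F G : 'rV[R]_n -> R) :
  continuous F -> vanish_out L F -> continuous G -> vanish_out L G ->
  lebesgue_int (fun q => F q + G q) = lebesgue_int F + lebesgue_int G.
Proof.
move=> cF vF cG vG; rewrite /lebesgue_int RintegralD//.
  exact: (vanish_out_integrable cF vF).
exact: (vanish_out_integrable cG vG).
Qed.

Lemma lebesgue_intZ n L (a : R) (F : 'rV[R]_n -> R) :
  continuous F -> vanish_out L F ->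
  lebesgue_int (fun q => a * F q) = a * lebesgue_int F.
Proof.
by move=> cF vF; rewrite /lebesgue_int RintegralZl//; exact: (vanish_out_integrable cF vF).
Qed.

Lemma lebesgue_int0 n : lebesgue_int (fun _ : 'rV[R]_n => 0) = 0 :> R.
Proof. by rewrite /lebesgue_int /Rintegral integral0. Qed.

Lemma lebesgue_int_sum n L (I : Type) (r : seq I) (F : I -> 'rV[R]_n -> R) :
  (forall i, continuous (F i)) -> (forall i, vanish_out L (F i)) ->
  lebesgue_int (fun q => \sum_(i <- r) F i q) = \sum_(i <- r) lebesgue_int (F i).
Proof.
move=> cF vF; elim: r => [|i r IH].
  by rewrite big_nil -[RHS](lebesgue_int0 n); congr lebesgue_int; apply/funext => q; rewrite big_nil.
rewrite big_cons -IH -(@lebesgue_intD _ L)//.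
- by congr lebesgue_int; apply/funext => q; rewrite big_cons.
- by move=> q; apply: cont_sum => j _; exact: cF.
- exact: vanish_out_sum.
Qed.

Lemma lebesgue_int_small n L (F : 'rV[R]_n -> R) M : 0 <= L ->
  continuous F -> vanish_out L F -> (forall q, `|F q| <= M) ->
  `|lebesgue_int F| <= M * (L + L) ^+ n.
Proof.
move=> L0 cF vF FM.
rewrite /lebesgue_int -(vanish_out_restrict vF) -Rintegral_mkcond.
have iF : (lebesgue_tuple n).-integrable (cube n L)
    (EFin \o (fun t : n.-tuple RR => F (tvec t))).
  apply: integrableS (vanish_out_integrable cF vF) => //; exact: measurable_cubeL.
have mL := @measurable_cubeL n L.
apply: le_trans (le_normr_Rintegral mL iF) _.
have -> : M * (L + L) ^+ n = \int[lebesgue_tuple n]_(t in cube n L) M.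
  rewrite Rintegral_cst//; congr (_ * _).
  by rewrite -[LHS]/(fine ((L + L) ^+ n)%:E) -fine_cube.
apply: le_Rintegral => //.
- exact: integrable_norm.
- apply: measurable_bounded_integrable => //.
  + by rewrite [X in (X < _)%E]fine_cube// ltry.
  + exists `|M|; split; first exact: num_real.
    by move=> x Mx t _ /=; exact: ltW.
Qed.

(** By continuity F exceeds F(q0)/2 on a small cube about [q0], whose measure is positive. *)
Lemma lebesgue_int_gt0 n L (F : 'rV[R]_n -> R) (q0 : 'rV[R]_n) :
  continuous F -> vanish_out L F -> (forall q, 0 <= F q) -> 0 < F q0 ->
  0 < lebesgue_int F.
Proof.
move=> cF vF F0 Fq0.
have := cF q0 => /cvgr_gt /(_ (F q0 / 2)).
rewrite ltr_pdivrMr// ltr_pMr// ltr1n => /(_ isT) /nbhs_cube[e e0 eF].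
pose A : set (n.-tuple RR) := [set t | forall i,
  `[q0 0 i - e / 2, q0 0 i + e / 2]%classic (tnth t i)].
have mA : measurable A.
  exact: (measurable_cube (fun i => q0 0 i - e / 2) (fun i => q0 0 i + e / 2)).
have muA : lebesgue_tuple n A = (e ^+ n)%:E.
  rewrite /A (@lebesgue_cube n (fun i => q0 0 i - e / 2) (fun i => q0 0 i + e / 2)).
    congr (_%:E); rewrite -[n in RHS]card_ord -prodr_const.
    by apply: eq_bigr => i _; field.
  by move=> i; lra.
have iF := vanish_out_integrable cF vF.
apply: (@lt_le_trans _ _ (\int[lebesgue_tuple n]_(t in A) (F q0 / 2))).
  rewrite Rintegral_cst// [X in fine X]muA/= mulr_gt0 ?divr_gt0 ?exprn_gt0//.
rewrite Rintegral_mkcond; apply: le_Rintegral => //.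
- rewrite -restrict_EFin; apply: (integrable_mkcond _ mA).1.
  apply: measurable_bounded_integrable => //.
  + by rewrite [X in (X < _)%E]muA ltry.
  + exists `|F q0 / 2|; split; first exact: num_real.
    by move=> x Mx t _ /=; exact: ltW.
move=> t _; rewrite patchE; case: ifPn => [|_]; last exact: F0.
rewrite inE => At; apply/ltW/eF => i.
have := At i; rewrite /= in_itv/= mxE => /andP[a1 a2].
have aux (a b c : R) : 0 < c -> b - c / 2 <= a -> a <= b + c / 2 -> `|a - b| < c.
  by move=> *; rewrite ltr_norml; apply/andP; split; lra.
exact: aux e0 a1 a2.
Qed.

End tuple_integral.

(** * Integrals of partial derivatives, by Fubini in the first coordinate *)

Section row_cons.
Context {R : realType}.

Definition row_cons n (x : R) (q : 'rV[R]_n) : 'rV[R]_n.+1 :=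
  \row_i oapp (fun k => q 0 k) x (unlift ord0 i).

Lemma row_cons0 n x (q : 'rV[R]_n) : row_cons x q 0 ord0 = x.
Proof. by rewrite mxE unlift_none. Qed.

Lemma row_consS n x (q : 'rV[R]_n) j : row_cons x q 0 (lift ord0 j) = q 0 j.
Proof. by rewrite mxE liftK. Qed.

Lemma row_cons_lineS n x (q : 'rV[R]_n) j (h : R) :
  row_cons x (h *: delta_mx 0 j + q) =
  h *: delta_mx 0 (lift ord0 j) + row_cons x q.
Proof.
apply/rowP => i; case: (unliftP ord0 i) => [k ->|->].
  by rewrite [RHS]mxE !row_consS !mxE (inj_eq lift_inj).
by rewrite [RHS]mxE !row_cons0 !mxE andbC/= mulr0 add0r.
Qed.

Lemma row_cons_line0 n (q : 'rV[R]_n) (h x : R) :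
  row_cons (h + x) q = h *: delta_mx 0 ord0 + row_cons x q.
Proof.
apply/rowP => i; case: (unliftP ord0 i) => [k ->|->].
  by rewrite [RHS]mxE !row_consS !mxE /= mulr0 add0r.
by rewrite [RHS]mxE !row_cons0 !mxE eqxx mulr1.
Qed.

Lemma continuous_row_consr n (x : R) : continuous (@row_cons n x).
Proof.
move=> q; apply: continuous_rV => i; case: (unliftP ord0 i) => [k ->|->].
  rewrite (_ : (fun y : 'rV[R]_n => _) = (fun y : 'rV[R]_n => y 0 k)); first exact: continuous_coord.
  by apply/funext => y; rewrite row_consS.
rewrite (_ : (fun y : 'rV[R]_n => _) = (fun=> x)); first exact: contC.
by apply/funext => y; rewrite row_cons0.
Qed.

Lemma continuous_row_consl n (q : 'rV[R]_n) : continuous (fun x => row_cons x q).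
Proof.
move=> x; apply: continuous_rV => i; case: (unliftP ord0 i) => [k ->|->].
  rewrite (_ : (fun y : R => _) = (fun=> q 0 k)); first exact: contC.
  by apply/funext => y; rewrite row_consS.
rewrite (_ : (fun y : R => _) = id); first exact: cvg_id.
by apply/funext => y; rewrite row_cons0.
Qed.

Lemma is_derive_row_consS n (g : 'rV[R]_n.+1 -> R) x (q : 'rV[R]_n) j :
  derivable g (row_cons x q) (delta_mx 0 (lift ord0 j)) ->
  is_derive q (delta_mx 0 j) (fun q => g (row_cons x q))
    (partial (lift ord0 j) g (row_cons x q)).
Proof.
move=> dg; apply: (is_derive_line _ _ _ _).2.
rewrite (_ : (fun h => _) = (fun h : R => g (h *: delta_mx 0 (lift ord0 j) + row_cons x q))).
  by apply: (is_derive_line _ _ _ _).1; split.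
by apply/funext => h; rewrite row_cons_lineS.
Qed.

Lemma is_derive_row_cons0 n (g : 'rV[R]_n.+1 -> R) x (q : 'rV[R]_n) :
  derivable g (row_cons x q) (delta_mx 0 ord0) ->
  is_derive x 1 (fun x => g (row_cons x q)) (partial ord0 g (row_cons x q)).
Proof.
move=> dg; apply: (is_derive_line _ _ _ _).2.
rewrite (_ : (fun h => _) = (fun h : R => g (h *: delta_mx 0 ord0 + row_cons x q))).
  by apply: (is_derive_line _ _ _ _).1; split.
by apply/funext => h; rewrite -row_cons_line0 [_%:A]mulr1.
Qed.

Lemma tvec_cons n (z : R * n.-tuple R) : tvec (tuple_cons z) = row_cons z.1 (tvec z.2).
Proof.
case: z => x t; apply/rowP => i; case: (unliftP ord0 i) => [k ->|->].
  by rewrite row_consS !mxE /tuple_cons tnthS.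
by rewrite row_cons0 mxE.
Qed.

End row_cons.

Section divergence.
Context {R : realType}.
Local Notation RR := (measurableTypeR R).

Lemma integral_derive_compact (h dh : R -> R) (L : R) :
  (forall x : R, is_derive x 1 h (dh x)) -> continuous dh ->
  (forall x : R, L < `|x| -> h x = 0) ->
  (\int[lebesgue_measure]_x (dh x)%:E = 0)%E.
Proof.
move=> dE cdh h0.
(* Strictly beyond L, so that [h] vanishes at both ends of [-K, K]. *)
pose K : R := `|L| + 1.
have K0 : 0 < K by rewrite ltr_wpDl.
have LK : L < K by apply: le_lt_trans (ler_norm L) _; rewrite ltrDl.
have dh0 x : L < `|x| -> dh x = 0.
  move=> Lx; have [_ <-] := dE x; rewrite (near_eq_derive (g := cst 0)) ?derive_cst//.
  have := @norm_continuous _ _ x => /cvgr_gt /(_ _ Lx).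
  by apply: filterS => y /h0.
have ch : continuous h by apply: derivable_continuous1 => x; have [] := dE x.
have -> : (\int[lebesgue_measure]_x (dh x)%:E =
    \int[lebesgue_measure]_(x in `[(- K)%R, K]) (dh x)%:E)%E.
  rewrite [RHS]integral_mkcond; apply: eq_integral => x _; rewrite patchE.
  case: ifPn => // xK; rewrite dh0//.
  rewrite ltNge; apply/negP => xL; move/negP: xK; apply.
  by rewrite inE/= in_itv/= -ler_norml (le_trans xL)// ltW.
rewrite (@continuous_FTC2 _ dh h).
- by rewrite !h0 ?normrN ?(gtr0_norm K0)// sube0.
- by rewrite gtrN.
- exact: continuous_subspaceT.
- split=> [x _| |].
  + by have [] := dE x.
  + exact: cvg_at_right_filter (ch _).
  + exact: cvg_at_left_filter (ch _).
- by move=> x _; rewrite derive1E; have [_ ->] := dE x.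
Qed.

(** Induction on the dimension with a choice of the order of integration: for the first coordinate
    the inner integral is one-dimensional and zero by the fundamental theorem; for any other it runs
    over the remaining coordinates and is zero by induction. *)
Lemma lebesgue_int_partial n (i : 'I_n) (g : 'rV[R]_n -> R) L :
  continuous g -> (forall q, derivable g q (delta_mx 0 i)) ->
  continuous (partial i g) -> vanish_out L g ->
  lebesgue_int (partial i g) = 0.
Proof.
elim: n i g => [[]//|n IH] i g cg dg cpg vg.
have vpg : vanish_out L (partial i g) by exact: vanish_out_partial.
pose G (t : n.+1.-tuple RR) : \bar R := (partial i g (tvec t))%:E.
have iG : (lebesgue_tuple n.+1).-integrable setT G.
  exact: (vanish_out_integrable cpg vpg).
have mG := measurable_int _ iG.
have mc := @measurable_tuple_cons R n.
pose nu : {sigma_finite_measure set RR -> \bar R} := lebesgue_measure.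
pose mu := @lebesgue_tuple R n.
pose prod := (nu \x mu)%E.
have iGc : prod.-integrable setT (G \o @tuple_cons R n).
  apply/integrableP; split.
    move=> _ Y mY; rewrite setTI comp_preimage.
    have := mG measurableT Y mY; rewrite setTI => mGY.
    by have := mc measurableT _ mGY; rewrite setTI.
  have /integrableP[_] := iG; apply: le_lt_trans.
  rewrite [leRHS](@ge0_integral_pushforward _ _ _ _ _ (@tuple_cons R n) mc prod setT)//.
  exact: (measurable_int _ (integrable_abse iG)).
have E : (\int[lebesgue_tuple n.+1]_t G t =
    \int[prod]_z (G \o @tuple_cons R n) z)%E.
  by rewrite [LHS](@integral_pushforward _ _ _ _ _ (@tuple_cons R n) mc prod setT).
rewrite /lebesgue_int /Rintegral.
rewrite [X in fine X](_ : _ = \int[lebesgue_tuple n.+1]_t G t)%E// E.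
case: (unliftP ord0 i) => [j ij|i0].
  rewrite -integral12_prod_meas1// integral0_eq// => x _.
  rewrite /fubini_F.
  pose gx (q : 'rV[R]_n) := g (row_cons x q).
  have dgx q : is_derive q (delta_mx 0 j) gx (partial i g (row_cons x q)).
    by rewrite ij; apply: is_derive_row_consS; rewrite -ij.
  have pgx : partial j gx = (fun q => partial i g (row_cons x q)).
    by apply/funext => q; have [_ h] := dgx q; exact: h.
  have cgx : continuous gx.
    by move=> q; apply: continuous_comp; [exact: continuous_row_consr|exact: cg].
  have vgx : vanish_out L gx by move=> q k Lq; apply: (vg _ (lift ord0 k)); rewrite row_consS.
  have cpgx : continuous (partial j gx).
    rewrite pgx => q; apply: continuous_comp; [exact: continuous_row_consr|exact: cpg].
  have iint := vanish_out_integrable cpgx (@vanish_out_partial _ _ L gx j vgx).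
  have := IH j gx cgx _ cpgx vgx.
  rewrite /lebesgue_int /Rintegral => H.
  transitivity (\int[mu]_t (partial j gx (tvec t))%:E)%E.
    by apply: eq_integral => t _; rewrite pgx /G/= tvec_cons.
  rewrite -[LHS]fineK; last exact: integrable_fin_num.
  by congr EFin; apply: H => q; have [] := dgx q.
rewrite -integral21_prod_meas1// integral0_eq// => t _; rewrite /fubini_G.
transitivity (\int[nu]_x (partial i g (row_cons x (tvec t)))%:E)%E.
  by apply: eq_integral => x _; rewrite /G/= tvec_cons.
apply: (@integral_derive_compact (fun x => g (row_cons x (tvec t))) _ L).
- by move=> x; rewrite i0; apply: is_derive_row_cons0; rewrite -i0.
- move=> x; apply: (@continuous_comp _ _ _ (fun x => row_cons x (tvec t))).
    exact: continuous_row_consl.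
  exact: cpg.
- by move=> x Lx; apply: (vg _ ord0); rewrite row_cons0.
Qed.

End divergence.

(** * C^1 approximation by test functions *)

Section spline_approximation.
Context {R : realType} {n : nat}.
Implicit Types (F zeta : 'rV[R]_n -> R) (q : 'rV[R]_n) (L h : R).

Lemma cube_nbhs q (r : R) : 0 < r ->
  nbhs q [set q' : 'rV[R]_n | forall i, `|q' 0 i - q 0 i| < r].
Proof.
move=> r0; apply/nbhs_ballP; exists r => // q' [_ h] i /=.
by have := h ord0 i; rewrite /ball/= distrC.
Qed.

Lemma vanish_out_uniform F L e : continuous F -> vanish_out L F -> 0 < e ->
  exists2 d : R, 0 < d & forall q q', (forall i, `|q' 0 i - q 0 i| <= d) ->
    `|F q' - F q| <= e.
Proof.
move=> cF vF e0.
have /compact_near_coveringP/(_ R (0^'+)) := @compact_cube R n (L + 1).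
move=> /(_ (fun d q => forall q', (forall i, `|q' 0 i - q 0 i| <= d) ->
    `|F q' - F q| <= e)) [].
  move=> q _.
  have /cvgr_dist_lt /(_ (e / 2)) := cF q.
  rewrite divr_gt0// => /(_ isT) /nbhs_cube[r r0 rF].
  exists ([set q' : 'rV[R]_n | forall i, `|q' 0 i - q 0 i| < r / 2], [set d | d < r / 2]).
    split; last by apply: nbhs_right_lt; rewrite divr_gt0.
    by apply: cube_nbhs; rewrite divr_gt0.
  move=> [q1 d]/= [q1r dr] q2 q2d.
  have F1 : `|F q - F q1| < e / 2.
    by apply: rF => i; apply: lt_trans (q1r i) _; rewrite ltr_pdivrMr// ltr_pMr// ltr1n.
  have F2 : `|F q - F q2| < e / 2.
    apply: rF => i; rewrite -(subrK (q1 0 i) (q2 0 i)) -addrA [r]splitr.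
    by apply: le_lt_trans (ler_normD _ _) _; rewrite ltrD ?q1r// (le_lt_trans (q2d i)).
  rewrite -(subrK (F q) (F q2)) -addrA [e]splitr.
  by apply: le_trans (ler_normD _ _) _; rewrite lerD// ltW// distrC.
move=> d /= d0 dP.
(* The bound 1 handles points outside the cube of half-side L + 1: their neighbours are still
   outside that of half-side L, so both values are 0. *)
pose d' := Num.min (d / 2) 1.
have d'0 : 0 < d' by rewrite lt_min divr_gt0/=.
exists d' => // q q' qq'.
have [qL|/existsNP[i /negP]] := pselect (forall i, `|q 0 i| <= L + 1).
  apply: (dP d') => //=.
  rewrite sub0r normrN gtr0_norm// gt_min; apply/orP; left.
  by rewrite ltr_pdivrMr// ltr_pMr// ltr1n.
rewrite -ltNge => Lq.
rewrite (vF q' i) ?(vF q i) ?subrr ?normr0 ?ltW//.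
  by apply: lt_trans Lq; rewrite ltrDl.
have := qq' i; rewrite le_min => /andP[_ q1].
have : `|q 0 i| <= `|q' 0 i| + `|q' 0 i - q 0 i|.
  rewrite -[in leLHS](subKr (q' 0 i) (q 0 i)); exact: ler_normB.
by lra.
Qed.

Lemma is_derive_line_at F q (v : 'rV[R]_n) (s : R) :
  derivable F (s *: v + q) v ->
  is_derive s 1 (fun s => F (s *: v + q)) ('D_v F (s *: v + q)).
Proof.
move=> dF.
pose G (h : R) := F (h *: v + (s *: v + q)).
have dG : is_derive (s - s) 1 G ('D_v F (s *: v + q)).
  by rewrite subrr; apply: (is_derive_line _ _ _ _).1; split.
have ds : is_derive s 1 (fun x : R => x - s) 1.
  by apply: is_derive_eq; rewrite subr0.
have := @is_derive1_comp _ G (fun x : R => x - s) s _ _ dG ds.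
rewrite mulr1; congr is_derive; apply/funext => x.
by rewrite /G /= addrA -scalerDl subrK.
Qed.

Lemma is_derive_bigsum (I : Type) (r : seq I) (G : I -> 'rV[R]_n -> R)
    (dG : I -> R) q v : (forall j, is_derive q v (G j) (dG j)) ->
  is_derive q v (fun q => \sum_(j <- r) G j q) (\sum_(j <- r) dG j).
Proof.
move=> dE; elim: r => [|j r IH].
  rewrite (_ : (fun q => _) = cst 0) ?big_nil; first exact: is_derive_cst.
  by apply/funext => x; rewrite big_nil.
rewrite (_ : (fun q => _) = (fun q => G j q + \sum_(j <- r) G j q)).
  by rewrite big_cons; apply: is_deriveD.
by apply/funext => x; rewrite big_cons.
Qed.

Lemma weighted_average (I : finType) (W c : I -> R) (c0 e : R) :
  (forall k, 0 <= W k) -> \sum_k W k = 1 ->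
  (forall k, W k != 0 -> `|c k - c0| <= e) -> `|\sum_k c k * W k - c0| <= e.
Proof.
move=> W0 W1 cc.
have -> : \sum_k c k * W k - c0 = \sum_k (c k - c0) * W k.
  rewrite -[in LHS](mulr1 c0) -W1 mulr_sumr -sumrB.
  by apply: eq_bigr => k _; rewrite mulrBl.
apply: le_trans (ler_norm_sum _ _ _) _.
rewrite -[e]mulr1 -W1 mulr_sumr; apply: ler_sum => k _.
rewrite normrM (ger0_norm (W0 k)).
have [->|Wk] := eqVneq (W k) 0; first by rewrite !mulr0.
by rewrite ler_wpM2r// cc.
Qed.

Lemma compact_support_vanish_out F L : vanish_out L F ->
  compact (closure [set q | F q != 0]).
Proof.
move=> vF; apply: (subclosed_compact _ (@compact_cube R n L)).
  exact: closed_closure.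
have cK : closed [set q : 'rV[R]_n | forall i, `|q 0 i| <= L].
  by apply: compact_closed; [exact: norm_hausdorff|exact: compact_cube].
rewrite [X in _ `<=` X]((closure_id _).1 cK).
apply: closure_subset => q /= Fq i; rewrite leNgt; apply/negP => /vF F0.
by rewrite F0 eqxx in Fq.
Qed.

Section quasi_interpolant.
Variables (beta gamma : R -> R) (zeta : 'rV[R]_n -> R) (h A : R) (K : nat).
Hypothesis sbeta : smooth beta.
Hypothesis dbeta : forall x : R, is_derive x 1 beta (gamma x - gamma (x - 1)).

Definition knot (k : {ffun 'I_n -> 'I_K}) : 'rV[R]_n :=
  \row_j (h * (k j)%:R - A).

(** Tensor-product spline. The factor depends on the coordinate because differentiation in direction
    i trades [beta] for [gamma] in that coordinate only. *)
Definition spline_weight (theta : 'I_n -> R -> R) (k : {ffun 'I_n -> 'I_K}) q : R :=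
  \prod_j theta j ((q 0 j + A) / h - (k j)%:R).

(** A local average of the values of [zeta] at nearby knots. Its partial derivatives turn out to be
    local averages of difference quotients, which gives C^1 closeness. *)
Definition quasi_interpolant q : R :=
  \sum_k zeta (knot k) * spline_weight (fun=> beta) k q.

Lemma spline_weight_sum (theta : 'I_n -> R -> R) q :
  (forall j, \sum_(k < K) theta j ((q 0 j + A) / h - k%:R) = 1) ->
  \sum_k spline_weight theta k q = 1.
Proof.
move=> H; transitivity (\prod_(j < n) \sum_(k < K) theta j ((q 0 j + A) / h - k%:R)).
  by rewrite bigA_distr_bigA.
by apply: big1 => j _; exact: H.
Qed.

Lemma Ck_quasi_interpolant k : Ck k quasi_interpolant.
Proof.
apply: Ck_sum => kk _; apply: CkM; first exact: Ck_cst.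
apply: Ck_prod => j _.
apply: (@Ck_coord _ _ _ (fun x => beta ((x + A) / h - (kk j)%:R))).
rewrite (_ : (fun x => _) = (fun x => beta (h^-1 * x + (A / h - (kk j)%:R)))).
  by apply: C1d_affine; exact: sbeta.
by apply/funext => x; congr beta; rewrite mulrDl addrA mulrC.
Qed.

Let split_theta i (k : {ffun 'I_n -> 'I_K}) q : R :=
  \prod_(j | j != i) beta ((q 0 j + A) / h - (k j)%:R).

Lemma spline_weight_derive i (k : {ffun 'I_n -> 'I_K}) q :
  is_derive q (delta_mx 0 i) (spline_weight (fun=> beta) k)
    (h^-1 * (gamma ((q 0 i + A) / h - (k i)%:R) -
             gamma ((q 0 i + A) / h - (k i)%:R - 1)) * split_theta i k q).
Proof.
rewrite (_ : spline_weight _ k = (fun q => beta ((q 0 i + A) / h - (k i)%:R) * split_theta i k q)); last first.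
  by apply/funext => x; rewrite /spline_weight (bigD1 i).
have d0 : is_derive q (delta_mx 0 i) (split_theta i k) 0.
  apply: (is_derive_line _ _ _ _).2.
  rewrite (_ : (fun x => _) = cst (split_theta i k q)); first exact: is_derive_cst.
  apply/funext => x; apply: eq_bigr => j ji; rewrite !mxE eqxx/= (negPf ji).
  by rewrite mulr0 add0r.
have d1 : is_derive q (delta_mx 0 i) (fun q : 'rV[R]_n => (q 0 i + A) / h - (k i)%:R) h^-1.
  have dc := @is_derive_coord R n i q (delta_mx 0 i).
  rewrite (_ : (fun x => _) = (fun x : 'rV[R]_n => h^-1 * x 0 i + (A / h - (k i)%:R))).
    have := is_derive_compR (is_derive_affine h^-1 (A / h - (k i)%:R) (q 0 i)) dc.
    by rewrite mxE !eqxx mulr1.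
  by apply/funext => x; rewrite mulrDl addrA mulrC.
have d2 := @is_derive_compR R 'rV[R]_n beta _ q (delta_mx 0 i) _ _ (dbeta _) d1.
have := is_derive_mul d2 d0; rewrite mulr0 add0r.
by congr is_derive; ring.
Qed.

Hypothesis vanish_last : forall (k : {ffun 'I_n -> 'I_K}) i, (k i).+1 = K -> zeta (knot k) = 0.
Hypothesis vanish_first : forall (k : {ffun 'I_n -> 'I_K}) i, (k i : nat) = 0%N ->
  zeta ((- h) *: delta_mx 0 i + knot k) = 0.

(* Abel summation: the shift of the [i]-th index is a bijection of the grid,
   wrapping around only where [zeta] vanishes. *)
Lemma partial_quasi_interpolant i q :
  partial i quasi_interpolant q =
  \sum_k (zeta (knot k) - zeta ((- h) *: delta_mx 0 i + knot k)) / h *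
    spline_weight (fun j => if j == i then gamma else beta) k q.
Proof.
pose y := (q 0 i + A) / h.
have -> : partial i quasi_interpolant q =
    \sum_k zeta (knot k) * (h^-1 * (gamma (y - (k i)%:R) - gamma (y - (k i)%:R - 1)) *
      split_theta i k q).
  apply: is_derive_partial; apply: is_derive_bigsum => k.
  have dw := spline_weight_derive i k q.
  exact: is_derive_scale.
have sw k : spline_weight (fun j => if j == i then gamma else beta) k q =
    gamma (y - (k i)%:R) * split_theta i k q.
  rewrite /spline_weight (bigD1 i)//= eqxx; congr (_ * _).
  by apply: eq_bigr => j /negPf ->.
pose H (k : {ffun 'I_n -> 'I_K}) := zeta ((- h) *: delta_mx 0 i + knot k) *
  (gamma (y - (k i)%:R) * split_theta i k q).
pose s (k : {ffun 'I_n -> 'I_K}) : {ffun 'I_n -> 'I_K} :=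
  [ffun j => if j == i then ordS (k j) else k j].
have s_inj : injective s.
  move=> k1 k2 /ffunP E; apply/ffunP => j; have := E j; rewrite !ffunE.
  by case: ifP => // _ /ordS_inj.
have Hs k : H (s k) = zeta (knot k) * (gamma (y - (k i)%:R - 1) * split_theta i k q).
  rewrite /H (_ : split_theta i (s k) q = split_theta i k q); last first.
    by apply: eq_bigr => j /negPf ji; rewrite ffunE ji.
  (* When the index wraps around, both sides are 0: on the left [zeta] is taken one step before the
     first knot, on the right at a last knot. *)
  have [kK|kK] := eqVneq (k i).+1 K.
    rewrite vanish_first ?(vanish_last kK) ?mul0r//.
    by rewrite ffunE eqxx/= kK modnn.
  have ksi : (s k i : nat) = (k i).+1.
    by rewrite ffunE eqxx/= modn_small// ltn_neqAle kK ltn_ord.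
  congr (zeta _ * (gamma _ * _)).
    apply/rowP => j; rewrite !mxE eqxx/=; case: (eqVneq j i) => [->|ji].
      by rewrite /= mulr1 ksi -natr1; ring.
    by rewrite ffunE (negPf ji) mulr0 add0r.
  by rewrite ksi -natr1; ring.
transitivity (h^-1 * (\sum_k zeta (knot k) * (gamma (y - (k i)%:R) * split_theta i k q)
    - \sum_k H (s k))).
  rewrite -sumrB mulr_sumr; apply: eq_bigr => k _; rewrite Hs; ring.
have -> : \sum_k H (s k) = \sum_k H k by rewrite [RHS](reindex_inj s_inj).
by rewrite -sumrB mulr_sumr; apply: eq_bigr => k _; rewrite sw /H; ring.
Qed.

End quasi_interpolant.

End spline_approximation.

Section test_approximation.
Context {R : realType} {n : nat}.
Implicit Types (zeta : 'rV[R]_n -> R) (q : 'rV[R]_n) (L e : R).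

Lemma spline_weight_neq0 (theta : 'I_n -> R -> R) (h A : R) K
    (k : {ffun 'I_n -> 'I_K}) q : 0 < h ->
  (forall j x, ~~ (0 < x < 3) -> theta j x = 0) ->
  spline_weight h A theta k q != 0 -> forall j, `|knot h A k 0 j - q 0 j| <= 3 * h.
Proof.
move=> h0 t0 /prodf_neq0 W j.
have : 0 < (q 0 j + A) / h - (k j)%:R < 3.
  by apply: contraT => /(t0 j) E; have := W j isT; rewrite E eqxx.
rewrite subr_gt0 ltr_pdivlMr// ltrBlDr ltr_pdivrMr// mulrDl => /andP[W1 W2].
by rewrite mxE ler_norml; apply/andP; split; lra.
Qed.

Lemma MVT_partial zeta (i : 'I_n) q (h : R) : 0 < h ->
  (forall q, derivable zeta q (delta_mx 0 i)) ->
  exists2 s, - h < s < 0 & (zeta q - zeta ((- h) *: delta_mx 0 i + q)) / h =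
    partial i zeta (s *: delta_mx 0 i + q).
Proof.
move=> h0 dz; have hN : - h < 0 by rewrite oppr_lt0.
have [|s s0] := @MVT_derive R (fun s => zeta (s *: delta_mx 0 i + q))
    (fun s => partial i zeta (s *: delta_mx 0 i + q)) (- h) 0 _ hN.
  by move=> x; exact: is_derive_line_at.
rewrite scale0r add0r sub0r opprK => ->; exists s => //.
by rewrite mulfK// gt_eqF.
Qed.

(** At every point the approximant averages values of [zeta] taken nearby, and its partials average
    nearby values of the partials of [zeta]; uniform continuity concludes. *)
Lemma test_approx zeta L e : 0 <= L -> Ck 1 zeta -> (forall q, 0 <= zeta q) ->
  vanish_out L zeta -> 0 < e ->
  exists zh : 'rV[R]_n -> R,
    [/\ test_function zh, forall q, 0 <= zh q, vanish_out (L + 1) zh,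
        forall q, `|zh q - zeta q| <= e &
        forall i q, `|partial i zh q - partial i zeta q| <= e].
Proof.
move=> L0 [cz [dz pz]] z0 vz e0.
have [beta [gamma [sbeta dbeta [beta0 gamma0] [betaS gammaS] sums]]] := @spline_exists R.
(* 4h = 3h + h: splines supported in [0, 3] only see knots within 3h, and the mean value theorem
   moves the point by at most another h. *)
have near_uniform (F : 'rV[R]_n -> R) : continuous F -> vanish_out L F ->
    \forall h \near (0 : R)^'+, forall q q', (forall i, `|q' 0 i - q 0 i| <= 4 * h) ->
    `|F q' - F q| <= e.
  move=> cF vF; have [d d0 dF] := vanish_out_uniform cF vF e0.
  have : \forall h \near (0 : R)^'+, h < d / 4 by apply: nbhs_right_lt; rewrite divr_gt0.
  apply: filterS => h; rewrite ltr_pdivlMr// => hd q q' qq'.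
  by apply: dF => i; apply: le_trans (qq' i) _; rewrite mulrC ltW.
have U0 := near_uniform _ cz vz.
have /filter_forall U1 : forall i, _ := fun i =>
  near_uniform _ (pz i).1 (vanish_out_partial i vz).
have hs : \forall h \near (0 : R)^'+, h < 1 / 10 by apply: nbhs_right_lt.
have [h [[[{}U0 {}U1] {}hs] /= h0]] := filter_ex (filterI (filterI (filterI U0 U1) hs)
  (nbhs_right_gt (0 : R))).
(* The grid overshoots the support of [zeta] on both sides. As h < 1/10, the spline arguments lie in
   [3, K] wherever |q_j| <= L + 3h, so the translates sum to 1 there, while [zeta] vanishes at the
   last knots and one step before the first. *)
pose A := L + 1; pose K := (Num.truncn ((L + L + 2) / h)).+1.
have hK : L + L + 2 <= h * K%:R.
  by rewrite mulrC -ler_pdivrMr// ltW// truncnS_gt.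
pose zh := quasi_interpolant beta zeta h A K.
have L3 : L <= L + 3 * h by lra.
have vzh : vanish_out (L + 3 * h) zh.
  move=> q i Lq; apply: big1 => k _.
  have [->|/(spline_weight_neq0 h0 (fun _ => betaS)) W] :=
    eqVneq (spline_weight h A (fun=> beta) k q) 0; first by rewrite mulr0.
  rewrite (vz _ i) ?mul0r//.
  have := W i; have := ler_normB (knot h A k 0 i) (knot h A k 0 i - q 0 i).
  by rewrite opprB addrC subrK; lra.
have interior q : (forall j, `|q 0 j| <= L + 3 * h) ->
    forall j, 3 <= (q 0 j + A) / h <= K%:R.
  move=> qL j; have := qL j; rewrite ler_norml => /andP[q1 q2].
  by rewrite ler_pdivlMr// ler_pdivrMr// [K%:R * h]mulrC /A; apply/andP; split; lra.
have outside q : ~ (forall j, `|q 0 j| <= L + 3 * h) ->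
    exists j, L + 3 * h < `|q 0 j|.
  by move=> /existsNP[j /negP]; rewrite -ltNge; exists j.
have last0 (k : {ffun 'I_n -> 'I_K}) (i : 'I_n) :
    (k i).+1 = K -> zeta (knot h A k) = 0.
  move=> kK; apply: (vz _ i); rewrite mxE.
  have -> : (k i)%:R = K%:R - 1 :> R.
    by have := congr1 (fun x : nat => x%:R : R) kK; rewrite -natr1 => <-; rewrite addrK.
  by rewrite (lt_le_trans _ (ler_norm _))// /A; lra.
have first0 (k : {ffun 'I_n -> 'I_K}) (i : 'I_n) : (k i : nat) = 0%N ->
    zeta ((- h) *: delta_mx 0 i + knot h A k) = 0.
  move=> k0; apply: (vz _ i); rewrite !mxE !eqxx k0 mulr0 sub0r mulr1.
  by rewrite -normrN (lt_le_trans _ (ler_norm _))// /A; lra.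
exists zh; split.
- split; first by move=> k; exact: Ck_quasi_interpolant.
  exact: compact_support_vanish_out vzh.
- move=> q; apply: sumr_ge0 => k _; rewrite mulr_ge0//.
  by apply: prodr_ge0.
- by apply: vanish_outW vzh; lra.
- move=> q; have [qL|/outside[j Lq]] := pselect (forall j, `|q 0 j| <= L + 3 * h).
    apply: weighted_average => [k||k /(spline_weight_neq0 h0 (fun _ => betaS)) W].
    + by apply: prodr_ge0.
    + by apply: spline_weight_sum => j; have [] := sums _ _ (interior q qL j).
    + by apply: U0 => j; apply: le_trans (W j) _; lra.
  by rewrite (vzh q j)// (vz q j) ?(le_lt_trans L3)// subrr normr0 ltW.
- move=> i q; have [qL|/outside[j Lq]] := pselect (forall j, `|q 0 j| <= L + 3 * h).
    rewrite (partial_quasi_interpolant dbeta last0 first0).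
    pose theta (j : 'I_n) := if j == i then gamma else beta.
    have thetaS (j : 'I_n) (x : R) : ~~ (0 < x < 3) -> theta j x = 0.
      by rewrite /theta; case: ifP => _; [exact: gammaS|exact: betaS].
    apply: weighted_average => [k||k /(spline_weight_neq0 h0 thetaS) W].
    + by apply: prodr_ge0 => j _; case: ifP.
    + apply: spline_weight_sum => j; have [] := sums _ _ (interior q qL j).
      by case: ifP.
    + have [s /andP[s1 s2] ->] := MVT_partial (knot h A k) h0 (dz i).
      apply: U1 => j; rewrite mxE -addrA; apply: le_trans (ler_normD _ _) _.
      have : `|(s *: delta_mx 0 i : 'rV[R]_n) 0 j| <= h.
        rewrite !mxE eqxx/=; case: (j == i); last by rewrite mulr0 normr0 ltW.
        by rewrite mulr1 ltr0_norm//; lra.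
      by have := W j; lra.
  rewrite (vanish_out_partial i vzh Lq) (vanish_out_partial i vz (le_lt_trans L3 Lq)).
  by rewrite subrr normr0 ltW.
Qed.

End test_approximation.

(** * C^1 regularity near a point *)

Section pointwise_C1.
Context {R : realType} {n : nat}.
Implicit Types (F G : 'rV[R]_n -> R) (q : 'rV[R]_n) (i : 'I_n).

(** A pointwise form of [Ck 1], suited to the gauge and its radial field, which are regular only
    away from the centre and from the axis respectively. *)
Definition C1at q F := {for q, continuous F} /\
  forall i, (\forall q' \near q, derivable F q' (delta_mx 0 i)) /\
            {for q, continuous (partial i F)}.

Lemma near_continuous (T : topologicalType) (f g : T -> R) (x : T) :
  (\forall y \near x, f y = g y) -> {for x, continuous g} -> {for x, continuous f}.
Proof.
move=> fg; rewrite /prop_for /continuous_at (nbhs_singleton fg) => cg.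
by apply: cvg_trans cg; apply: near_eq_cvg; apply: filterS fg => y ->.
Qed.

Lemma Ck1_C1at F : (forall q, C1at q F) <-> Ck 1 F.
Proof.
split=> [C1F|[cF [dF pF]] q]; last first.
  split; first exact: cF.
  by by move=> i; split; [near=> q'; exact: dF|exact: (pF i).1].
split; first by move=> q; exact: (C1F q).1.
split=> [i q|i]; first by have [_ /(_ i)[/nbhs_singleton]] := C1F q.
by split=> // q; exact: ((C1F q).2 i).2.
Unshelve. all: by end_near. Qed.

Lemma C1at_derivable q F i : C1at q F -> derivable F q (delta_mx 0 i).
Proof. by case=> _ /(_ i)[/nbhs_singleton]. Qed.

Lemma C1at_near q F G : (\forall q' \near q, F q' = G q') -> C1at q G -> C1at q F.
Proof.
move=> FG [cG dG]; split; first exact: near_continuous cG.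
move=> i; have [dGi pGi] := dG i; split.
  near=> q'; apply: (near_eq_derivable (f := G)); last by near: q'.
  near: q'; apply: filterS (nbhs_interior FG) => y.
  by rewrite /interior /= => H; apply: filterS H => z ->.
apply: near_continuous pGi; apply: filterS (nbhs_interior FG) => y.
by rewrite /interior /= => H; exact: near_eq_derive.
Unshelve. all: by end_near. Qed.

Lemma C1at_cst q (c : R) : C1at q (fun=> c).
Proof. by move: q; apply/Ck1_C1at; exact: Ck_cst. Qed.

Lemma C1at_mul q F G : C1at q F -> C1at q G -> C1at q (fun q => F q * G q).
Proof.
move=> [cF dF] [cG dG]; split; first exact: contM.
move=> i; have [dFi pFi] := dF i; have [dGi pGi] := dG i; split.
  by apply: filterS2 dFi dGi => q'; exact: derivableM.
apply: (@near_continuous _ _ (fun q => F q * partial i G q + G q * partial i F q)).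
  by apply: filterS2 dFi dGi => q' dF' dG'; rewrite /partial deriveM.
by apply: contD; exact: contM.
Qed.

Lemma C1at_add q F G : C1at q F -> C1at q G -> C1at q (fun q => F q + G q).
Proof.
move=> [cF dF] [cG dG]; split; first exact: contD.
move=> i; have [dFi pFi] := dF i; have [dGi pGi] := dG i; split.
  by apply: filterS2 dFi dGi => q'; exact: derivableD.
apply: (@near_continuous _ _ (fun q => partial i F q + partial i G q)).
  by apply: filterS2 dFi dGi => q' dF' dG'; rewrite /partial deriveD.
exact: contD.
Qed.

Lemma C1at_sub q F G : C1at q F -> C1at q G -> C1at q (fun q => F q - G q).
Proof.
move=> CF CG; rewrite (_ : (fun q => _) = (fun q => F q + (-1) * G q)).
  exact: C1at_add CF (C1at_mul (@C1at_cst q (-1)) CG).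
by apply/funext => x; rewrite mulN1r.
Qed.

Lemma C1at_comp q F (phi : R -> R) : C1at q F ->
  (\forall x \near F q, derivable phi x 1) -> {for F q, continuous (derive1 phi)} ->
  C1at q (fun q => phi (F q)).
Proof.
move=> [cF dF] dphi cdphi; split.
  apply: cont_comp => //.
  exact/differentiable_continuous/derivable1_diffP/(nbhs_singleton dphi).
move=> i; have [dFi pFi] := dF i.
have near_d : \forall q' \near q, is_derive q' (delta_mx 0 i) (fun q => phi (F q))
    (derive1 phi (F q') * partial i F q').
  apply: filterS2 dFi (cF _ dphi) => q' dF' dphi'.
  by apply: is_derive_compR; split; rewrite ?derive1E.
split; first by apply: filterS near_d => q' [].
apply: (@near_continuous _ _ (fun q => derive1 phi (F q) * partial i F q)).
  by apply: filterS near_d => q' [].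
by apply: contM => //; exact: cont_comp.
Qed.

Lemma is_derive_inv q v F (b : R) : F q != 0 -> is_derive q v F b ->
  is_derive q v (fun q => (F q)^-1) (- (F q) ^- 2 * b).
Proof.
move=> F0 dF; apply: (@is_derive_compR _ _ (fun y : R => y^-1)) => //.
rewrite -[X in is_derive _ _ _ X]mulr1.
exact: (is_deriveV (f := id) F0 (is_derive_id _ _)).
Qed.

Lemma is_derive_sqrt q v F (b : R) : 0 < F q -> is_derive q v F b ->
  is_derive q v (fun q => Num.sqrt (F q)) ((2 * Num.sqrt (F q))^-1 * b).
Proof. by move=> F0 dF; apply: is_derive_compR => //; exact: is_derive1_sqrt. Qed.

Lemma C1at_sqrt q F : C1at q F -> 0 < F q -> C1at q (fun q => Num.sqrt (F q)).
Proof.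
move=> CF F0; apply: C1at_comp => //.
  near=> x; have x0 : 0 < x by near: x; exact: lt_nbhsr.
  by have [] := is_derive1_sqrt x0.
apply: (@near_continuous _ _ (fun x => (2 * Num.sqrt x)^-1)).
  near=> x; have x0 : 0 < x by near: x; exact: lt_nbhsr.
  by rewrite derive1E; have [_ ->] := is_derive1_sqrt x0.
apply: continuousV; first by rewrite mulf_neq0// gt_eqF// sqrtr_gt0.
by apply: contM; [exact: contC|exact: sqrt_continuous].
Unshelve. all: by end_near. Qed.

Lemma C1at_inv q F : C1at q F -> F q != 0 -> C1at q (fun q => (F q)^-1).
Proof.
move=> CF F0.
have dV (x : R) : x != 0 -> is_derive x 1 (fun y : R => y^-1) (- x ^- 2).
  move=> x0; rewrite -[X in is_derive _ _ _ X]mulr1.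
  exact: (is_deriveV (f := id) x0 (is_derive_id _ _)).
have near0 : \forall x \near F q, x != 0 :> R.
  have [|] := ltP (F q) 0 => Fq.
    by near=> x; rewrite lt_eqF//; near: x; exact: lt_nbhsl.
  have {}Fq : 0 < F q by rewrite lt_def F0.
  by near=> x; rewrite gt_eqF//; near: x; exact: lt_nbhsr.
apply: (@C1at_comp q F (fun y : R => y^-1)) => //.
  by apply: filterS near0 => x /dV[].
apply: (@near_continuous _ _ (fun x : R => - x ^- 2)).
  by apply: filterS near0 => x /dV[_ <-]; rewrite derive1E.
apply: (@continuousN _ _ _ (fun x : R => x ^- 2)).
apply: continuousV; first by rewrite expf_neq0.
exact: exprn_continuous.
Unshelve. all: by end_near. Qed.

Lemma C1at_zero q F : (\forall q' \near q, F q' = 0) -> C1at q F.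
Proof. by move=> F0; apply: (C1at_near F0); exact: C1at_cst. Qed.

End pointwise_C1.

(** * Horizontal calculus and the Koranyi gauge *)

Section horizontal_calculus.
Context {R : realType} {m : nat}.
Implicit Types (u v : Hpoint R m -> R) (q : Hpoint R m) (j : 'I_m).

Lemma HX_mul j u v q : C1at q u -> C1at q v ->
  HX j (fun q => u q * v q) q = u q * HX j v q + v q * HX j u q.
Proof.
move=> Cu Cv; rewrite /HX /partial !deriveM; try exact: C1at_derivable.
rewrite /GRing.scale/=; move: (derive u q (delta_mx 0 (idx_x j)))
  (derive v q (delta_mx 0 (idx_x j))) (derive u q (delta_mx 0 idx_t))
  (derive v q (delta_mx 0 idx_t)) (2 * q 0 _) => *; ring.
Qed.

Lemma HY_mul j u v q : C1at q u -> C1at q v ->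
  HY j (fun q => u q * v q) q = u q * HY j v q + v q * HY j u q.
Proof.
move=> Cu Cv; rewrite /HY /partial !deriveM; try exact: C1at_derivable.
rewrite /GRing.scale/=; move: (derive u q (delta_mx 0 (idx_y j)))
  (derive v q (delta_mx 0 (idx_y j))) (derive u q (delta_mx 0 idx_t))
  (derive v q (delta_mx 0 idx_t)) (2 * q 0 _) => *; ring.
Qed.

Lemma HY_sub j u v q : C1at q u -> C1at q v ->
  HY j (fun q => u q - v q) q = HY j u q - HY j v q.
Proof.
move=> Cu Cv; rewrite /HY /partial !deriveB; try exact: C1at_derivable.
by move: (2 * q 0 _) ('D_ _ u q) ('D_ _ v q) ('D_ _ u q) ('D_ _ v q) => *; ring.
Qed.

Lemma HX_near0 j u q : (\forall q' \near q, u q' = 0) -> HX j u q = 0.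
Proof.
by move=> u0; rewrite /HX /partial !(near_eq_derive (g := cst 0) _ u0) !derive_cst mulr0 addr0.
Qed.

Lemma HY_near0 j u q : (\forall q' \near q, u q' = 0) -> HY j u q = 0.
Proof.
by move=> u0; rewrite /HY /partial !(near_eq_derive (g := cst 0) _ u0) !derive_cst mulr0 subr0.
Qed.

Lemma continuous_HX j u q : C1at q u -> {for q, continuous (HX j u)}.
Proof.
move=> [_ Cu]; apply: contD; first exact: (Cu _).2.
apply: contM; last exact: (Cu _).2.
by apply: contM; [exact: contC|exact: continuous_coord].
Qed.

Lemma continuous_HY j u q : C1at q u -> {for q, continuous (HY j u)}.
Proof.
move=> [_ Cu]; apply: contB; first exact: (Cu _).2.
apply: contM; last exact: (Cu _).2.
by apply: contM; [exact: contC|exact: continuous_coord].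
Qed.

Lemma vanish_out_HX L j u : vanish_out L u -> vanish_out L (HX j u).
Proof.
move=> vu q i Lq; rewrite /HX (vanish_out_partial _ vu Lq).
by rewrite (vanish_out_partial _ vu Lq) mulr0 addr0.
Qed.

Lemma vanish_out_HY L j u : vanish_out L u -> vanish_out L (HY j u).
Proof.
move=> vu q i Lq; rewrite /HY (vanish_out_partial _ vu Lq).
by rewrite (vanish_out_partial _ vu Lq) mulr0 subr0.
Qed.

Lemma continuous_hgrad_dot u v q : C1at q u -> C1at q v ->
  {for q, continuous (hgrad_dot u v)}.
Proof.
move=> Cu Cv; apply: cont_sum => j _.
by apply: contD; apply: contM;
  [exact: continuous_HX|exact: continuous_HX|exact: continuous_HY|exact: continuous_HY].
Qed.

Lemma continuous_hgrad_norm u q : C1at q u -> {for q, continuous (hgrad_norm u)}.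
Proof.
move=> Cu; apply: cont_comp; first exact: continuous_hgrad_dot.
exact: sqrt_continuous.
Qed.

Lemma delta_xx j k : (delta_mx 0 (idx_x j) : Hpoint R m) 0 (idx_x k) = (k == j)%:R.
Proof. by rewrite mxE eqxx /= /idx_x !eq_shift. Qed.
Lemma delta_xy j k : (delta_mx 0 (idx_x j) : Hpoint R m) 0 (idx_y k) = 0.
Proof. by rewrite mxE eqxx /= /idx_x /idx_y !eq_shift. Qed.
Lemma delta_xt j : (delta_mx 0 (idx_x j) : Hpoint R m) 0 idx_t = 0.
Proof. by rewrite mxE eqxx /= /idx_x /idx_t !eq_shift. Qed.
Lemma delta_yx j k : (delta_mx 0 (idx_y j) : Hpoint R m) 0 (idx_x k) = 0.
Proof. by rewrite mxE eqxx /= /idx_x /idx_y !eq_shift. Qed.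
Lemma delta_yy j k : (delta_mx 0 (idx_y j) : Hpoint R m) 0 (idx_y k) = (k == j)%:R.
Proof. by rewrite mxE eqxx /= /idx_y !eq_shift. Qed.
Lemma delta_yt j : (delta_mx 0 (idx_y j) : Hpoint R m) 0 idx_t = 0.
Proof. by rewrite mxE eqxx /= /idx_y /idx_t !eq_shift. Qed.
Lemma delta_tx k : (delta_mx 0 idx_t : Hpoint R m) 0 (idx_x k) = 0.
Proof. by rewrite mxE eqxx /= /idx_x /idx_t !eq_shift. Qed.
Lemma delta_ty k : (delta_mx 0 idx_t : Hpoint R m) 0 (idx_y k) = 0.
Proof. by rewrite mxE eqxx /= /idx_y /idx_t !eq_shift. Qed.
Lemma delta_tt : (delta_mx 0 idx_t : Hpoint R m) 0 idx_t = 1.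
Proof. by rewrite mxE !eqxx. Qed.

Definition delta_idx := (delta_xx, delta_xy, delta_xt, delta_yx, delta_yy, delta_yt,
  delta_tx, delta_ty, delta_tt).

Lemma HX_derive j u q (l : Hpoint R m -> R) : (forall w, is_derive q w u (l w)) ->
  HX j u q = l (delta_mx 0 (idx_x j)) + 2 * q 0 (idx_y j) * l (delta_mx 0 idx_t).
Proof. by move=> dl; rewrite /HX /partial; have [_ ->] := dl (delta_mx 0 (idx_x j));
  have [_ ->] := dl (delta_mx 0 idx_t). Qed.

Lemma HY_derive j u q (l : Hpoint R m -> R) : (forall w, is_derive q w u (l w)) ->
  HY j u q = l (delta_mx 0 (idx_y j)) - 2 * q 0 (idx_x j) * l (delta_mx 0 idx_t).
Proof. by move=> dl; rewrite /HY /partial; have [_ ->] := dl (delta_mx 0 (idx_y j));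
  have [_ ->] := dl (delta_mx 0 idx_t). Qed.

Lemma Ck_coordinate k (i : 'I_(m + m + 1)) : Ck k (fun q : Hpoint R m => q 0 i).
Proof.
apply: (@Ck_coord R _ k id); case: k => [|k].
  by split => // x; exact: cvg_id.
by apply: (C1dS (df := fun=> 1)) => //; exact: C1d_cst.
Qed.

(** The coefficient 2 y_j does not depend on t, so it can be moved inside the t-derivative and X_j u
    becomes a sum of Euclidean partial derivatives. *)
Lemma lebesgue_int_HX j u L : Ck 1 u -> vanish_out L u -> lebesgue_int (HX j u) = 0.
Proof.
move=> Cu vu; have [cu [du pu]] := Cu.
pose w q := q 0 (idx_y j) * u q.
have Cw : Ck 1 w by apply: CkM => //; exact: Ck_coordinate.
have vw : vanish_out L w by exact: vanish_outMr.
have wE : partial idx_t w = (fun q => q 0 (idx_y j) * partial idx_t u q).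
  apply/funext => q; rewrite /partial.
  have du' : is_derive q (delta_mx 0 idx_t) u (partial idx_t u q) by split.
  have [_ ->] := is_derive_mul (is_derive_coord (idx_y j) q _) du'.
  by rewrite delta_ty mulr0 addr0.
rewrite (_ : HX j u = (fun q => partial (idx_x j) u q + 2 * partial idx_t w q)); last first.
  by apply/funext => q; rewrite wE /HX mulrA.
have cpw := (Cw.2.2 idx_t).1.
rewrite (@lebesgue_intD _ _ L); first last.
- by apply: vanish_outMr; exact: vanish_out_partial.
- move=> q; exact: (@contM _ _ (fun=> 2) _ _ (@contC _ _ _ _) (cpw q)).
- exact: vanish_out_partial.
- exact: (pu _).1.
rewrite (@lebesgue_intZ _ _ L) //; last exact: vanish_out_partial.
rewrite (lebesgue_int_partial cu (du _) (pu _).1 vu).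
by rewrite (lebesgue_int_partial Cw.1 (Cw.2.1 _) cpw vw) mulr0 addr0.
Qed.

Lemma lebesgue_int_HY j u L : Ck 1 u -> vanish_out L u -> lebesgue_int (HY j u) = 0.
Proof.
move=> Cu vu; have [cu [du pu]] := Cu.
pose w q := q 0 (idx_x j) * u q.
have Cw : Ck 1 w by apply: CkM => //; exact: Ck_coordinate.
have vw : vanish_out L w by exact: vanish_outMr.
have wE : partial idx_t w = (fun q => q 0 (idx_x j) * partial idx_t u q).
  apply/funext => q; rewrite /partial.
  have du' : is_derive q (delta_mx 0 idx_t) u (partial idx_t u q) by split.
  have [_ ->] := is_derive_mul (is_derive_coord (idx_x j) q _) du'.
  by rewrite delta_tx mulr0 addr0.
rewrite (_ : HY j u = (fun q => partial (idx_y j) u q + (- 2) * partial idx_t w q)); last first.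
  by apply/funext => q; rewrite wE /HY mulrA mulNr mulNr.
have cpw := (Cw.2.2 idx_t).1.
rewrite (@lebesgue_intD _ _ L); first last.
- by apply: vanish_outMr; exact: vanish_out_partial.
- move=> q; exact: (@contM _ _ (fun=> - 2) _ _ (@contC _ _ _ _) (cpw q)).
- exact: vanish_out_partial.
- exact: (pu _).1.
rewrite (@lebesgue_intZ _ _ L) //; last exact: vanish_out_partial.
rewrite (lebesgue_int_partial cu (du _) (pu _).1 vu).
by rewrite (lebesgue_int_partial Cw.1 (Cw.2.1 _) cpw vw) mulr0 addr0.
Qed.

Lemma horizontal_divergence_theorem (P Q : 'I_m -> Hpoint R m -> R) L :
  (forall j, Ck 1 (P j)) -> (forall j, Ck 1 (Q j)) ->
  (forall j, vanish_out L (P j)) -> (forall j, vanish_out L (Q j)) ->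
  lebesgue_int (fun q => \sum_j (HX j (P j) q + HY j (Q j) q)) = 0.
Proof.
move=> CP CQ vP vQ.
have cX j : continuous (HX j (P j)).
  by move=> q; apply: continuous_HX; exact: (Ck1_C1at _).2.
have cY j : continuous (HY j (Q j)).
  by move=> q; apply: continuous_HY; exact: (Ck1_C1at _).2.
have vX j : vanish_out L (HX j (P j)) by exact: vanish_out_HX.
have vY j : vanish_out L (HY j (Q j)) by exact: vanish_out_HY.
rewrite (@lebesgue_int_sum _ _ L).
- rewrite big1// => j _; rewrite (@lebesgue_intD _ _ L)//.
  by rewrite (lebesgue_int_HX _ (CP j) (vP j)) (lebesgue_int_HY _ (CQ j) (vQ j)) addr0.
- by move=> j q; apply: contD; [exact: cX|exact: cY].
- by move=> j; exact: vanish_outD.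
Qed.

End horizontal_calculus.

(** * The Koranyi gauge and the phi-Laplacian of its multiples *)

Section gauge.
Context {R : realType} {m : nat}.
Implicit Types (c q v : Hpoint R m) (j : 'I_m).

(* [(ga c, gb c, gT c)] are the coordinates of c^-1 o q and [gr c] is the
   Koranyi norm of c^-1 o q; its horizontal gradient is
   [(gE c, gF c) / gr c ^+ 3]. *)
Definition ga c j q : R := q 0 (idx_x j) - c 0 (idx_x j).
Definition gb c j q : R := q 0 (idx_y j) - c 0 (idx_y j).
Definition gT c q : R := q 0 idx_t - c 0 idx_t +
  2 * \sum_j (c 0 (idx_x j) * q 0 (idx_y j) - c 0 (idx_y j) * q 0 (idx_x j)).
Definition grho c q : R := \sum_j (ga c j q ^+ 2 + gb c j q ^+ 2).
Definition gN c q : R := grho c q ^+ 2 + gT c q ^+ 2.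
Definition gE c j q : R := grho c q * ga c j q + gT c q * gb c j q.
Definition gF c j q : R := grho c q * gb c j q - gT c q * ga c j q.
Definition gsigma c q : R := Num.sqrt (grho c q).
Definition gr c q : R := Num.sqrt (Num.sqrt (gN c q)).

Lemma grho_ge0 c q : 0 <= grho c q.
Proof. by apply: sumr_ge0 => j _; rewrite addr_ge0// sqr_ge0. Qed.

Lemma gN_ge0 c q : 0 <= gN c q.
Proof. by rewrite addr_ge0// sqr_ge0. Qed.

Lemma gN_gt0 c q : 0 < grho c q -> 0 < gN c q.
Proof. by move=> r0; rewrite ltr_pwDl ?sqr_ge0// exprn_gt0. Qed.

Lemma gr_ge0 c q : 0 <= gr c q. Proof. exact: sqrtr_ge0. Qed.

Lemma gr_gt0 c q : 0 < gN c q -> 0 < gr c q.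
Proof. by move=> N0; rewrite !sqrtr_gt0. Qed.

Lemma gsigma2 c q : gsigma c q ^+ 2 = grho c q.
Proof. by rewrite sqr_sqrtr// grho_ge0. Qed.

Lemma gr2 c q : gr c q ^+ 2 = Num.sqrt (gN c q).
Proof. by rewrite sqr_sqrtr// sqrtr_ge0. Qed.

Lemma gr4 c q : gr c q ^+ 4 = gN c q.
Proof. by rewrite (exprM _ 2 2) gr2 sqr_sqrtr// gN_ge0. Qed.

(** In complex notation gE + i gF = (rho - i T)(a + i b). Dividing by r^6 gives sigma / r as the
    length of the gradient of r. *)
Lemma gEF_sqr c q : \sum_j (gE c j q ^+ 2 + gF c j q ^+ 2) = gN c q * grho c q.
Proof.
rewrite [in RHS]/grho mulr_sumr; apply: eq_bigr => j _.
by rewrite /gE /gF /gN; ring.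
Qed.

Lemma gsigma_le_gr c q : gsigma c q <= gr c q.
Proof.
rewrite -(@ler_pXn2r _ 4) ?nnegrE ?sqrtr_ge0// gr4 (exprM _ 2 2) gsigma2.
by rewrite lerDl sqr_ge0.
Qed.

Lemma is_derive_ga c j q v : is_derive q v (ga c j) (v 0 (idx_x j)).
Proof.
rewrite -[X in is_derive _ _ _ X]subr0.
exact: is_derive_sub (is_derive_coord _ _ _) (is_derive_cst _ _ _).
Qed.

Lemma is_derive_gb c j q v : is_derive q v (gb c j) (v 0 (idx_y j)).
Proof.
rewrite -[X in is_derive _ _ _ X]subr0.
exact: is_derive_sub (is_derive_coord _ _ _) (is_derive_cst _ _ _).
Qed.

Lemma is_derive_grho c q v : is_derive q v (grho c)
  (\sum_j (2 * (ga c j q * v 0 (idx_x j)) + 2 * (gb c j q * v 0 (idx_y j)))).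
Proof.
apply: is_derive_bigsum => j.
have := is_derive_add (is_derive_mul (is_derive_ga c j q v) (is_derive_ga c j q v))
  (is_derive_mul (is_derive_gb c j q v) (is_derive_gb c j q v)).
by congr is_derive; ring.
Qed.

Lemma is_derive_gT c q v : is_derive q v (gT c) (v 0 idx_t +
  2 * \sum_j (c 0 (idx_x j) * v 0 (idx_y j) - c 0 (idx_y j) * v 0 (idx_x j))).
Proof.
apply: is_derive_add.
  rewrite -[X in is_derive _ _ _ X]subr0.
  exact: is_derive_sub (is_derive_coord _ _ _) (is_derive_cst _ _ _).
apply: is_derive_scale; apply: is_derive_bigsum => j.
by apply: is_derive_sub; apply: is_derive_scale; exact: is_derive_coord.
Qed.

Let sum_delta j (f : 'I_m -> R) : \sum_k f k * (k == j)%:R = f j.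
Proof.
rewrite (bigD1 j)//= eqxx mulr1 big1 ?addr0// => k /negPf ->.
by rewrite mulr0.
Qed.

Lemma HX_ga c j k q : HX j (ga c k) q = (k == j)%:R.
Proof. by rewrite (HX_derive _ (is_derive_ga c k q)) !delta_idx mulr0 addr0. Qed.

Lemma HY_ga c j k q : HY j (ga c k) q = 0.
Proof. by rewrite (HY_derive _ (is_derive_ga c k q)) !delta_idx mulr0 subr0. Qed.

Lemma HX_gb c j k q : HX j (gb c k) q = 0.
Proof. by rewrite (HX_derive _ (is_derive_gb c k q)) !delta_idx mulr0 addr0. Qed.

Lemma HY_gb c j k q : HY j (gb c k) q = (k == j)%:R.
Proof. by rewrite (HY_derive _ (is_derive_gb c k q)) !delta_idx mulr0 subr0. Qed.

Lemma HX_grho c j q : HX j (grho c) q = 2 * ga c j q.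
Proof.
rewrite (HX_derive _ (is_derive_grho c q)).
under eq_bigr => k _ do rewrite !delta_idx !mulr0 addr0 mulrA.
rewrite sum_delta big1 ?mulr0 ?addr0// => k _.
by rewrite !delta_idx !mulr0 addr0.
Qed.

Lemma HY_grho c j q : HY j (grho c) q = 2 * gb c j q.
Proof.
rewrite (HY_derive _ (is_derive_grho c q)).
under eq_bigr => k _ do rewrite !delta_idx !mulr0 add0r mulrA.
rewrite sum_delta big1 ?mulr0 ?subr0// => k _.
by rewrite !delta_idx !mulr0 addr0.
Qed.

(** Left invariance: -2 c_y from the group law and 2 q_y from the field add up to the relative
    coordinate. *)
Lemma HX_gT c j q : HX j (gT c) q = 2 * gb c j q.
Proof.
rewrite (HX_derive _ (is_derive_gT c q)) !delta_idx.
under eq_bigr => k _ do rewrite !delta_idx mulr0 sub0r -mulNr.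
rewrite sum_delta big1 => [|k _]; last by rewrite !delta_idx !mulr0 subr0.
by rewrite /gb; ring.
Qed.

Lemma HY_gT c j q : HY j (gT c) q = - (2 * ga c j q).
Proof.
rewrite (HY_derive _ (is_derive_gT c q)) !delta_idx.
under eq_bigr => k _ do rewrite !delta_idx mulr0 subr0.
rewrite sum_delta big1 => [|k _]; last by rewrite !delta_idx !mulr0 subr0.
by rewrite /ga; ring.
Qed.

Lemma C1at_coordinate (i : 'I_(m + m + 1)) q : C1at q (fun q : Hpoint R m => q 0 i).
Proof. by move: q; apply/Ck1_C1at; exact: Ck_coordinate. Qed.

Lemma C1at_ga c j q : C1at q (ga c j).
Proof. by apply: C1at_sub; [exact: C1at_coordinate|exact: C1at_cst]. Qed.

Lemma C1at_gb c j q : C1at q (gb c j).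
Proof. by apply: C1at_sub; [exact: C1at_coordinate|exact: C1at_cst]. Qed.

Lemma C1at_sum (I : Type) (r : seq I) (F : I -> Hpoint R m -> R) q :
  (forall k, C1at q (F k)) -> C1at q (fun q => \sum_(k <- r) F k q).
Proof.
move=> CF; elim: r => [|k r IH].
  rewrite (_ : (fun q => _) = (fun=> 0)); first exact: C1at_cst.
  by apply/funext => x; rewrite big_nil.
rewrite (_ : (fun q => _) = (fun q => F k q + \sum_(k <- r) F k q)).
  exact: C1at_add.
by apply/funext => x; rewrite big_cons.
Qed.

Lemma C1at_grho c q : C1at q (grho c).
Proof.
apply: C1at_sum => j.
by apply: C1at_add; apply: C1at_mul;
  [exact: C1at_ga|exact: C1at_ga|exact: C1at_gb|exact: C1at_gb].
Qed.

Lemma C1at_gT c q : C1at q (gT c).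
Proof.
apply: C1at_add; first by apply: C1at_sub; [exact: C1at_coordinate|exact: C1at_cst].
apply: C1at_mul; first exact: C1at_cst.
apply: C1at_sum => j; apply: C1at_sub; (apply: C1at_mul;
  [exact: C1at_cst|exact: C1at_coordinate]).
Qed.

Lemma C1at_gN c q : C1at q (gN c).
Proof.
by apply: C1at_add; apply: C1at_mul;
  [exact: C1at_grho|exact: C1at_grho|exact: C1at_gT|exact: C1at_gT].
Qed.

Lemma C1at_gE c j q : C1at q (gE c j).
Proof.
by apply: C1at_add; apply: C1at_mul;
  [exact: C1at_grho|exact: C1at_ga|exact: C1at_gT|exact: C1at_gb].
Qed.

Lemma C1at_gF c j q : C1at q (gF c j).
Proof.
by apply: C1at_sub; apply: C1at_mul;
  [exact: C1at_grho|exact: C1at_gb|exact: C1at_gT|exact: C1at_ga].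
Qed.

Lemma C1at_gsigma c q : 0 < grho c q -> C1at q (gsigma c).
Proof. by apply: C1at_sqrt; exact: C1at_grho. Qed.

Lemma C1at_gr c q : 0 < gN c q -> C1at q (gr c).
Proof.
move=> N0; apply: C1at_sqrt; last by rewrite sqrtr_gt0.
by apply: C1at_sqrt => //; exact: C1at_gN.
Qed.

Lemma continuous_gr c : continuous (gr c).
Proof.
move=> q; apply: (@cont_comp _ _ Num.sqrt (fun q => Num.sqrt (gN c q)));
  last exact: sqrt_continuous.
apply: (@cont_comp _ _ Num.sqrt (gN c)); last exact: sqrt_continuous.
by have [] := C1at_gN c q.
Qed.

(** For a function of (rho, T) with derivatives [al] and [be]; this reduces its horizontal
    derivatives to those of rho and T. *)
Lemma HX_chain c q u (al be : R) j :
  (forall i, is_derive q (delta_mx 0 i) u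
    (al * partial i (grho c) q + be * partial i (gT c) q)) ->
  HX j u q = 2 * (al * ga c j q + be * gb c j q).
Proof.
move=> du; rewrite /HX !(is_derive_partial (du _)).
have := HX_grho c j q; have := HX_gT c j q; rewrite /HX => T1 r1.
transitivity (al * (2 * ga c j q) + be * (2 * gb c j q)); last by ring.
rewrite -r1 -T1; move: (partial _ (grho c) q) (partial _ (grho c) q)
  (partial _ (gT c) q) (partial _ (gT c) q) (2 * q 0 _) => *; ring.
Qed.

Lemma HY_chain c q u (al be : R) j :
  (forall i, is_derive q (delta_mx 0 i) u
    (al * partial i (grho c) q + be * partial i (gT c) q)) ->
  HY j u q = 2 * (al * gb c j q - be * ga c j q).
Proof.
move=> du; rewrite /HY !(is_derive_partial (du _)).
have := HY_grho c j q; have := HY_gT c j q; rewrite /HY => T1 r1.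
transitivity (al * (2 * gb c j q) + be * - (2 * ga c j q)); last by ring.
rewrite -r1 -T1; move: (partial _ (grho c) q) (partial _ (grho c) q)
  (partial _ (gT c) q) (partial _ (gT c) q) (2 * q 0 _) => *; ring.
Qed.

Let is_derive_partial_grho c q i :
  is_derive q (delta_mx 0 i) (grho c) (partial i (grho c) q).
Proof. by split=> //; exact: C1at_derivable (C1at_grho c q). Qed.

Let is_derive_partial_gT c q i :
  is_derive q (delta_mx 0 i) (gT c) (partial i (gT c) q).
Proof. by split=> //; exact: C1at_derivable (C1at_gT c q). Qed.

Lemma is_derive_gsigma c q i : 0 < grho c q ->
  is_derive q (delta_mx 0 i) (gsigma c) ((2 * gsigma c q)^-1 * partial i (grho c) q).
Proof. by move=> r0; exact: is_derive_sqrt. Qed.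

Lemma is_derive_gr c q i : 0 < gN c q ->
  is_derive q (delta_mx 0 i) (gr c)
    (grho c q / (2 * gr c q ^+ 3) * partial i (grho c) q +
     gT c q / (2 * gr c q ^+ 3) * partial i (gT c) q).
Proof.
move=> N0; have r0 := gr_gt0 N0.
have dr := is_derive_partial_grho c q i; have dT := is_derive_partial_gT c q i.
have dN : is_derive q (delta_mx 0 i) (gN c)
    (2 * grho c q * partial i (grho c) q + 2 * gT c q * partial i (gT c) q).
  have := is_derive_add (is_derive_mul dr dr) (is_derive_mul dT dT).
  by congr is_derive; ring.
have sN0 : 0 < Num.sqrt (gN c q) by rewrite sqrtr_gt0.
have := is_derive_sqrt sN0 (is_derive_sqrt N0 dN).
rewrite -/(gr c) -/(gr c q) -gr2; congr is_derive.
by field; rewrite gt_eqF.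
Qed.

Lemma HX_gr c j q : 0 < gN c q -> HX j (gr c) q = gE c j q / gr c q ^+ 3.
Proof.
move=> N0; rewrite (@HX_chain c q _ _ _ j (fun i => is_derive_gr i N0)).
by rewrite /gE; field; rewrite gt_eqF// gr_gt0.
Qed.

Lemma HY_gr c j q : 0 < gN c q -> HY j (gr c) q = gF c j q / gr c q ^+ 3.
Proof.
move=> N0; rewrite (@HY_chain c q _ _ _ j (fun i => is_derive_gr i N0)).
by rewrite /gF; field; rewrite gt_eqF// gr_gt0.
Qed.

Lemma HX_gE c j q : HX j (gE c j) q =
  2 * ga c j q ^+ 2 + 2 * gb c j q ^+ 2 + grho c q.
Proof.
have Ca := C1at_ga c j q; have Cb := C1at_gb c j q.
have Cr := C1at_grho c q; have CT := C1at_gT c q.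
have -> : HX j (gE c j) q = HX j (fun q => grho c q * ga c j q) q +
    HX j (fun q => gT c q * gb c j q) q.
  rewrite /HX /partial /gE !deriveD; try by apply: C1at_derivable; exact: C1at_mul.
  by ring.
rewrite !HX_mul// HX_ga HX_gb HX_grho HX_gT eqxx mulr1; ring.
Qed.

Lemma HY_gF c j q : HY j (gF c j) q =
  2 * ga c j q ^+ 2 + 2 * gb c j q ^+ 2 + grho c q.
Proof.
have Ca := C1at_ga c j q; have Cb := C1at_gb c j q.
have Cr := C1at_grho c q; have CT := C1at_gT c q.
rewrite HY_sub; try exact: C1at_mul.
rewrite !HY_mul// HY_ga HY_gb HY_grho HY_gT eqxx mulr1; ring.
Qed.

Section radial_field.
Variables (phi : R -> R) (delta : R).
Hypothesis delta_gt0 : 0 < delta.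
Hypothesis phi_derivable : forall t : R, 0 < t -> derivable phi t 1.
Hypothesis dphi_cont : forall t : R, 0 < t -> {for t, continuous (derive1 phi)}.

(* [radial_coef c * (gE c, gF c)] is |X|^-1 phi(|X|) X for X the horizontal
   gradient of [delta * gr c]. *)
Definition radial_coef c q : R :=
  phi (delta * (gsigma c q / gr c q)) / (gr c q ^+ 2 * gsigma c q).

Lemma C1at_ratio c q : 0 < grho c q ->
  C1at q (fun q => delta * (gsigma c q / gr c q)).
Proof.
move=> r0; have N0 := gN_gt0 r0.
apply: C1at_mul; first exact: C1at_cst.
apply: C1at_mul; first exact: C1at_gsigma.
by apply: C1at_inv; [exact: C1at_gr|rewrite gt_eqF// gr_gt0].
Qed.

Lemma ratio_gt0 c q : 0 < grho c q -> 0 < delta * (gsigma c q / gr c q).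
Proof.
move=> r0; have N0 := gN_gt0 r0.
by rewrite mulr_gt0// divr_gt0 ?gr_gt0// sqrtr_gt0.
Qed.

Lemma C1at_radial_coef c q : 0 < grho c q -> C1at q (radial_coef c).
Proof.
move=> r0; have N0 := gN_gt0 r0.
apply: C1at_mul.
  apply: C1at_comp; first exact: C1at_ratio.
    near=> x; apply: phi_derivable; near: x; apply: lt_nbhsr; exact: ratio_gt0.
  exact/dphi_cont/ratio_gt0.
apply: C1at_inv.
  apply: C1at_mul; last exact: C1at_gsigma.
  by apply: C1at_mul; exact: C1at_gr.
by rewrite mulf_neq0// ?expf_neq0// gt_eqF// ?gr_gt0// sqrtr_gt0.
Unshelve. all: by end_near. Qed.

(* Along the field (gE, gF), (rho, T) is scaled at rate [2 rho], so the argument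
   of [phi], homogeneous of degree 0, is constant and phi' does not appear. *)
Lemma radial_divergence c q : 0 < grho c q ->
  \sum_j (HX j (fun q => radial_coef c q * gE c j q) q +
          HY j (fun q => radial_coef c q * gF c j q) q) =
  (2 * m%:R + 1) * (grho c q * radial_coef c q).
Proof.
move=> rho0; have N0 := gN_gt0 rho0; have r0 := gr_gt0 N0.
have s0 : 0 < gsigma c q by rewrite sqrtr_gt0.
set G := radial_coef c.
pose x := delta * (gsigma c q / gr c q).
pose s := gsigma c q; pose r := gr c q; pose dp := derive1 phi x.
(* partial derivatives of sigma / r and of r^2 sigma in (rho, T) *)
pose k1 := (2 * s)^-1 / r - s * (grho c q / (2 * r ^+ 3)) / r ^+ 2.
pose k2 := - (s * (gT c q / (2 * r ^+ 3)) / r ^+ 2).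
pose h1 := 2 * r * (grho c q / (2 * r ^+ 3)) * s + r ^+ 2 * (2 * s)^-1.
pose h2 := 2 * r * (gT c q / (2 * r ^+ 3)) * s.
pose al := dp * delta * k1 / (r ^+ 2 * s) - phi x * h1 / (r ^+ 2 * s) ^+ 2.
pose be := dp * delta * k2 / (r ^+ 2 * s) - phi x * h2 / (r ^+ 2 * s) ^+ 2.
have dG i : is_derive q (delta_mx 0 i) G
    (al * partial i (grho c) q + be * partial i (gT c) q).
  have ds := is_derive_gsigma i rho0; have dr := is_derive_gr i N0.
  have dri := is_derive_inv (lt0r_neq0 r0) dr.
  have dx := is_derive_scale delta (is_derive_mul ds dri).
  have dphi : is_derive x 1 phi dp.
    by split; [exact/phi_derivable/ratio_gt0|rewrite /dp derive1E].
  have dpx := @is_derive_compR R _ phi (fun q => delta * (gsigma c q / gr c q)) q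
    _ _ _ dphi dx.
  have w0 : gr c q ^+ 2 * gsigma c q != 0.
    by rewrite mulf_neq0// ?expf_neq0// gt_eqF.
  have dw := is_derive_inv w0 (is_derive_mul (is_derive_mul dr dr) ds).
  have := is_derive_mul dpx dw; congr is_derive.
  rewrite /al /be /k1 /k2 /h1 /h2 -/s -/r -/x.
  by field; rewrite !gt_eqF.
(* Euler's identity in (rho, T): r and sigma have degree 1/2, so sigma / r has degree 0 ([kk]), r^2
   sigma has degree 3/2 ([hh]), and [G] has degree -3/2. *)
have euler : grho c q * al + gT c q * be = - (3 / 2) * G q.
  have T2 : gT c q ^+ 2 = r ^+ 4 - s ^+ 4.
    by rewrite gr4 (exprM s 2 2) gsigma2 /gN; ring.
  have kk : grho c q * k1 + gT c q * k2 = 0.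
    rewrite /k1 /k2 -gsigma2 -/s.
    transitivity (s / (2 * r) - s * (s ^+ 4 + gT c q ^+ 2) / (2 * r ^+ 5)).
      by field; rewrite !gt_eqF.
    by rewrite T2; field; rewrite gt_eqF.
  have hh : grho c q * h1 + gT c q * h2 = 3 / 2 * (r ^+ 2 * s).
    rewrite /h1 /h2 -gsigma2 -/s.
    transitivity (s * (s ^+ 4 + gT c q ^+ 2) / r ^+ 2 + r ^+ 2 * s / 2).
      by field; rewrite !gt_eqF.
    by rewrite T2; field; rewrite gt_eqF.
  transitivity (dp * delta / (r ^+ 2 * s) * (grho c q * k1 + gT c q * k2) -
      phi x / (r ^+ 2 * s) ^+ 2 * (grho c q * h1 + gT c q * h2)).
    by rewrite /al /be; ring.
  by rewrite kk hh /G /radial_coef -/r -/s -/x; field; rewrite !gt_eqF.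
(* Summed over j this gives (4 - 3) rho G + 2m rho G, whence the factor 2m + 1. *)
have term j : HX j (fun q => G q * gE c j q) q + HY j (fun q => G q * gF c j q) q =
    (4 * G q + 2 * (grho c q * al + gT c q * be)) * (ga c j q ^+ 2 + gb c j q ^+ 2) +
    2 * (G q * grho c q).
  have CG := C1at_radial_coef rho0.
  rewrite HX_mul//; last exact: C1at_gE.
  rewrite HY_mul//; last exact: C1at_gF.
  rewrite HX_gE HY_gF (HX_chain j dG) (HY_chain j dG) /gE /gF; ring.
under eq_bigr => j _ do rewrite term.
rewrite big_split/= -mulr_sumr -/(grho c q) euler sumr_const card_ord -mulr_natr.
by field.
Qed.

Lemma hgrad_norm_gr c q : 0 < gN c q ->
  hgrad_norm (fun q => delta * gr c q) q = delta * (gsigma c q / gr c q).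
Proof.
move=> N0; have r0 := gr_gt0 N0.
have CK := C1at_cst q delta; have Cr := C1at_gr N0.
rewrite /hgrad_norm /hgrad_dot.
have -> : \sum_j (HX j (fun q => delta * gr c q) q * HX j (fun q => delta * gr c q) q +
    HY j (fun q => delta * gr c q) q * HY j (fun q => delta * gr c q) q) =
    (delta * (gsigma c q / gr c q)) ^+ 2.
  rewrite (eq_bigr (fun j => delta ^+ 2 / gr c q ^+ 6 * (gE c j q ^+ 2 + gF c j q ^+ 2))).
    rewrite -mulr_sumr gEF_sqr -gr4 -gsigma2; field.
    by rewrite gt_eqF.
  move=> j _; rewrite HX_mul// HY_mul// HX_gr// HY_gr//.
  have -> : HX j (fun=> delta) q = 0.
    by rewrite (@HX_derive _ _ _ _ _ (fun=> 0)) ?mulr0 ?addr0// => v; exact: is_derive_cst.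
  have -> : HY j (fun=> delta) q = 0.
    by rewrite (@HY_derive _ _ _ _ _ (fun=> 0)) ?mulr0 ?subr0// => v; exact: is_derive_cst.
  by field; rewrite gt_eqF.
rewrite sqrtr_sqr ger0_norm// mulr_ge0//; first exact: ltW.
by rewrite divr_ge0 ?sqrtr_ge0.
Qed.

End radial_field.

End gauge.

(** * The weak inequality with C^1 test functions *)

Section C1_test_functions.
Context {R : realType} {m : nat}.
Implicit Types (u v zeta : Hpoint R m -> R) (q : Hpoint R m) (j : 'I_m).

Lemma continuous_cube_bounded (F : Hpoint R m -> R) L : continuous F ->
  exists2 M : R, 0 <= M & forall q, (forall i, `|q 0 i| <= L) -> `|F q| <= M.
Proof.
move=> cF; pose K := [set q : Hpoint R m | forall i, `|q 0 i| <= L].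
have /compact_bounded[M [_ Mb]] : compact (F @` K).
  by apply: continuous_compact; [exact: continuous_subspaceT|exact: compact_cube].
exists (`|M| + 1) => [|q qK]; first by rewrite addr_ge0.
by apply: Mb; [rewrite ltr_pwDr// ler_norm|exists q].
Qed.

(** The two sides of the weak inequality merged into one expression, linear in [zeta] and its first
    derivatives with continuous coefficients; density needs nothing more. *)
Definition test_integrand (b : Hpoint R m -> R) (p r : 'I_m -> Hpoint R m -> R) zeta q :=
  b q * zeta q + \sum_j (p j q * HX j zeta q + r j q * HY j zeta q).

Variables (b : Hpoint R m -> R) (p r : 'I_m -> Hpoint R m -> R).
Hypothesis cb : continuous b.
Hypothesis cp : forall j, continuous (p j).
Hypothesis cr : forall j, continuous (r j).

Lemma continuous_test_integrand zeta : Ck 1 zeta -> continuous (test_integrand b p r zeta).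
Proof.
move=> Cz q; have Cq := (Ck1_C1at _).2 Cz q.
apply: (@contD R _ (fun q => b q * zeta q)).
  by apply: contM; [exact: cb|exact: Cz.1].
apply: cont_sum => j _; apply: contD; apply: contM.
- exact: cp.
- exact: continuous_HX.
- exact: cr.
- exact: continuous_HY.
Qed.

Lemma vanish_out_test_integrand L zeta : vanish_out L zeta ->
  vanish_out L (test_integrand b p r zeta).
Proof.
move=> vz; apply: vanish_outD; first exact: vanish_outMr.
apply: vanish_out_sum => j; apply: vanish_outD; apply: vanish_outMr.
  exact: vanish_out_HX.
exact: vanish_out_HY.
Qed.

(** All approximants live in one fixed cube, where the coefficients are bounded, so uniform C^1
    closeness passes to the integrals. *)
Lemma C1_test_integral_le0 :
  (forall zeta, test_function zeta -> (forall q, 0 <= zeta q) ->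
     lebesgue_int (test_integrand b p r zeta) <= 0) ->
  forall zeta L, 0 <= L -> Ck 1 zeta -> (forall q, 0 <= zeta q) -> vanish_out L zeta ->
    lebesgue_int (test_integrand b p r zeta) <= 0.
Proof.
move=> H zeta L L0 Cz z0 vz.
pose M q := `|b q| + \sum_j (`|p j q| + `|r j q|).
have cM : continuous M.
  have cn (F : Hpoint R m -> R) : continuous F -> continuous (fun q => `|F q|).
    by move=> cF q; apply: (@cont_comp _ _ (fun x : R => `|x|) F); [exact: cF|exact: norm_continuous].
  move=> q; apply: (@contD R _ (fun q => `|b q|)); first exact: cn.
  by apply: cont_sum => j _; apply: contD; exact: cn.
have [K K0 MK] := continuous_cube_bounded (L + 1) cM.
pose V : R := (L + 1 + (L + 1)) ^+ (m + m + 1).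
(* On the cube of half-side L + 1 the horizontal derivatives of the error are at most d (1 + 2 (L +
   1)), [K] bounds the coefficients and [V] is the volume: the integrals differ by at most d S. *)
pose S := (2 * L + 3) * K * V.
have L23 : 0 <= 2 * L + 3 by lra.
have LK0 : 0 <= (2 * L + 3) * K := mulr_ge0 L23 K0.
have L10 : 0 <= L + 1 by lra.
have L1 : 1 <= 2 * L + 3 by lra.
have S0 : 0 <= S by apply: mulr_ge0 LK0 _; apply: exprn_ge0; exact: addr_ge0.
apply/ler_addgt0Pr => e e0; rewrite add0r.
pose d := e / (S + 1).
have d0 : 0 < d by rewrite divr_gt0// ltr_wpDl.
have [zh [tzh zh0 vzh zhd dzhd]] := test_approx L0 Cz z0 vz d0.
have Czh := tzh.1 1%N.
have vz1 : vanish_out (L + 1) zeta by apply: vanish_outW vz; rewrite lerDl.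
have cI := continuous_test_integrand Cz; have cIh := continuous_test_integrand Czh.
have vI := vanish_out_test_integrand vz1; have vIh := vanish_out_test_integrand vzh.
pose D q := test_integrand b p r zeta q + (-1) * test_integrand b p r zh q.
have cNIh : continuous (fun q => (-1) * test_integrand b p r zh q).
  by move=> q; exact: (@contM R _ (fun=> -1) _ q (@contC _ _ _ _) (cIh q)).
have vNIh : vanish_out (L + 1) (fun q => (-1) * test_integrand b p r zh q).
  exact: vanish_outMr.
have DE : lebesgue_int D = lebesgue_int (test_integrand b p r zeta) -
    lebesgue_int (test_integrand b p r zh).
  by rewrite (@lebesgue_intD _ _ (L + 1))// (@lebesgue_intZ _ _ (L + 1))// mulN1r.
have Dsmall q : `|D q| <= d * ((2 * L + 3) * K).
  have [qL|/existsNP[i /negP]] := pselect (forall i, `|q 0 i| <= L + 1); last first.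
    rewrite -ltNge => Lq; rewrite /D (vI q i Lq) (vIh q i Lq) mulr0 addr0 normr0.
    exact: mulr_ge0 (ltW d0) LK0.
  have dX j : `|HX j zeta q - HX j zh q| <= d * (2 * L + 3).
    have -> : HX j zeta q - HX j zh q =
        - ((partial (idx_x j) zh q - partial (idx_x j) zeta q) +
           2 * q 0 (idx_y j) * (partial idx_t zh q - partial idx_t zeta q)).
      rewrite /HX; move: (partial _ zeta q) (partial _ zh q) (partial _ zeta q)
        (partial _ zh q) (2 * q 0 _) => *; ring.
    rewrite normrN; apply: le_trans (ler_normD _ _) _.
    have -> : d * (2 * L + 3) = d + 2 * (L + 1) * d by ring.
    rewrite lerD ?dzhd// !normrM (ger0_norm (ler0n _ _)).
    by apply: ler_pM; rewrite ?mulr_ge0 ?dzhd// ler_wpM2l.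
  have dY j : `|HY j zeta q - HY j zh q| <= d * (2 * L + 3).
    have -> : HY j zeta q - HY j zh q =
        - ((partial (idx_y j) zh q - partial (idx_y j) zeta q) +
           - (2 * q 0 (idx_x j)) * (partial idx_t zh q - partial idx_t zeta q)).
      rewrite /HY; move: (partial _ zeta q) (partial _ zh q) (partial _ zeta q)
        (partial _ zh q) (2 * q 0 _) => *; ring.
    rewrite normrN; apply: le_trans (ler_normD _ _) _.
    have -> : d * (2 * L + 3) = d + 2 * (L + 1) * d by ring.
    rewrite lerD ?dzhd// normrM normrN normrM (ger0_norm (ler0n _ _)).
    by apply: ler_pM; rewrite ?mulr_ge0 ?dzhd// ler_wpM2l.
  have d1 : d <= d * (2 * L + 3) by rewrite -[leLHS]mulr1 (ler_wpM2l (ltW d0) L1).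
  apply: (@le_trans _ _ (d * (2 * L + 3) * M q)); last first.
    rewrite mulrA ler_wpM2l//; first exact: mulr_ge0 (ltW d0) L23.
    by apply: le_trans (ler_norm _) _; exact: MK.
  have -> : D q = b q * (zeta q - zh q) +
      \sum_j (p j q * (HX j zeta q - HX j zh q) + r j q * (HY j zeta q - HY j zh q)).
    rewrite /D /test_integrand mulN1r.
    rewrite [X in _ = _ + X](_ : _ =
      \sum_j (p j q * HX j zeta q + r j q * HY j zeta q) -
      \sum_j (p j q * HX j zh q + r j q * HY j zh q)); first by ring.
    by rewrite -sumrB; apply: eq_bigr => j _; ring.
  apply: le_trans (ler_normD _ _) _.
  rewrite /M [leRHS]mulrDr; apply: lerD.
    rewrite normrM mulrC ler_wpM2r// distrC; exact: le_trans (zhd q) d1.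
  rewrite mulr_sumr; apply: le_trans (ler_norm_sum _ _ _) _.
  apply: ler_sum => j _; apply: le_trans (ler_normD _ _) _.
  rewrite [leRHS]mulrDr !normrM; apply: lerD; rewrite mulrC ler_wpM2r//.
have cD : continuous D.
  by move=> q; apply: (@contD R _ (test_integrand b p r zeta)); [exact: cI|exact: cNIh].
have vD : vanish_out (L + 1) D by exact: vanish_outD.
have := lebesgue_int_small L10 cD vD Dsmall.
rewrite DE => /(le_trans (ler_norm _)).
have := H zh tzh zh0 => Hh Hd.
have dV : d * ((2 * L + 3) * K) * V <= e.
  rewrite -mulrA -/S /d mulrAC ler_pdivrMr; last by rewrite ltr_wpDl.
  by rewrite ler_pM2l// lerDl.
move: Hd; rewrite lerBlDr => /le_trans; apply.
by rewrite -[leRHS]addr0; exact: lerD dV Hh.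
Qed.

End C1_test_functions.

Lemma coord_le_norm {R : realType} n (q : 'rV[R]_n) i : `|q 0 i| <= `|q|.
Proof.
by rewrite [leRHS]/Num.Def.normr /= mx_normrE; apply/bigmax_geP; right; exists (0, i).
Qed.

Section weak_inequality.
Context {R : realType} {m : nat}.
Implicit Types (u v zeta : Hpoint R m -> R) (q : Hpoint R m) (j : 'I_m).

(** The data are controlled on [0, +oo[ only; composed with a non-negative function they become
    continuous in the ordinary sense. *)
Lemma continuous_nonneg_comp (T : topologicalType) (h : R -> R) (g : T -> R) :
  {within `[0, +oo[, continuous h} -> (forall x, 0 <= g x) ->
  forall x, {for x, continuous g} -> {for x, continuous (fun x => h (g x))}.
Proof.
move=> ch g0 x cg U hU.
have gx : `[0, +oo[%classic (g x) by rewrite /= in_itv/= g0.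
have /subspace_continuousP/(_ _ gx) := ch.
move=> /(_ U hU) hU'.
have hV : nbhs (g x) (fun y => `[0, +oo[%classic y -> U (h y)) := hU'.
have hg : nbhs x (fun y => `[0, +oo[%classic (g y) -> U (h (g y))) := cg _ hV.
suff : nbhs x (fun y => U (h (g y))) by [].
by apply: filterS hg => y; apply; rewrite /= in_itv/= g0.
Qed.

Lemma HX_le_hgrad_norm u q j : `|HX j u q| <= hgrad_norm u q.
Proof.
rewrite -sqrtr_sqr ler_wsqrtr// /hgrad_dot (bigD1 j)//= -!expr2 -addrA lerDl.
by rewrite addr_ge0 ?sqr_ge0// sumr_ge0// => k _; rewrite addr_ge0// -expr2 sqr_ge0.
Qed.

Lemma HY_le_hgrad_norm u q j : `|HY j u q| <= hgrad_norm u q.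
Proof.
rewrite -sqrtr_sqr ler_wsqrtr// /hgrad_dot (bigD1 j)//= -!expr2 addrAC lerDr.
by rewrite addr_ge0 ?sqr_ge0// sumr_ge0// => k _; rewrite addr_ge0// -expr2 sqr_ge0.
Qed.

Lemma hgrad_norm_ge0 u q : 0 <= hgrad_norm u q.
Proof. exact: sqrtr_ge0. Qed.

Variables (phi f l : R -> R) (u : Hpoint R m -> R).
Hypothesis phi_cont : {within `[0, +oo[, continuous phi}.
Hypothesis phi0 : phi 0 = 0.
Hypothesis f_cont : {within `[0, +oo[, continuous f}.
Hypothesis l_cont : {within `[0, +oo[, continuous l}.
Hypothesis u_sol : weak_subsolution phi f l u.
Hypothesis u_ge0 : forall q, 0 <= u q.

Let Cu := u_sol.1.
Let Cat q : C1at q u := (Ck1_C1at _).2 Cu q.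

Definition flux w q : R := (hgrad_norm u q)^-1 * phi (hgrad_norm u q) * w q.

(** Where the gradient vanishes, phi(|X|)/|X| may be unbounded nearby, but |w| <= |X| bounds the
    product by phi(|X|), which tends to phi(0) = 0. *)
Lemma continuous_flux w : continuous w ->
  (forall q, `|w q| <= hgrad_norm u q) -> continuous (flux w).
Proof.
move=> cw wu q.
have cn := continuous_hgrad_norm (Cat q).
have cphi := continuous_nonneg_comp phi_cont (hgrad_norm_ge0 u) cn.
have [n0|n0] := eqVneq (hgrad_norm u q) 0; last first.
  apply: (@contM R _ (fun q => (hgrad_norm u q)^-1 * phi (hgrad_norm u q))); last exact: cw.
  by apply: contM => //; exact: continuousV.
have fl q' : `|flux w q'| <= `|phi (hgrad_norm u q')|.
  rewrite /flux; have [->|nq] := eqVneq (hgrad_norm u q') 0.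
    by rewrite invr0 !mul0r normr0.
  rewrite mulrAC normrM ler_piMl// normrM normfV.
  by rewrite (ger0_norm (hgrad_norm_ge0 _ _)) mulrC ler_pdivrMr ?mul1r// lt_def nq hgrad_norm_ge0.
have fq : flux w q = 0 by rewrite /flux n0 invr0 !mul0r.
rewrite /continuous_at fq.
apply/(@cvgr0Pnorm_lt R R _ (nbhs q) (nbhs_filter q)) => e e0.
move: cphi; rewrite /prop_for /continuous_at n0 phi0.
move=> /(@cvgr0Pnorm_lt R R _ (nbhs q) (nbhs_filter q)) /(_ _ e0).
by apply: filterS => q'; apply: le_lt_trans; exact: fl.
Qed.

Lemma weak_inequality_C1 zeta L : 0 <= L -> Ck 1 zeta -> (forall q, 0 <= zeta q) ->
  vanish_out L zeta ->
  lebesgue_int (test_integrand (fun q => f (u q) * l (hgrad_norm u q))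
    (fun j => flux (HX j u)) (fun j => flux (HY j u)) zeta) <= 0.
Proof.
pose b q := f (u q) * l (hgrad_norm u q).
have cb : continuous b.
  move=> q; apply: contM.
    by apply: continuous_nonneg_comp => //; exact: Cu.1.
  apply: continuous_nonneg_comp => //; first exact: hgrad_norm_ge0.
  exact: continuous_hgrad_norm.
have cX j : continuous (flux (HX j u)).
  apply: continuous_flux; last by move=> q; exact: HX_le_hgrad_norm.
  by move=> q; exact: continuous_HX.
have cY j : continuous (flux (HY j u)).
  apply: continuous_flux; last by move=> q; exact: HY_le_hgrad_norm.
  by move=> q; exact: continuous_HY.
apply: C1_test_integral_le0 => // z tz z0.
have := u_sol.2 z tz z0.
have Cz := tz.1 1%N.
have [L0 vz] : exists L0 : R, vanish_out L0 z.
  have /compact_bounded[M [_ Mb]] := tz.2.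
  exists (M + 1) => q i Lq; apply/eqP/negP => /negP zq.
  have : `|q| <= M + 1 by apply: Mb; [rewrite ltrDl|exact: subset_closure].
  by rewrite leNgt (lt_le_trans Lq (coord_le_norm q i)).
have eA : (fun q => (hgrad_norm u q)^-1 * phi (hgrad_norm u q) * hgrad_dot u z q) =
    (fun q => \sum_j (flux (HX j u) q * HX j z q + flux (HY j u) q * HY j z q)).
  apply/funext => q; rewrite /hgrad_dot mulr_sumr; apply: eq_bigr => j _.
  by rewrite /flux; ring.
rewrite eA.
pose Aint q := \sum_j (flux (HX j u) q * HX j z q + flux (HY j u) q * HY j z q).
have cz q : C1at q z := (Ck1_C1at _).2 Cz q.
have cA : continuous Aint.
  move=> q; apply: cont_sum => j _; apply: contD; apply: contM.
  - exact: cX.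
  - exact: continuous_HX.
  - exact: cY.
  - exact: continuous_HY.
have vA : vanish_out L0 Aint.
  apply: vanish_out_sum => j; apply: vanish_outD; apply: vanish_outMr.
    exact: vanish_out_HX.
  exact: vanish_out_HY.
have cB : continuous (fun q => b q * z q).
  by move=> q; apply: contM; [exact: cb|exact: Cz.1].
have vB : vanish_out L0 (fun q => b q * z q) by exact: vanish_outMr.
rewrite -/Aint -/b /test_integrand => h.
rewrite (@lebesgue_intD _ _ L0 _ Aint)//.
by rewrite -lerBrDr sub0r.
Qed.

End weak_inequality.

(** * Profile of the test function and monotonicity of the flux *)

Section positive_part.
Context {R : realType}.

Definition pos_part (x : R) : R := (x + `|x|) / 2.

Lemma pos_part_ge0 x : 0 <= pos_part x.
Proof. by rewrite /pos_part; have := ler_norm (- x); rewrite normrN => ?; lra. Qed.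

Lemma pos_part_le0 x : x <= 0 -> pos_part x = 0.
Proof. by move=> x0; rewrite /pos_part ler0_norm// subrr mul0r. Qed.

Lemma pos_part_gt0 x : 0 < x -> pos_part x = x.
Proof. by move=> x0; rewrite /pos_part gtr0_norm//; field. Qed.

Lemma continuous_pos_part : continuous pos_part.
Proof.
move=> x; have h : {for x, continuous (fun x : R => x + `|x|)}.
  by apply: contD; [exact: cvg_id|exact: norm_continuous].
have := @contM R R (fun x => x + `|x|) (fun=> 2^-1) x h (@contC R R _ _).
exact.
Qed.

(** At 0 the difference quotient of the square is [pos_part] itself, which is continuous. *)
Lemma is_derive_pos_part_sqr (x : R) :
  is_derive x 1 (fun x : R => pos_part x ^+ 2) (2 * pos_part x).
Proof.
have [x0|x0|->] := ltgtP x 0.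
- rewrite pos_part_le0 ?mulr0; last exact: ltW.
  apply: (near_eq_is_derive (f := cst 0)).
  by near=> z; rewrite pos_part_le0 ?expr0n//; apply/ltW; near: z; exact: lt_nbhsl.
- rewrite pos_part_gt0//; apply: (near_eq_is_derive (f := fun z : R => z * z)).
    by near=> z; rewrite pos_part_gt0 ?expr2//; near: z; exact: lt_nbhsr.
  have := is_derive_mul (is_derive_id x 1) (is_derive_id x (1 : R)).
  by congr is_derive; ring.
- rewrite pos_part_le0// mulr0; apply/is_derive1_caratheodory; exists pos_part; split.
  + move=> z; rewrite [pos_part 0]pos_part_le0// expr0n !subr0.
    have [z0|z0] := leP z 0; first by rewrite pos_part_le0// expr0n mul0r.
    by rewrite pos_part_gt0// expr2.
  + exact: continuous_pos_part.
  + exact: pos_part_le0.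
Unshelve. all: by end_near. Qed.

End positive_part.

Section monotonicity.
Context {R : realType} {m : nat}.
Implicit Types (u v : Hpoint R m -> R) (q : Hpoint R m).

Lemma hgrad_dot_ge0 u q : 0 <= hgrad_dot u u q.
Proof. by apply: sumr_ge0 => j _; rewrite -!expr2 addr_ge0 ?sqr_ge0. Qed.

Lemma hgrad_norm2 u q : hgrad_norm u q ^+ 2 = hgrad_dot u u q.
Proof. by rewrite sqr_sqrtr// hgrad_dot_ge0. Qed.

Let bilinear_expand (x x' y y' : 'I_m -> R) (k k' h h' : R) :
  \sum_j ((k * x j - k' * y j) * (h * x j - h' * y j) +
          (k * x' j - k' * y' j) * (h * x' j - h' * y' j)) =
  k * h * (\sum_j (x j * x j + x' j * x' j)) -
  (k * h' + k' * h) * (\sum_j (x j * y j + x' j * y' j)) +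
  k' * h' * (\sum_j (y j * y j + y' j * y' j)).
Proof.
rewrite !mulr_sumr -sumrB -big_split/=.
by apply: eq_bigr => j _; ring.
Qed.

Lemma hgrad_dot_expand u v q (k k' h h' : R) :
  \sum_j ((k * HX j u q - k' * HX j v q) * (h * HX j u q - h' * HX j v q) +
          (k * HY j u q - k' * HY j v q) * (h * HY j u q - h' * HY j v q)) =
  k * h * hgrad_dot u u q - (k * h' + k' * h) * hgrad_dot u v q +
  k' * h' * hgrad_dot v v q.
Proof.
exact: (bilinear_expand (fun j => HX j u q) (fun j => HY j u q)
  (fun j => HX j v q) (fun j => HY j v q)).
Qed.

(** For non-zero norms a, b expand |b X - a Y|^2 = 2ab (ab - X.Y), with X and Y the two gradients;
    if a norm is 0, all components of that gradient vanish. *)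
Lemma hgrad_cauchy_schwarz u v q :
  hgrad_dot u v q <= hgrad_norm u q * hgrad_norm v q.
Proof.
set a := hgrad_norm u q; set b := hgrad_norm v q.
have a0 : 0 <= a := hgrad_norm_ge0 u q.
have b0 : 0 <= b := hgrad_norm_ge0 v q.
have zero (w w' : Hpoint R m -> R) : hgrad_norm w q = 0 -> hgrad_dot w w' q = 0 /\ hgrad_dot w' w q = 0.
  move=> w0; have X0 j : HX j w q = 0.
    by apply/normr0_eq0/eqP; rewrite eq_le normr_ge0 -w0 HX_le_hgrad_norm.
  have Y0 j : HY j w q = 0.
    by apply/normr0_eq0/eqP; rewrite eq_le normr_ge0 -w0 HY_le_hgrad_norm.
  by split; apply: big1 => j _; rewrite X0 Y0 ?mul0r ?mulr0 addr0.
have [aE|a1] := eqVneq a 0; first by rewrite (zero u v aE).1 aE mul0r.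
have [bE|b1] := eqVneq b 0; first by rewrite (zero v u bE).2 bE mulr0.
have ap : 0 < a by rewrite lt0r a1 a0.
have bp : 0 < b by rewrite lt0r b1 b0.
have a2 : hgrad_dot u u q = a ^+ 2 := esym (hgrad_norm2 u q).
have b2 : hgrad_dot v v q = b ^+ 2 := esym (hgrad_norm2 v q).
have h : 0 <= b * b * a ^+ 2 - (b * a + a * b) * hgrad_dot u v q + a * a * b ^+ 2.
  rewrite -a2 -b2 -hgrad_dot_expand; apply: sumr_ge0 => j _.
  by rewrite -!expr2 addr_ge0 ?sqr_ge0.
clearbody a b; set X := hgrad_dot u v q in h *.
have : 0 <= 2 * (a * b) * (a * b - X).
  by apply: le_trans h _; rewrite le_eqVlt; apply/orP; left; apply/eqP; ring.
by rewrite pmulr_rge0 ?subr_ge0// !mulr_gt0.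
Qed.

(** With k(x) = phi(x)/x the sum is k(a) a^2 - (k(a) + k(b)) X.Y + k(b) b^2. Replacing X.Y by its
    upper bound ab leaves (phi(a) - phi(b))(a - b). *)
Lemma flux_monotone (phi : R -> R) u v q : phi 0 = 0 ->
  (forall x y, 0 <= x -> x <= y -> phi x <= phi y) ->
  0 <= \sum_j ((flux phi u (HX j u) q - flux phi v (HX j v) q) * (HX j u q - HX j v q) +
               (flux phi u (HY j u) q - flux phi v (HY j v) q) * (HY j u q - HY j v q)).
Proof.
move=> phi0 phi_mono.
set a := hgrad_norm u q; set b := hgrad_norm v q.
have a0 : 0 <= a := hgrad_norm_ge0 u q.
have b0 : 0 <= b := hgrad_norm_ge0 v q.
pose k (x : R) := x^-1 * phi x.
have phi_ge0 x : 0 <= x -> 0 <= phi x by move=> x0; rewrite -phi0 phi_mono.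
have k_ge0 x : 0 <= x -> 0 <= k x.
  by move=> x0; apply: mulr_ge0; [rewrite invr_ge0|exact: phi_ge0].
have kE x : k x * x = phi x.
  have [->|x0] := eqVneq x 0; first by rewrite mulr0 phi0.
  by rewrite /k mulrAC mulVf// mul1r.
have a2 : hgrad_dot u u q = a ^+ 2 := esym (hgrad_norm2 u q).
have b2 : hgrad_dot v v q = b ^+ 2 := esym (hgrad_norm2 v q).
have cs : hgrad_dot u v q <= a * b := hgrad_cauchy_schwarz u v q.
have E := hgrad_dot_expand u v q (k a) (k b) 1 1.
have -> : \sum_j ((flux phi u (HX j u) q - flux phi v (HX j v) q) * (HX j u q - HX j v q) +
     (flux phi u (HY j u) q - flux phi v (HY j v) q) * (HY j u q - HY j v q)) =
   k a * a ^+ 2 - (k a + k b) * hgrad_dot u v q + k b * b ^+ 2.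
  rewrite !mulr1 in E; rewrite -a2 -b2; apply: etrans E.
  by apply: eq_bigr => j _; rewrite !mul1r.
clear E a2 b2; set X := hgrad_dot u v q in cs *; clearbody a b X.
apply: (@le_trans _ _ ((phi a - phi b) * (a - b))).
  have [ab|/ltW ab] := leP a b.
    by rewrite mulr_le0// subr_le0// phi_mono.
  by rewrite mulr_ge0// subr_ge0// phi_mono.
have -> : (phi a - phi b) * (a - b) =
    k a * a ^+ 2 - (k a + k b) * (a * b) + k b * b ^+ 2.
  by rewrite -!kE; ring.
by rewrite lerD2r lerD2l lerN2 ler_wpM2l// addr_ge0// k_ge0.
Qed.

End monotonicity.

(** * Comparison at a maximum *)

Section comparison.
Context {R : realType} {m : nat}.
Implicit Types (q : Hpoint R m) (j : 'I_m).

(** The part of the superlevel set {w >= M - 1} outside [O] is compact and misses the level M, so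
    [w] stays below some smaller level there. *)
Lemma superlevel_in_open (w : Hpoint R m -> R) (M L : R) (O : set (Hpoint R m)) :
  continuous w -> (forall q, w q <= M) ->
  (forall q, O q -> nbhs q O) -> (forall q, w q = M -> O q) ->
  (forall q, M - 1 <= w q -> forall i, `|q 0 i| <= L) ->
  exists2 eta : R, 0 < eta <= 1 & forall q, M - eta <= w q -> O q.
Proof.
move=> cw wM oO MO wL.
pose B := [set q | M - 1 <= w q /\ ~ O q].
have cB : compact B.
  apply: (subclosed_compact _ (@compact_cube R (m + m + 1) L)).
    apply: closedI.
      by apply: (@closed_comp _ _ w [set x | M - 1 <= x]) => [q _|]; [exact: cw|exact: closed_ge].
    by apply: open_closedC; rewrite openE => q /oO.
  by move=> q [/wL].
have [B0|/set0P/negP/negPn/eqP B0] := pselect (B !=set0); last first.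
  exists 1; first by rewrite ltr01 lexx.
  move=> q qM; apply: contrapT => nO.
  by have : B q by []; rewrite B0.
have [q1 q1B q1max] : exists2 q1, q1 \in B & forall q, q \in B -> w q <= w q1.
  by apply: EVT_max_rV => //; exact: continuous_subspaceT.
move: q1B; rewrite inE => -[q1M nO1].
have w1 : w q1 < M.
  by rewrite lt_neqAle wM andbT; apply/eqP => /MO.
exists (Num.min ((M - w q1) / 2) 1).
  by rewrite lt_min ge_min lexx orbT ltr01 !andbT divr_gt0// subr_gt0.
move=> q qM; apply: contrapT => nO.
have e1 : Num.min ((M - w q1) / 2) 1 <= 1 by rewrite ge_min lexx orbT.
have e2 : Num.min ((M - w q1) / 2) 1 <= (M - w q1) / 2 by rewrite ge_min lexx.
have qB : B q by split=> //; apply: le_trans qM; rewrite lerD2l lerN2.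
have := q1max q; rewrite inE => /(_ qB) => h.
have := le_trans qM h; lra.
Qed.

End comparison.

Section comparison_principle.
Context {R : realType} {m : nat}.
Implicit Types (q : Hpoint R m) (j : 'I_m).

Lemma HX_partial (z u v : Hpoint R m -> R) (k : R) q j :
  (forall i, partial i z q = k * (partial i u q - partial i v q)) ->
  HX j z q = k * (HX j u q - HX j v q).
Proof.
move=> E; rewrite /HX (E (idx_x j)) (E idx_t).
by move: (partial _ u q) (partial _ v q) (partial _ u q) (partial _ v q) (2 * _) => *; ring.
Qed.

Lemma HY_partial (z u v : Hpoint R m -> R) (k : R) q j :
  (forall i, partial i z q = k * (partial i u q - partial i v q)) ->
  HY j z q = k * (HY j u q - HY j v q).
Proof.
move=> E; rewrite /HY (E (idx_y j)) (E idx_t).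
by move: (partial _ u q) (partial _ v q) (partial _ u q) (partial _ v q) (2 * _) => *; ring.
Qed.

Let partial_scale (d : R) (g : Hpoint R m -> R) q i : C1at q g ->
  partial i (fun q => d * g q) q = d * partial i g q.
Proof.
move=> Cg; apply: is_derive_partial; apply: is_derive_scale.
by split=> //; exact: C1at_derivable.
Qed.

Lemma HX_scale (d : R) (g : Hpoint R m -> R) q j : C1at q g ->
  HX j (fun q => d * g q) q = d * HX j g q.
Proof.
move=> /(partial_scale d) E; rewrite [LHS]/HX (E (idx_x j)) (E idx_t) /HX.
by move: (partial _ g q) (partial _ g q) (2 * _) => *; ring.
Qed.

Lemma HY_scale (d : R) (g : Hpoint R m -> R) q j : C1at q g ->
  HY j (fun q => d * g q) q = d * HY j g q.
Proof.
move=> /(partial_scale d) E; rewrite [LHS]/HY (E (idx_y j)) (E idx_t) /HY.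
by move: (partial _ g q) (partial _ g q) (2 * _) => *; ring.
Qed.

Lemma flux_radial (phi : R -> R) (delta : R) c q j : 0 < delta -> 0 < grho c q ->
  flux phi (fun q => delta * gr c q) (HX j (fun q => delta * gr c q)) q =
    radial_coef phi delta c q * gE c j q /\
  flux phi (fun q => delta * gr c q) (HY j (fun q => delta * gr c q)) q =
    radial_coef phi delta c q * gF c j q.
Proof.
move=> d0 rho0; have N0 := gN_gt0 rho0; have r0 := gr_gt0 N0.
have s0 : 0 < gsigma c q by rewrite sqrtr_gt0.
have Cr := C1at_gr N0.
rewrite /flux hgrad_norm_gr// HX_scale// HY_scale// HX_gr// HY_gr// /radial_coef.
have rn := lt0r_neq0 r0; have sn := lt0r_neq0 s0; have dn := lt0r_neq0 d0.
by split; field; rewrite rn sn dn.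
Qed.

Variables (phi f l : R -> R) (u : Hpoint R m -> R).
Hypothesis phi_cont : {within `[0, +oo[, continuous phi}.
Hypothesis phi_derivable : forall t : R, 0 < t -> derivable phi t 1.
Hypothesis dphi_cont : forall t : R, 0 < t -> {for t, continuous (derive1 phi)}.
Hypothesis phi0 : phi 0 = 0.
Hypothesis phi_mono : forall x y, 0 <= x -> x <= y -> phi x <= phi y.
Hypothesis f_cont : {within `[0, +oo[, continuous f}.
Hypothesis l_cont : {within `[0, +oo[, continuous l}.
Hypothesis u_sol : weak_subsolution phi f l u.
Hypothesis u_ge0 : forall q, 0 <= u q.
Variables (c : Hpoint R m) (delta : R).
Hypothesis delta_gt0 : 0 < delta.

Let Cu q : C1at q u := (Ck1_C1at _).2 u_sol.1 q.
Let v q : R := delta * gr c q.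
Let w q : R := u q - v q.
Let G := radial_coef phi delta c.

(** The right-hand side along [u] minus the phi-Laplacian of [v] as given by [radial_divergence]. *)
Let rhs_gap q : R :=
  f (u q) * l (hgrad_norm u q) - (2 * m%:R + 1) * (grho c q * G q).

Let good := [set q | 0 < grho c q /\ 0 < rhs_gap q].

Let cont_rhs q : {for q, continuous (fun q => f (u q) * l (hgrad_norm u q))}.
Proof.
apply: contM.
  by apply: continuous_nonneg_comp => //; exact: (Cu q).1.
apply: continuous_nonneg_comp => //; first exact: hgrad_norm_ge0.
exact: continuous_hgrad_norm.
Qed.

Let cont_gap q : 0 < grho c q -> {for q, continuous rhs_gap}.
Proof.
move=> r0; apply: (@contB R _ (fun q => f (u q) * l (hgrad_norm u q))
  (fun q => (2 * m%:R + 1) * (grho c q * G q))); first exact: cont_rhs.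
have h := (@contM R _ (grho c) G q (C1at_grho c q).1
  (C1at_radial_coef delta_gt0 phi_derivable dphi_cont r0).1).
exact: (@contM R _ (fun=> 2 * m%:R + 1) _ q (@contC R _ _ _) h).
Qed.

Let open_good q : good q -> nbhs q good.
Proof.
move=> [r0 g0]; apply: filterI.
  by have := (C1at_grho c q).1 => /cvgr_gt /(_ _ r0).
by have := cont_gap r0 => /cvgr_gt /(_ _ g0).
Qed.

Let cont_w : continuous w.
Proof.
move=> q; apply: (@contB R _ u v); first exact: (Cu q).1.
have h := @contM R _ (fun=> delta) (gr c) q (@contC R _ _ _) (@continuous_gr R m c q).
exact: h.
Qed.

(** Let z be the test function. The weak integrand minus the divergence of z times the field of [v]
    has integral <= 0, as the divergence integrates to 0. Yet it is the gap times z plus a monotone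
    term, hence non-negative, and positive at a maximum point. *)
Lemma comparison_max (M L : R) :
  (forall q, w q <= M) -> (exists q0, w q0 = M) ->
  (forall q, M - 1 <= w q -> forall i, `|q 0 i| <= L) ->
  (forall q, w q = M -> 0 < grho c q /\
    (2 * m%:R + 1) * (grho c q * radial_coef phi delta c q) <
    f (u q) * l (hgrad_norm u q)) -> False.
Proof.
move=> wM [q0 wq0] wL goodM.
have [eta /andP[eta0 eta1] sub] : exists2 eta : R, 0 < eta <= 1 &
    forall q, M - eta <= w q -> good q.
  apply: (superlevel_in_open cont_w wM open_good _ wL) => q /goodM[g1 g2].
  by split=> //; rewrite /rhs_gap subr_gt0.
pose K := M - eta.
pose z q := pos_part (w q - K) ^+ 2.
have z_out q : w q < K -> \forall q' \near q, z q' = 0.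
  move=> wK; have := @cont_w q => /cvgr_lt /(_ _ wK); apply: filterS => q' wK'.
  by rewrite /z pos_part_le0 ?expr0n// subr_le0 ltW.
(* In the second case [z] vanishes near q. So [z] and its products with the field of [v] are C^1
   everywhere, although that field is singular on the axis. *)
have dichotomy q : good q \/ w q < K.
  by have [wK|wK] := leP K (w q); [left; exact: sub|right].
have Cv q : good q -> C1at q v.
  move=> [r0 _]; apply: (@C1at_mul R _ q (fun=> delta)); first exact: C1at_cst.
  exact/C1at_gr/gN_gt0.
have Cw q : good q -> C1at q w by move=> gq; apply: C1at_sub => //; exact: Cv.
have dpos x : derive1 (fun x : R => pos_part x ^+ 2) x = 2 * pos_part x.
  by rewrite derive1E; have [_ ->] := is_derive_pos_part_sqr x.
have CwK q : good q -> C1at q (fun q => w q - K).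
  by move=> gq; apply: C1at_sub; [exact: Cw|exact: C1at_cst].
have Cz q : C1at q z.
  have [gq|wK] := dichotomy q; last by apply: C1at_zero; exact: z_out.
  apply: (@C1at_comp R _ q (fun q => w q - K) (fun x => pos_part x ^+ 2)).
  - exact: CwK.
  - by near=> x; have [] := is_derive_pos_part_sqr x.
  - rewrite (_ : derive1 _ = (fun x => 2 * pos_part x)); last exact/funext.
    exact: (@contM R _ (fun=> 2) pos_part _ (@contC R _ _ _) (@continuous_pos_part R (w q - K))).
have Ckz : Ck 1 z by exact: (Ck1_C1at _).1.
have z0 q : 0 <= z q by exact: sqr_ge0.
have vz : vanish_out L z.
  move=> q i Lq; have [wK|wK] := leP K (w q); last exact: nbhs_singleton (z_out q wK).
  have : `|q 0 i| <= L.
    by apply: wL; apply: le_trans wK; rewrite lerD2l lerN2.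
  by rewrite leNgt Lq.
have {}vz : vanish_out `|L| z by apply: vanish_outW vz; exact: ler_norm.
have weak := weak_inequality_C1 phi_cont phi0 f_cont l_cont u_sol u_ge0
  (normr_ge0 L) Ckz z0 vz.
set I1 := test_integrand _ _ _ z in weak.
pose P j q := G q * gE c j q * z q.
pose Q j q := G q * gF c j q * z q.
have CG q : good q -> C1at q G.
  by move=> [r0 _]; exact: C1at_radial_coef.
have CP j : Ck 1 (P j).
  apply: (Ck1_C1at _).1 => q; have [gq|wK] := dichotomy q.
    apply: C1at_mul => //; apply: C1at_mul; first exact: CG.
    exact: C1at_gE.
  by apply: C1at_zero; apply: filterS (z_out q wK) => q' zq'; rewrite /P zq' mulr0.
have CQ j : Ck 1 (Q j).
  apply: (Ck1_C1at _).1 => q; have [gq|wK] := dichotomy q.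
    apply: C1at_mul => //; apply: C1at_mul; first exact: CG.
    exact: C1at_gF.
  by apply: C1at_zero; apply: filterS (z_out q wK) => q' zq'; rewrite /Q zq' mulr0.
have vP j : vanish_out `|L| (P j) by exact: vanish_outMr.
have vQ j : vanish_out `|L| (Q j) by exact: vanish_outMr.
have div0 := horizontal_divergence_theorem CP CQ vP vQ.
pose I2 q := \sum_j (HX j (P j) q + HY j (Q j) q).
pose H q := I1 q + (-1) * I2 q.
have cI1 : continuous I1.
  apply: continuous_test_integrand => //.
  - by move=> j; apply: (continuous_flux phi_cont phi0 u_sol);
      [move=> q; exact: continuous_HX|move=> q; exact: HX_le_hgrad_norm].
  - by move=> j; apply: (continuous_flux phi_cont phi0 u_sol);
      [move=> q; exact: continuous_HY|move=> q; exact: HY_le_hgrad_norm].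
have vI1 : vanish_out `|L| I1 by exact: vanish_out_test_integrand.
have cI2 : continuous I2.
  move=> q; apply: cont_sum => j _; apply: contD.
    by apply: continuous_HX; exact: (Ck1_C1at _).2.
  by apply: continuous_HY; exact: (Ck1_C1at _).2.
have vI2 : vanish_out `|L| I2.
  apply: vanish_out_sum => j; apply: vanish_outD.
    exact: vanish_out_HX.
  exact: vanish_out_HY.
have cNI2 : continuous (fun q => (-1) * I2 q).
  by move=> q; exact: (@contM R _ (fun=> -1) _ q (@contC R _ _ _) (cI2 q)).
have vNI2 : vanish_out `|L| (fun q => (-1) * I2 q) by exact: vanish_outMr.
have H_out q : w q < K -> H q = 0.
  move=> wK; have zn := z_out q wK.
  rewrite /H /I1 /test_integrand (nbhs_singleton zn) mulr0 add0r.
  rewrite big1 => [|j _]; last by rewrite HX_near0// HY_near0// !mulr0 addr0.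
  rewrite /I2 big1 ?mulr0 ?addr0// => j _; rewrite HX_near0 ?HY_near0 ?addr0//.
    by apply: filterS zn => q' zq'; rewrite /Q zq' mulr0.
  by apply: filterS zn => q' zq'; rewrite /P zq' mulr0.
(* The gradient of [z] is 2 (w - K)^+ times the difference of the gradients, so the flux terms
   combine into the expression of [flux_monotone]. *)
have H_good q : good q -> H q = rhs_gap q * z q + 2 * pos_part (w q - K) *
    \sum_j ((flux phi u (HX j u) q - flux phi v (HX j v) q) * (HX j u q - HX j v q) +
            (flux phi u (HY j u) q - flux phi v (HY j v) q) * (HY j u q - HY j v q)).
  move=> gq; have [r0 _] := gq.
  have dz i : partial i z q = 2 * pos_part (w q - K) * (partial i u q - partial i v q).
    apply: is_derive_partial.
    apply: (@is_derive_compR _ _ (fun x => pos_part x ^+ 2) (fun q => w q - K)).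
      exact: is_derive_pos_part_sqr.
    rewrite -[X in is_derive _ _ _ X]subr0; apply: is_derive_sub.
    by apply: is_derive_sub; split=> //; apply: C1at_derivable => //; exact: Cv.
  have HXz j := HX_partial j dz; have HYz j := HY_partial j dz.
  have I2E : I2 q = (2 * m%:R + 1) * (grho c q * G q) * z q +
      \sum_j (G q * gE c j q * HX j z q + G q * gF c j q * HY j z q).
    rewrite -(radial_divergence delta_gt0 phi_derivable dphi_cont r0) mulr_suml -big_split/=.
    apply: eq_bigr => j _; rewrite /P /Q.
    have CGE : C1at q (fun q => G q * gE c j q).
      by apply: C1at_mul; [exact: CG|exact: C1at_gE].
    have CGF : C1at q (fun q => G q * gF c j q).
      by apply: C1at_mul; [exact: CG|exact: C1at_gF].
    rewrite (HX_mul j CGE (Cz q)) (HY_mul j CGF (Cz q)); ring.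
  rewrite /H I2E /I1 /test_integrand mulr_sumr.
  set S1 := \sum_j _; set S2 := \sum_j _; set S3 := \sum_j _.
  have -> : S3 = S1 - S2.
    rewrite /S1 /S2 /S3 -sumrB; apply: eq_bigr => j _.
    have [-> ->] := flux_radial phi j delta_gt0 r0.
    by rewrite HXz HYz -/(v) -/(G q); ring.
  by rewrite /rhs_gap; ring.
have H_ge0 q : 0 <= H q.
  have [gq|/H_out ->//] := dichotomy q.
  rewrite H_good// addr_ge0//.
    by rewrite mulr_ge0//; case: gq => _ /ltW.
  by rewrite mulr_ge0 ?flux_monotone// mulr_ge0// pos_part_ge0.
have good0 : good q0 by apply: sub; rewrite wq0 lerBlDr lerDl ltW.
have H_gt0 : 0 < H q0.
  rewrite H_good// ltr_wpDr//.
    by rewrite mulr_ge0 ?flux_monotone// mulr_ge0// pos_part_ge0.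
  rewrite mulr_gt0//; first by case: good0.
  by rewrite /z exprn_gt0// pos_part_gt0 wq0 /K opprB addrC subrK.
have cH : continuous H.
  by move=> q; apply: (@contD R _ I1 (fun q => (-1) * I2 q)); [exact: cI1|exact: cNI2].
have vH : vanish_out `|L| H by exact: vanish_outD.
have := lebesgue_int_gt0 cH vH H_ge0 H_gt0.
rewrite (lebesgue_intD cI1 vI1 cNI2 vNI2) (lebesgue_intZ _ cI2 vI2).
by rewrite /I2 div0 mulr0 addr0 ltNge weak.
Unshelve. all: by end_near. Qed.

End comparison_principle.

(** * Three gauges *)

Section three_centres.
Context {R : realType} {m : nat}.
Implicit Types (c p q : Hpoint R m) (j : 'I_m).

Definition hsize c : R := \sum_j (`|c 0 (idx_x j)| + `|c 0 (idx_y j)|).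

Lemma hsize_ge0 c : 0 <= hsize c.
Proof. by apply: sumr_ge0 => j _; rewrite addr_ge0. Qed.

(** The vertical coordinate differs from that of c^-1 o q by twice a symplectic product of c with
    the relative coordinates, at most 2 A [hsize c]. *)
Lemma coord_le c q (A T : R) : 0 <= A -> (forall j, `|ga c j q| <= A) ->
  (forall j, `|gb c j q| <= A) -> `|gT c q| <= T ->
  forall i, `|q 0 i - c 0 i| <= A + T + 2 * A * hsize c.
Proof.
move=> A0 ha hb hT i.
have T0 : 0 <= T by apply: le_trans hT.
have S0 := hsize_ge0 c.
have AS0 : 0 <= 2 * A * hsize c by rewrite !mulr_ge0.
case: (split_ordP i) => [i1 ->|i1 ->]; last first.
  have -> : rshift (m + m) i1 = idx_t by rewrite /idx_t (ord1 i1).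
  pose S := \sum_j (c 0 (idx_x j) * gb c j q - c 0 (idx_y j) * ga c j q).
  have SE : S = \sum_j (c 0 (idx_x j) * q 0 (idx_y j) - c 0 (idx_y j) * q 0 (idx_x j)).
    by apply: eq_bigr => j _; rewrite /ga /gb; ring.
  have -> : q 0 idx_t - c 0 idx_t = gT c q - 2 * S by rewrite SE /gT; ring.
  apply: le_trans (ler_normB _ _) _.
  have : `|2 * S| <= 2 * A * hsize c.
    rewrite normrM ger0_norm// -mulrA ler_wpM2l// /hsize mulr_sumr.
    apply: le_trans (ler_norm_sum _ _ _) _; apply: ler_sum => j _.
    apply: le_trans (ler_normB _ _) _; rewrite !normrM mulrDr.
    by rewrite lerD// mulrC ler_wpM2r.
  by move=> hS; apply: le_trans (lerD hT hS) _; rewrite lerD2r lerDr.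
have small (x : R) : `|x| <= A -> `|x| <= A + T + 2 * A * hsize c by move=> ?; lra.
apply: small; case: (split_ordP i1) => [j ->|j ->]; first exact: ha.
exact: hb.
Qed.

Lemma gr_coord_le c q (B : R) : gr c q <= B ->
  [/\ forall j, `|ga c j q| <= B, forall j, `|gb c j q| <= B & `|gT c q| <= B ^+ 2].
Proof.
move=> rB; have B0 : 0 <= B by apply: le_trans rB; exact: gr_ge0.
have rhoB : grho c q <= B ^+ 2.
  rewrite -gsigma2 ler_pXn2r ?nnegrE ?sqrtr_ge0//.
  exact: le_trans (gsigma_le_gr c q) rB.
have sq j : ga c j q ^+ 2 + gb c j q ^+ 2 <= grho c q.
  rewrite /grho (bigD1 j)//= lerDl; apply: sumr_ge0 => k _.
  by rewrite addr_ge0 ?sqr_ge0.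
split=> [j|j|].
- rewrite -(@ler_pXn2r _ 2) ?nnegrE// real_normK ?num_real//.
  by apply: le_trans rhoB; apply: le_trans (sq j); rewrite lerDl sqr_ge0.
- rewrite -(@ler_pXn2r _ 2) ?nnegrE// real_normK ?num_real//.
  by apply: le_trans rhoB; apply: le_trans (sq j); rewrite lerDr sqr_ge0.
- rewrite -(@ler_pXn2r _ 2) ?nnegrE ?sqr_ge0// real_normK ?num_real//.
  rewrite -exprM; apply: (@le_trans _ _ (gN c q)); first by rewrite lerDr sqr_ge0.
  by rewrite -gr4 ler_pXn2r ?nnegrE ?gr_ge0.
Qed.

(* [p o (a e_x + b e_y, 0)]: right translation of [p] in the plane of index [j0]. *)
Definition hshift p j0 (a b : R) : Hpoint R m :=
  p + a *: delta_mx 0 (idx_x j0) + b *: delta_mx 0 (idx_y j0) +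
  (2 * (p 0 (idx_y j0) * a - p 0 (idx_x j0) * b)) *: delta_mx 0 idx_t.

Let entry (x y z : R) (A B C D : Hpoint R m) i :
  (A + x *: B + y *: C + z *: D) 0 i = A 0 i + x * B 0 i + y * C 0 i + z * D 0 i.
Proof. by rewrite !mxE. Qed.

Lemma hshift_x p j0 a b j :
  hshift p j0 a b 0 (idx_x j) = p 0 (idx_x j) + a * (j == j0)%:R.
Proof. by rewrite entry !delta_idx !mulr0 !addr0. Qed.

Lemma hshift_y p j0 a b j :
  hshift p j0 a b 0 (idx_y j) = p 0 (idx_y j) + b * (j == j0)%:R.
Proof. by rewrite entry !delta_idx !mulr0 !addr0. Qed.

Lemma hshift_t p j0 a b : hshift p j0 a b 0 idx_t =
  p 0 idx_t + 2 * (p 0 (idx_y j0) * a - p 0 (idx_x j0) * b).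
Proof. by rewrite entry !delta_idx !mulr0 !addr0 mulr1. Qed.

Lemma ga_hshift p j0 a b j q : ga (hshift p j0 a b) j q = ga p j q - a * (j == j0)%:R.
Proof. by rewrite /ga hshift_x; ring. Qed.

Lemma gb_hshift p j0 a b j q : gb (hshift p j0 a b) j q = gb p j q - b * (j == j0)%:R.
Proof. by rewrite /gb hshift_y; ring. Qed.

Lemma gT_hshift p j0 a b q : gT (hshift p j0 a b) q =
  gT p q + 2 * (a * gb p j0 q - b * ga p j0 q).
Proof.
rewrite /gT hshift_t /ga /gb.
have -> : \sum_j (hshift p j0 a b 0 (idx_x j) * q 0 (idx_y j) -
                  hshift p j0 a b 0 (idx_y j) * q 0 (idx_x j)) =
    \sum_j (p 0 (idx_x j) * q 0 (idx_y j) - p 0 (idx_y j) * q 0 (idx_x j)) +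
    (a * q 0 (idx_y j0) - b * q 0 (idx_x j0)).
  have -> : a * q 0 (idx_y j0) - b * q 0 (idx_x j0) =
      \sum_j (a * q 0 (idx_y j) - b * q 0 (idx_x j)) * (j == j0)%:R.
    rewrite (bigD1 j0)//= eqxx mulr1 big1 ?addr0// => j /negPf ->.
    by rewrite mulr0.
  rewrite -big_split/=; apply: eq_bigr => j _.
  by rewrite hshift_x hshift_y; ring.
by ring.
Qed.

(* The axis of the first centre meets the second gauge at vertical coordinate
   shifted by twice the determinant; far up or down, the sign of that shift
   decides, whence the need for a third centre. *)
Lemma gr_lt_on_axis p j0 (a b a' b' e : R) q :
  (a - a') ^+ 2 + (b - b') ^+ 2 <= 5 * e ^+ 2 ->
  (a' * b - b' * a) ^+ 2 = e ^+ 4 ->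
  (a' * b - b' * a) * gT (hshift p j0 a b) q < - (9 * e ^+ 4) ->
  grho (hshift p j0 a b) q = 0 ->
  gr (hshift p j0 a' b') q < gr (hshift p j0 a b) q.
Proof.
move=> near_ab det2 detT rho0.
have sq0 j : ga (hshift p j0 a b) j q ^+ 2 + gb (hshift p j0 a b) j q ^+ 2 = 0.
  apply/eqP; rewrite eq_le addr_ge0 ?sqr_ge0// andbT -rho0 /grho (bigD1 j)//= lerDl.
  by apply: sumr_ge0 => k _; rewrite addr_ge0 ?sqr_ge0.
have ga0 j : ga p j q = a * (j == j0)%:R.
  apply/eqP; rewrite -subr_eq0 -(ga_hshift _ _ _ b) -sqrf_eq0 eq_le sqr_ge0 andbT.
  by rewrite -(sq0 j) lerDl sqr_ge0.
have gb0 j : gb p j q = b * (j == j0)%:R.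
  apply/eqP; rewrite -subr_eq0 -(gb_hshift _ _ a) -sqrf_eq0 eq_le sqr_ge0 andbT.
  by rewrite -(sq0 j) lerDr sqr_ge0.
have T' : gT (hshift p j0 a' b') q = gT (hshift p j0 a b) q + 2 * (a' * b - b' * a).
  by rewrite !gT_hshift ga0 gb0 eqxx !mulr1; ring.
have rho' : grho (hshift p j0 a' b') q = (a - a') ^+ 2 + (b - b') ^+ 2.
  rewrite /grho (bigD1 j0)//= big1 => [|j /negPf jj0]; last first.
    by rewrite ga_hshift gb_hshift ga0 gb0 jj0 !mulr0 subr0 expr0n addr0.
  by rewrite ga_hshift gb_hshift ga0 gb0 eqxx !mulr1 addr0.
have e2 := sqr_ge0 e.
have N' : gN (hshift p j0 a' b') q < gN (hshift p j0 a b) q.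
  rewrite /gN rho0 T' rho'; move: near_ab det2 detT.
  have := addr_ge0 (sqr_ge0 (a - a')) (sqr_ge0 (b - b')).
  move: ((a - a') ^+ 2 + (b - b') ^+ 2) (a' * b - b' * a) (gT _ q) => r s t r0 r5 s2 st.
  (* The change of N is r^2 + 4st + 4s^2 < (25 - 36 + 4) e^4 <= 0; this is where the 5 and the 9 of
     the statement come from. *)
  have r2 : r ^+ 2 <= 25 * e ^+ 4.
    rewrite (_ : 25 * e ^+ 4 = (5 * e ^+ 2) ^+ 2); last by ring.
    by rewrite ler_pXn2r ?nnegrE// mulr_ge0.
  have e4 : 0 <= e ^+ 4 by rewrite exprn_even_ge0.
  have -> : r ^+ 2 + (t + 2 * s) ^+ 2 = r ^+ 2 + t ^+ 2 + 4 * (s * t) + 4 * s ^+ 2.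
    by ring.
  have E0 : (0 : R) ^+ 2 = 0 by rewrite expr0n.
  rewrite E0 s2; case: (ltgtP (e ^+ 4) 0) e4 => // [ep|ez] _; first by lra.
  by rewrite ez in r2 st *; lra.
by rewrite /gr !ltr_sqrt// ?sqrtr_gt0; exact: le_lt_trans (gN_ge0 _ _) N'.
Qed.

Lemma three_centres p j0 (r : R) : 0 < r ->
  exists (C : 'I_3 -> Hpoint R m) (B : R), [/\ 0 < B,
    forall k q, gr (C k) q <= B -> forall i, `|q 0 i - p 0 i| < r &
    forall k q, grho (C k) q = 0 -> B < gr (C k) q ->
      exists l, gr (C l) q < gr (C k) q].
Proof.
move=> r0; pose Sp := hsize p; have Sp0 : 0 <= Sp := hsize_ge0 p.
(* On the gauge ball of radius 3e about a centre, relative to [p]: |a|, |b| <= 4e and |T| <= 9e^2 +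
   16e^2 <= 25e, as e <= 1. Then [coord_le] bounds the coordinates by 29e + 8e [Sp], strictly below
   r. *)
pose e := Num.min 1 (r / (30 + 8 * Sp)).
have d0 : 0 < 30 + 8 * Sp by lra.
have e0 : 0 < e by rewrite lt_min ltr01 divr_gt0.
have e1 : e <= 1 by rewrite ge_min lexx.
have er : e * (30 + 8 * Sp) <= r by rewrite -ler_pdivlMr// ge_min lexx orbT.
(* The triangle e(1,0), e(0,1), e(-1,-1): the determinant of cyclically consecutive vertices is
   always e^2, and squared sides are at most 5e^2. *)
pose wx (k : 'I_3) : R := if k == 0 then e else if k == 1 then 0 else - e.
pose wy (k : 'I_3) : R := if k == 0 then 0 else if k == 1 then e else - e.
have wxe k : `|wx k| <= e.
  by rewrite /wx; do 2?case: ifP => _; rewrite ?normr0 ?normrN ?gtr0_norm// ltW.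
have wye k : `|wy k| <= e.
  by rewrite /wy; do 2?case: ifP => _; rewrite ?normr0 ?normrN ?gtr0_norm// ltW.
exists (fun k => hshift p j0 (wx k) (wy k)), (3 * e); split.
- by rewrite mulr_gt0.
- move=> k q /gr_coord_le[ha hb hT] i.
  have delta_le (x : R) (j : 'I_m) : `|x| <= e -> `|x * (j == j0)%:R| <= e.
    by case: (j == j0); rewrite ?mulr1// mulr0 normr0 => _; exact: ltW.
  have pa j : `|ga p j q| <= 4 * e.
    have := ha j; rewrite ga_hshift; have := delta_le _ j (wxe k).
    move: (wx k * _) (ga p j q) => x y hx hy.
    rewrite -[y](subrK x); apply: le_trans (ler_normD _ _) _; lra.
  have pb j : `|gb p j q| <= 4 * e.
    have := hb j; rewrite gb_hshift; have := delta_le _ j (wye k).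
    move: (wy k * _) (gb p j q) => x y hx hy.
    rewrite -[y](subrK x); apply: le_trans (ler_normD _ _) _; lra.
  have pT : `|gT p q| <= 25 * e.
    have x1 : `|wx k * gb p j0 q| <= e * (4 * e) by rewrite normrM ler_pM.
    have x2 : `|wy k * ga p j0 q| <= e * (4 * e) by rewrite normrM ler_pM.
    move: hT; rewrite gT_hshift.
    move: (wx k * _) (wy k * _) (gT p q) x1 x2 => x y t x1 x2 hT.
    have e2 : e * e <= e by rewrite ger_pMr.
    have xy : `|2 * (x - y)| <= 16 * (e * e).
      rewrite normrM ger0_norm//; have := ler_normB x y; lra.
    have -> : t = (t + 2 * (x - y)) - 2 * (x - y) by ring.
    apply: le_trans (ler_normB _ _) _.
    have -> : 25 * e = 9 * e + 16 * e by ring.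
    apply: lerD; first by apply: le_trans hT _; rewrite exprMn expr2 expr2; lra.
    by apply: le_trans xy _; rewrite ler_wpM2l.
  have e4 : 0 <= 4 * e by rewrite mulr_ge0// ltW.
  apply: le_lt_trans (coord_le e4 pa pb pT i) _; apply: lt_le_trans er.
  have := mulr_ge0 (ltW e0) Sp0; rewrite -/Sp mulrDr => eS.
  have -> : 2 * (4 * e) * Sp = e * (8 * Sp) by ring.
  by rewrite ltrD2r; clear -e0; lra.
- move=> k q rho0 Bq.
  (* On the axis r^2 = |T|, so the radius 3e is exactly the threshold |T| > 9e^2 of
     [gr_lt_on_axis]. *)
  have T9 : (9 * e ^+ 2) ^+ 2 < gT (hshift p j0 (wx k) (wy k)) q ^+ 2.
    have -> : (9 * e ^+ 2) ^+ 2 = (3 * e) ^+ 4 by ring.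
    have : (3 * e) ^+ 4 < gr (hshift p j0 (wx k) (wy k)) q ^+ 4.
      by rewrite ltr_pXn2r ?nnegrE ?gr_ge0// mulr_ge0// ltW.
    by rewrite gr4 /gN rho0 expr0n add0r.
  have e2 : 0 < e ^+ 2 by rewrite exprn_gt0.
  have close (l : 'I_3) (s : R) : wx l * wy k - wy l * wx k = s * e ^+ 2 -> s ^+ 2 = 1 ->
      (wx k - wx l) ^+ 2 + (wy k - wy l) ^+ 2 <= 5 * e ^+ 2 ->
      s * gT (hshift p j0 (wx k) (wy k)) q < 0 ->
      exists l, gr (hshift p j0 (wx l) (wy l)) q < gr (hshift p j0 (wx k) (wy k)) q.
    move=> det s1 near sT; exists l; apply: (gr_lt_on_axis near _ _ rho0).
      by rewrite det exprMn s1 mul1r -exprM.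
    rewrite det; move: (gT _ q) T9 sT => t T9 sT.
    have st9 : 9 * e ^+ 2 < - (s * t).
      have st0 : 0 <= - (s * t) by rewrite oppr_ge0 ltW.
      have e90 : 0 <= 9 * e ^+ 2 by rewrite mulr_ge0// ltW.
      have st2 : (- (s * t)) ^+ 2 = t ^+ 2 by rewrite sqrrN exprMn s1 mul1r.
      by rewrite -(@ltr_pXn2r _ 2) ?nnegrE// st2.
    have -> : s * e ^+ 2 * t = - (e ^+ 2 * (- (s * t))) by ring.
    rewrite ltrN2; have -> : 9 * e ^+ 4 = e ^+ 2 * (9 * e ^+ 2) by ring.
    by rewrite ltr_pM2l.
  have T0 : gT (hshift p j0 (wx k) (wy k)) q != 0.
    apply/eqP => T0; move: T9; rewrite T0 expr0n ltNge => /negP; apply.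
    exact: sqr_ge0.
  (* Indices are modulo 3: the preceding vertex gives determinant e^2, suited to T < 0, the
     following one -e^2, suited to T > 0. *)
  have [Tneg|Tpos] : gT (hshift p j0 (wx k) (wy k)) q < 0 \/
      0 < gT (hshift p j0 (wx k) (wy k)) q.
    by case: ltgtP T0 => //; [left|right].
  + apply: (close (k - 1) 1); rewrite ?mul1r ?expr1n//.
      by case: k {rho0 Bq T9 close T0 Tneg} => -[|[|[|]]]//= ?; rewrite /wx /wy /=; ring.
    by case: k {rho0 Bq T9 close T0 Tneg} => -[|[|[|]]]//= ?; rewrite /wx /wy /=; nra.
  + apply: (close (k + 1) (-1)); rewrite ?mulN1r ?sqrrN ?expr1n ?oppr_lt0//.
      by case: k {rho0 Bq T9 close T0 Tpos} => -[|[|[|]]]//= ?; rewrite /wx /wy /=; ring.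
    by case: k {rho0 Bq T9 close T0 Tpos} => -[|[|[|]]]//= ?; rewrite /wx /wy /=; nra.
Qed.

End three_centres.

(** * Liouville property *)

Section one_variable.
Context {R : realType}.

Lemma nondecreasing_of_derive (g dg : R -> R) : continuous g ->
  (forall t : R, 0 < t -> is_derive t 1 g (dg t)) -> (forall t : R, 0 < t -> 0 <= dg t) ->
  forall x y : R, 0 <= x -> x <= y -> g x <= g y.
Proof.
move=> cg Dg dg0 x y x0; rewrite le_eqVlt => /predU1P[->//|xy].
have Dg' c : c \in `]x, y[ -> is_derive c 1 g (dg c).
  by rewrite in_itv/= => /andP[xc _]; apply: Dg; exact: le_lt_trans xc.
have [|c] := MVT xy Dg'; first exact: continuous_subspaceT.
rewrite in_itv/= => /andP[xc _] E; rewrite -subr_ge0 E mulr_ge0 ?subr_ge0 ?(ltW xy)//.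
by apply: dg0; exact: le_lt_trans xc.
Qed.

Variable phi : R -> R.
Hypothesis phi_cont : {within `[0, +oo[, continuous phi}.
Hypothesis phi_derivable : forall t : R, 0 < t -> derivable phi t 1.
Hypothesis phi0 : phi 0 = 0.
Hypothesis dphi_gt0 : forall t : R, 0 < t -> 0 < derive1 phi t.

(** The even extension is continuous on the whole line, as the mean value argument requires, and
    agrees with [phi] on [0, +oo[. *)
Let psi (x : R) := phi `|x|.

Let cont_psi : continuous psi.
Proof.
move=> x; apply: (continuous_nonneg_comp (g := fun x : R => `|x|) phi_cont) => //.
exact: norm_continuous.
Qed.

Let derive_psi (t : R) : 0 < t -> is_derive t 1 psi (derive1 phi t).
Proof.
move=> t0; apply: (near_eq_is_derive (f := phi)).
  by near=> x; rewrite /psi gtr0_norm//; near: x; exact: lt_nbhsr.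
by split; [exact: phi_derivable|rewrite derive1E].
Unshelve. all: by end_near. Qed.

Lemma phi_nondecreasing (x y : R) : 0 <= x -> x <= y -> phi x <= phi y.
Proof.
move=> x0 xy; have := nondecreasing_of_derive cont_psi derive_psi
  (fun t t0 => ltW (dphi_gt0 t0)) x0 xy.
by rewrite /psi !ger0_norm// (le_trans x0).
Qed.

(** The scaling hypothesis integrated: the difference of the two sides is 0 at t = 0, and by the
    chain rule its derivative is the difference assumed non-negative. *)
Lemma phi_scale (D tau s t : R) :
  (forall s t : R, 0 < s <= 1 -> 0 < t ->
     s * derive1 phi (s * t) <= D * s `^ tau * derive1 phi t) ->
  0 < s <= 1 -> 0 <= t -> phi (s * t) <= D * s `^ tau * phi t.
Proof.
move=> dphi_scale s01 t0; have /andP[s0 s1] := s01.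
pose k := D * s `^ tau.
pose g x := k * psi x - psi (s * x).
have cg : continuous g.
  move=> x; have h1 := @contM R R (fun=> k) psi x (@contC R R _ _) (@cont_psi x).
  have h2 := @contM R R (fun=> s) id x (@contC R R _ _) (@cvg_id _ _).
  exact: (@contB R R _ (fun x => psi (s * x)) x h1 (continuous_comp h2 (@cont_psi _))).
have Dg (x : R) : 0 < x -> is_derive x 1 g (k * derive1 phi x - derive1 phi (s * x) * s).
  move=> x0; apply: is_derive_sub; first by apply: is_derive_scale; exact: derive_psi.
  apply: (@is_derive_compR _ _ psi (fun x : R => s * x)).
    by apply: derive_psi; exact: mulr_gt0.
  rewrite -[X in is_derive _ _ _ X]mulr1.
  by apply: (@is_derive_scale _ _ s id); exact: is_derive_id.
have := nondecreasing_of_derive cg Dg _ (lexx 0) t0.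
rewrite /g /psi mulr0 normr0 phi0 mulr0 subrr subr_ge0 !ger0_norm ?mulr_ge0 ?(ltW s0)//.
by apply=> x x0; rewrite subr_ge0 mulrC; exact: dphi_scale.
Qed.

End one_variable.

Section maximum.
Context {R : realType} {m : nat}.
Implicit Types (c p q : Hpoint R m) (u v : Hpoint R m -> R).

(** There the gauge is at most (U - K) / delta, and gauge balls are bounded. *)
Lemma superlevel_bounded u (U delta : R) c (K : R) : (forall q, u q <= U) -> 0 < delta ->
  exists L, forall q, K <= u q - delta * gr c q -> forall i, `|q 0 i| <= L.
Proof.
move=> uU d0; pose B := (U - K) / delta.
exists (`|c| + (B + B ^+ 2 + 2 * B * hsize c)) => q Kq i.
have rB : gr c q <= B.
  rewrite ler_pdivlMr// mulrC lerBrDr addrC -lerBrDr.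
  exact: le_trans Kq (lerD (uU q) (lexx _)).
have B0 : 0 <= B by apply: le_trans rB; exact: gr_ge0.
have [ha hb hT] := gr_coord_le rB.
have h := coord_le B0 ha hb hT i.
rewrite -[q 0 i](subrK (c 0 i)) addrC; apply: le_trans (ler_normD _ _) _.
by apply: lerD h; exact: coord_le_norm.
Qed.

Lemma continuous_sub_gr u (delta : R) c : continuous u ->
  continuous (fun q => u q - delta * gr c q).
Proof.
move=> cu q; apply: (@contB R _ u (fun q => delta * gr c q)); first exact: cu.
exact: (@contM R _ (fun=> delta) (gr c) q (@contC R _ _ _) (@continuous_gr R m c q)).
Qed.

Lemma max_attained u (U delta : R) c : continuous u -> (forall q, u q <= U) -> 0 < delta ->
  exists q0, forall q, u q - delta * gr c q <= u q0 - delta * gr c q0.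
Proof.
move=> cu uU d0; pose w q := u q - delta * gr c q.
have [L wL] := superlevel_bounded c (w c) uU d0.
pose A := [set q : Hpoint R m | forall i, `|q 0 i| <= L].
have A0 : A !=set0 by exists c => i; exact: wL.
have cw : {within A, continuous w} by apply: continuous_subspaceT; exact: continuous_sub_gr.
have [q0 _ q0max] := EVT_max_rV A0 (@compact_cube R _ L) cw.
exists q0 => q; have [qc|cq] := leP (w c) (w q).
  by apply: q0max; rewrite inE => i; exact: wL.
by apply: le_trans (ltW cq) _; apply: q0max; rewrite inE => i; exact: wL.
Qed.

Lemma hgrad_norm_eq_at_max u v q : C1at q u -> C1at q v ->
  (forall q', u q' - v q' <= u q - v q) -> hgrad_norm u q = hgrad_norm v q.
Proof.
move=> Cu Cv max.
have E i : partial i u q = partial i v q.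
  apply/eqP; rewrite -subr_eq0; apply/eqP.
  apply: (is_derive_max (v := delta_mx 0 i) _ max).
  by apply: is_derive_sub; split=> //; exact: C1at_derivable.
rewrite /hgrad_norm /hgrad_dot; congr Num.sqrt; apply: eq_bigr => j _.
by rewrite /HX /HY !E.
Qed.

(** With s = sigma / r, the chain is s phi(s delta) <= D s^(1+tau) phi(delta) <= D Lambda
    (phi(delta)/l(delta)) l(s delta), and 1/r < 1/B. The extra s in the phi-Laplacian supplies the
    exponent 1 + tau. *)
Lemma radial_bound (phi l : R -> R) (D Lambda tau B k f1 delta : R) c q :
  (forall x y : R, 0 <= x -> x <= y -> phi x <= phi y) -> phi 0 = 0 ->
  (forall t : R, 0 < t -> 0 < l t) -> 0 <= k -> 0 < D -> 0 < Lambda ->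
  (forall s t : R, 0 < s <= 1 -> 0 <= t -> phi (s * t) <= D * s `^ tau * phi t) ->
  (forall s t : R, 0 <= s <= 1 -> 0 <= t -> s `^ (1 + tau) * l t <= Lambda * l (s * t)) ->
  0 < delta -> 0 < B -> B < gr c q -> 0 < grho c q ->
  k * D * Lambda / B * (phi delta / l delta) < f1 ->
  k * (grho c q * radial_coef phi delta c q) < f1 * l (delta * (gsigma c q / gr c q)).
Proof.
move=> phi_mono phi0 l_gt0 k0 D0 La0 phi_scl l_scl d0 B0 Br rho0 small.
have r0 : 0 < gr c q by exact: lt_trans Br.
have sg0 : 0 < gsigma c q by rewrite sqrtr_gt0.
have -> : grho c q * radial_coef phi delta c q =
    gsigma c q / gr c q * phi (delta * (gsigma c q / gr c q)) / gr c q.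
  rewrite /radial_coef -gsigma2; have rn := lt0r_neq0 r0; have sn := lt0r_neq0 sg0.
  by move: (phi _) => x; field; rewrite rn sn.
have s0 : 0 < gsigma c q / gr c q by exact: divr_gt0.
have s1 : gsigma c q / gr c q <= 1 by rewrite ler_pdivrMr// mul1r; exact: gsigma_le_gr.
move: (gsigma c q / gr c q) s0 s1 => s s0 s1; rewrite (mulrC delta s).
move: (gr c q) r0 Br => r r0 Br.
have s01 : 0 < s <= 1 by rewrite s0 s1.
have ld0 := l_gt0 _ d0; have lsd0 : 0 < l (s * delta) by apply: l_gt0; exact: mulr_gt0.
have pd0 : 0 <= phi delta by rewrite -phi0; apply: phi_mono => //; exact: ltW.
have psd0 : 0 <= phi (s * delta) by rewrite -phi0; apply: phi_mono => //; apply: ltW; exact: mulr_gt0.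
have step1 : s * phi (s * delta) <= D * Lambda * (phi delta / l delta) * l (s * delta).
  apply: (@le_trans _ _ (s * (D * s `^ tau * phi delta))).
    by rewrite ler_pM2l//; apply: phi_scl => //; exact: ltW.
  have -> : s * (D * s `^ tau * phi delta) = D * phi delta * s `^ (1 + tau).
    rewrite powRD ?powRr1 ?(ltW s0)//; last by rewrite (gt_eqF s0) implybT.
    by move: (s `^ tau) => x; ring.
  have -> : D * Lambda * (phi delta / l delta) * l (s * delta) =
      D * phi delta * (Lambda * l (s * delta) / l delta).
    by move: (l _) (l _) (phi _) => x y z; ring.
  rewrite ler_wpM2l ?mulr_ge0 ?(ltW D0)// ler_pdivlMr//.
  by apply: l_scl; [rewrite (ltW s0)|exact: ltW].
have step2 : s * phi (s * delta) / r <= s * phi (s * delta) / B.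
  rewrite ler_wpM2l ?mulr_ge0 ?(ltW s0)// lef_pV2 ?posrE//; exact: ltW.
apply: (@le_lt_trans _ _ (k * D * Lambda / B * (phi delta / l delta) * l (s * delta))).
  have -> : k * D * Lambda / B * (phi delta / l delta) * l (s * delta) =
      k * (D * Lambda * (phi delta / l delta) * l (s * delta) / B).
    by move: (phi delta / l delta) (l _) (B^-1) => x y z; ring.
  rewrite ler_wpM2l//; apply: le_trans step2 _.
  by rewrite ler_pM2r ?invr_gt0.
by rewrite ltr_pM2r.
Qed.

End maximum.

Section constant_solutions.
Context {R : realType} {m : nat}.
Implicit Types (q : Hpoint R m).

Lemma bump_exists : exists (zeta : Hpoint R m -> R) (L : R) (q0 : Hpoint R m),
  [/\ 0 <= L, Ck 1 zeta, forall q, 0 <= zeta q, vanish_out L zeta & 0 < zeta q0].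
Proof.
have [beta [gamma [sb _ [b0 _] [bout _] part]]] := @spline_exists R.
(* Otherwise the translates of [beta] could not sum to 1. *)
have [x bx] : exists x, 0 < beta x.
  have [|sum1 _] := part 3 3; first by rewrite !lexx.
  apply: contrapT => nx; move: sum1; rewrite big1 => [/eqP|k _].
    by rewrite eq_sym oner_eq0.
  apply/eqP; rewrite eq_le b0 andbT leNgt; apply/negP => bk.
  by apply: nx; exists (3 - k%:R).
exists (fun q => \prod_i beta (q 0 i)), 3, (\row_i x); split=> //.
- by apply: Ck_prod => i _; apply: Ck_coord; exact: sb.
- by move=> q; exact: prodr_ge0.
- move=> q i qi; rewrite (bigD1 i)//= bout ?mul0r//.
  apply/negP => /andP[q0 q3]; move: qi; rewrite gtr0_norm// ltNge => /negP; apply.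
  exact: ltW.
- by apply: prodr_gt0 => i _; rewrite mxE.
Qed.

(** For a constant the flux is 0 and the inequality reads f(a) l(0) times the integral of a bump <=
    0, impossible for a > 0. *)
Lemma constant_solution_zero (phi f l : R -> R) (u : Hpoint R m -> R) (a : R) :
  {within `[0, +oo[, continuous phi} -> phi 0 = 0 ->
  {within `[0, +oo[, continuous f} -> {within `[0, +oo[, continuous l} ->
  (forall t : R, 0 < t -> 0 < f t) -> 0 < l 0 ->
  weak_subsolution phi f l u -> (forall q, 0 <= u q) -> (forall q, u q = a) -> a = 0.
Proof.
move=> phi_cont phi0 f_cont l_cont f_gt0 l0 u_sol u_ge0 ua.
have a0 : 0 <= a by rewrite -(ua 0).
apply/eqP; apply: contraT => an0; have {an0}a0 : 0 < a by rewrite lt_def an0.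
have [zeta [L [q0 [L0 Cz z0 vz zq0]]]] := bump_exists.
have := weak_inequality_C1 phi_cont phi0 f_cont l_cont u_sol u_ge0 L0 Cz z0 vz.
have uE : u = fun=> a by exact/funext.
have part0 i q : partial i u q = 0.
  by apply: is_derive_partial; rewrite uE; exact: is_derive_cst.
have HX0 j q : HX j u q = 0 by rewrite /HX !part0 mulr0 addr0.
have HY0 j q : HY j u q = 0 by rewrite /HY !part0 mulr0 subr0.
have n0 q : hgrad_norm u q = 0.
  by rewrite /hgrad_norm /hgrad_dot big1 ?sqrtr0// => j _; rewrite HX0 HY0 !mulr0 addr0.
have E : test_integrand (fun q => f (u q) * l (hgrad_norm u q))
    (fun j => flux phi u (HX j u)) (fun j => flux phi u (HY j u)) zeta =
    fun q => f a * l 0 * zeta q.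
  apply/funext => q; rewrite /test_integrand big1 => [|j _].
    by rewrite addr0 n0 ua.
  by rewrite /flux HX0 HY0 !mulr0 !mul0r addr0.
rewrite E leNgt => /negP; case.
have fl0 : 0 < f a * l 0 by rewrite mulr_gt0// f_gt0.
apply: (@lebesgue_int_gt0 R _ L _ q0).
- move=> q; exact: (@contM R _ (fun=> f a * l 0) zeta q (@contC R _ _ _)
    (@Ck_continuous R _ 1 zeta Cz q)).
- exact: vanish_outMr.
- by move=> q; rewrite mulr_ge0// ltW.
- exact: mulr_gt0.
Qed.

End constant_solutions.

(** As [p] and [p'] are arbitrary, exchanging them gives constancy; negated, it yields a point [p]
    strictly below the supremum. *)
Lemma bounded_subsolution_le (R : realType) (m : nat) (hm : (1 <= m)%N)
  (phi f l : R -> R)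
  (phi_cont : {within `[0, +oo[, continuous phi})
  (phi_derivable : forall t : R, 0 < t -> derivable phi t 1)
  (dphi_cont : forall t : R, 0 < t -> {for t, continuous (derive1 phi)})
  (phi0 : phi 0 = 0)
  (dphi_gt0 : forall t : R, 0 < t -> 0 < derive1 phi t)
  (f_cont : {within `[0, +oo[, continuous f})
  (f_incr : forall s t : R, 0 <= s -> s < t -> f s < f t)
  (f_gt0 : forall t : R, 0 < t -> 0 < f t)
  (l_cont : {within `[0, +oo[, continuous l})
  (l_gt0 : forall t : R, 0 < t -> 0 < l t)
  (phi_o : phi t / l t @[t --> 0^'+] --> (0 : R))
  (D Lambda tau : R) (D_gt0 : 0 < D) (Lambda_gt0 : 0 < Lambda)
  (dphi_scale : forall s t : R, 0 < s <= 1 -> 0 < t ->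
     s * derive1 phi (s * t) <= D * s `^ tau * derive1 phi t)
  (l_scale : forall s t : R, 0 <= s <= 1 -> 0 <= t ->
     s `^ (1 + tau) * l t <= Lambda * l (s * t))
  (u : Hpoint R m -> R)
  (u_sol : weak_subsolution phi f l u)
  (u_ge0 : forall q, 0 <= u q)
  (U : R) (uU : forall q, u q <= U) (p p' : Hpoint R m) : u p' <= u p.
Proof.
rewrite leNgt; apply/negP => pp'.
have Cu q : C1at q u := (Ck1_C1at _).2 u_sol.1 q.
have cu : continuous u by move=> q; exact: (Cu q).1.
have phi_mono := phi_nondecreasing phi_cont phi_derivable dphi_gt0.
have phi_scl (s t : R) : 0 < s <= 1 -> 0 <= t -> phi (s * t) <= D * s `^ tau * phi t.
  exact: phi_scale.
have hsup : has_sup (range u).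
  by split; [exists (u p); exists p|exists U => _ [q _ <-]].
pose V := sup (range u).
have uV q : u q <= V by apply: (sup_upper_bound hsup); exists q.
(* V - kappa is midway between u(p) and the supremum, hence positive, and [u] stays below it near
   [p]. *)
pose kappa := (V - u p) / 2.
have kappa0 : 0 < kappa by rewrite divr_gt0// subr_gt0 (lt_le_trans pp').
have upE : V - kappa = u p + kappa by rewrite /kappa; field.
have [r r0 ur] : exists2 r : R, 0 < r &
    forall q : Hpoint R m, (forall i, `|q 0 i - p 0 i| < r) -> u q < V - kappa.
  apply: nbhs_cube; apply: (@cvgr_lt R _ (nbhs p) _ u (u p)); first exact: cu.
  by rewrite upE ltrDl.
have [C [B [B0 Bp axis]]] := three_centres p (Ordinal hm) r0.
have [qt uqt] : exists q, V - kappa / 2 < u q.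
  by have [_ [q _ <-]] := sup_adherent (divr_gt0 kappa0 (ltr0Sn R 1)) hsup; exists q.
pose f1 := f (V - kappa).
have V0 : 0 < V - kappa by rewrite upE; apply: ltr_wpDl.
have f10 : 0 < f1 by exact: f_gt0.
pose k : R := 2 * m%:R + 1.
have k0 : 0 < k by rewrite ltr_wpDl// mulr_ge0.
pose K := k * D * Lambda / B.
have K0 : 0 < K by rewrite divr_gt0// !mulr_gt0.
(* Bounds all three gauges at [qt], where u > V - kappa/2; delta S < kappa/2 then puts every maximum
   above V - kappa. *)
pose S := 1 + \sum_i gr (C i) qt.
have S0 : 0 < S by rewrite ltr_pwDl// sumr_ge0// => i _; exact: gr_ge0.
have [delta [d0 dS dK]] : exists delta : R,
    [/\ 0 < delta, delta < kappa / 2 / S & phi delta / l delta < f1 / K].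
  have dS0 : 0 < kappa / 2 / S by rewrite divr_gt0// divr_gt0.
  have fK0 : 0 < f1 / K by exact: divr_gt0.
  near (0:R)^'+ => d; exists d; split; near: d.
  - exact: nbhs_right_gt.
  - exact: nbhs_right_lt.
  - exact: (@cvgr_lt R R (at_right 0) _ (fun t => phi t / l t) 0 phi_o).
pose w i q := u q - delta * gr (C i) q.
have /choice[qm qmax] : forall i, exists y, forall q, w i q <= w i y.
  by move=> i; exact: (max_attained (C i) cu uU d0).
pose M i := w i (qm i).
have [i0 _ i0max] := @arg_maxP _ _ 'I_3 ord0 predT M isT.
have wqt : V - kappa < M i0.
  apply: lt_le_trans (qmax i0 qt); rewrite /w.
  have : delta * gr (C i0) qt < kappa / 2.
    apply: le_lt_trans (_ : delta * S < _); last by rewrite -ltr_pdivlMr.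
    rewrite ler_pM2l// /S (bigD1 i0)//= addrCA lerDl addr_ge0//.
    by apply: sumr_ge0 => i _; exact: gr_ge0.
  move: (delta * gr _ _) (u qt) uqt; clearbody V kappa => x y uqt xk.
  clear -uqt xk; lra.
have [L wL] := superlevel_bounded (C i0) (M i0 - 1) uU d0.
apply: (comparison_max phi_cont phi_derivable dphi_cont phi0 phi_mono f_cont l_cont
  u_sol u_ge0 d0 (c := C i0) (M := M i0) (L := L)).
- exact: qmax.
- by exists (qm i0).
- exact: wL.
move=> q wq.
have uq : V - kappa < u q.
  by apply: (lt_le_trans wqt); rewrite -wq lerBlDr lerDl mulr_ge0 ?gr_ge0 ?ltW.
have Bq : B < gr (C i0) q.
  rewrite ltNge; apply/negP => /Bp /ur; rewrite ltNge => /negP; apply; exact: ltW.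
(* On its own axis q would be strictly closer to another centre, whose maximum would then exceed the
   largest one. *)
have rho0 : 0 < grho (C i0) q.
  rewrite lt_def grho_ge0 andbT; apply/eqP => /axis /(_ Bq)[j jq].
  suff : M i0 < M j by rewrite ltNge => /negP; apply; exact: i0max.
  apply: lt_le_trans (qmax j q); rewrite -wq /w ltrD2l ltrN2.
  by rewrite ltr_pM2l.
split=> //.
have N0 := gN_gt0 rho0.
have Cv : C1at q (fun q => delta * gr (C i0) q).
  by apply: (@C1at_mul R _ q (fun=> delta)); [exact: C1at_cst|exact: C1at_gr].
have -> : hgrad_norm u q = delta * (gsigma (C i0) q / gr (C i0) q).
  rewrite -hgrad_norm_gr//; apply: hgrad_norm_eq_at_max => // q'.
  by rewrite wq; exact: qmax.
have small : k * D * Lambda / B * (phi delta / l delta) < f1.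
  by rewrite mulrC -ltr_pdivlMr.
have b := radial_bound phi_mono phi0 l_gt0 (ltW k0) D_gt0 Lambda_gt0 phi_scl l_scale
  d0 B0 Bq rho0 small.
apply: (lt_le_trans b); rewrite ler_wpM2r//.
  apply/ltW/l_gt0; rewrite mulr_gt0// divr_gt0 ?sqrtr_gt0//; exact: lt_trans Bq.
by apply: ltW; apply: f_incr => //; exact: ltW.
Unshelve. all: by end_near. Qed.
Theorem theorem5p1 (R : realType) (m : nat) (hm : (1 <= m)%N)
  (phi f l : R -> R)
  (phi_cont : {within `[0, +oo[, continuous phi})
  (phi_derivable : forall t : R, 0 < t -> derivable phi t 1)
  (dphi_cont : forall t : R, 0 < t -> {for t, continuous (derive1 phi)})
  (phi0 : phi 0 = 0)
  (dphi_gt0 : forall t : R, 0 < t -> 0 < derive1 phi t)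
  (f_cont : {within `[0, +oo[, continuous f})
  (f_incr : forall s t : R, 0 <= s -> s < t -> f s < f t)
  (f_gt0 : forall t : R, 0 < t -> 0 < f t)
  (l_cont : {within `[0, +oo[, continuous l})
  (l_gt0 : forall t : R, 0 < t -> 0 < l t)
  (C : R) (C_ge1 : 1 <= C)
  (l_monotone : C_monotone_nondecreasing C l)
  (int_0 : L1_right_of_0 (fun t => t * derive1 phi t / l t))
  (nint_oo : ~ L1_near_pinfty (fun t => t * derive1 phi t / l t))
  (phi_o : phi t / l t @[t --> 0^'+] --> (0 : R))
  (D Lambda tau : R) (D_gt0 : 0 < D) (Lambda_gt0 : 0 < Lambda)
  (tau_ge0 : 0 <= tau)
  (dphi_scale : forall s t : R, 0 < s <= 1 -> 0 < t ->
     s * derive1 phi (s * t) <= D * s `^ tau * derive1 phi t)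
  (l_scale : forall s t : R, 0 <= s <= 1 -> 0 <= t ->
     s `^ (1 + tau) * l t <= Lambda * l (s * t))
  (u : Hpoint R m -> R)
  (u_sol : weak_subsolution phi f l u)
  (u_ge0 : forall q, 0 <= u q)
  (u_bounded : exists M : R, forall q, u q <= M) :
  (exists c : R, forall q, u q = c) /\ (0 < l 0 -> forall q, u q = 0).
Proof.
have [U uU] := u_bounded.
have le q q' : u q' <= u q.
  exact: (bounded_subsolution_le hm phi_cont phi_derivable dphi_cont phi0 dphi_gt0 f_cont
    f_incr f_gt0 l_cont l_gt0 phi_o D_gt0 Lambda_gt0 dphi_scale l_scale u_sol u_ge0 uU).
have uE q : u q = u 0 by apply/eqP; rewrite eq_le !le.
split=> [|l0 q]; first by exists (u 0).
rewrite uE; exact: (constant_solution_zero phi_cont phi0 f_cont l_cont f_gt0 l0 u_sol u_ge0 uE).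
Qed.
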